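(* Let $\alpha=\frac{M}{N}\pi$ for integers $M,N$ with $2M/N\notin\mathbb Z$, and let $\gamma=-2\cos(2\alpha)$. Then the series $t$, expressed as a formal power series in $\mathsf R=\mathsf R(t,\gamma)$ (i.e. the compositional inverse of $\mathsf R(t,\gamma)$), is D-finite: it satisfies a non-trivial linear differential equation in $\mathsf R$ with coefficients polynomial in $\mathsf R$.
   Context: $\mathsf R(t,\gamma)$ is defined as follows. Let $\theta(z,q)=2\sin(z)q^{1/8}\prod_{n\ge1}(1-2\cos(2z)q^n+q^{2n})(1-q^n)$, with derivatives in $z$. Let $q=q(t)=t+O(t^2)$ be the unique formal power series with zero constant term satisfying $t=\frac{\cos\alpha}{64\sin^3\alpha}\left(-\frac{\theta(\alpha,q)\theta'''(\alpha,q)}{\theta'(\alpha,q)^2}+\frac{\theta''(\alpha,q)}{\theta'(\alpha,q)}\right)$, and set $\mathsf R(t,\gamma)=\frac{\cos^2\alpha}{96\sin^4\alpha}\frac{\theta(\alpha,q)^2}{\theta'(\alpha,q)^2}\left(-\frac{\theta'''(\alpha,q)}{\theta'(\alpha,q)}+\frac{\theta'''(0,q)}{\theta'(0,q)}\right)$. Then $\mathsf R=t+O(t^2)$, so $t$ is a formal power series in $\mathsf R$. *)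

(* Defs.v *)
From HB Require Import structures.
From mathcomp Require Import all_boot all_order all_algebra.
From mathcomp Require Import all_classical all_reals.
From mathcomp Require Import topology normedtype derive trigo.
Set Implicit Arguments. Unset Strict Implicit. Unset Printing Implicit Defensive.
Import Order.TTheory GRing.Theory Num.Theory.
Local Open Scope ring_scope.

Section FPS.
Variable R : realType.

Definition fps := nat -> R.

Definition sone : fps := fun k => (k == 0)%:R.
Definition sadd (a b : fps) : fps := fun k => a k + b k.
Definition sopp (a : fps) : fps := fun k => - a k.
Definition sscale (c : R) (a : fps) : fps := fun k => c * a k.
Definition smul (a b : fps) : fps := fun k => \sum_(i < k.+1) a i * b (k - i)%N.

(* multiplicative inverse of a series with nonzero constant term:
   b_0 = 1/a_0,  b_k = -(1/a_0) * sum_{i=1}^k a_i b_{k-i}. *)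
Fixpoint sinv_aux (a : fps) (n : nat) : seq R :=
  match n with
  | 0 => [:: (a 0)^-1]
  | n'.+1 => let s := sinv_aux a n' in
      rcons s (- (a 0)^-1 * \sum_(1 <= i < n'.+2) a i * nth 0 s (n'.+1 - i)%N)
  end.
Definition sinv (a : fps) : fps := fun k => nth 0 (sinv_aux a k) k.
Definition sdiv (a b : fps) : fps := smul a (sinv b).

(* powers and composition T(S) (meaningful when S 0 = 0) *)
Definition spow (S : fps) (j : nat) : fps := iter j (smul S) sone.
Definition scomp (T S : fps) : fps :=
  fun k => \sum_(j < k.+1) T j * spow S j k.

Definition sder (a : fps) : fps := fun k => k.+1%:R * a k.+1.
Definition spmul (p : {poly R}) (a : fps) : fps :=
  fun k => \sum_(j < k.+1) p`_j * a (k - j)%N.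

Definition Dfinite (T : fps) : Prop :=
  exists (d : nat) (P : nat -> {poly R}),
    (exists2 i, (i <= d)%N & P i != 0) /\
    forall k, \sum_(i < d.+1) spmul (P i) (iter i sder T) k = 0.

(* theta(z,q) without the factor q^(1/8):
   2 sin z * prod_{n>=1} (1 - 2cos(2z) q^n + q^(2n)) (1 - q^n).
   The coefficient of q^k only involves factors with n <= k. *)
Definition thetaP (z : R) (m : nat) : {poly R} :=
  (2 * sin z)%:P *
  \prod_(1 <= n < m.+1) ((1 - (2 * cos (2 * z))%:P * 'X^n + 'X^(2 * n)) * (1 - 'X^n)).
Definition thetac (k : nat) : R -> R := fun z => (thetaP z k)`_k.

Definition theta (j : nat) (z : R) : fps := fun k => @derive1n R R^o j (thetac k) z.

Definition alphaMN (M N : int) : R := M%:~R / N%:~R * pi.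

Definition tser (a : R) : fps :=
  sscale (cos a / (64 * sin a ^+ 3))
    (sadd (sopp (sdiv (smul (theta 0 a) (theta 3 a)) (smul (theta 1 a) (theta 1 a))))
          (sdiv (theta 2 a) (theta 1 a))).

Definition Rser (a : R) : fps :=
  sscale (cos a ^+ 2 / (96 * sin a ^+ 4))
    (smul (sdiv (smul (theta 0 a) (theta 0 a)) (smul (theta 1 a) (theta 1 a)))
          (sadd (sopp (sdiv (theta 3 a) (theta 1 a)))
                (sdiv (theta 3 0) (theta 1 0)))).

End FPS.

(* Main.v *)
Require Import Defs.
From HB Require Import structures.
From mathcomp Require Import all_boot all_order all_algebra.
From mathcomp Require Import all_classical all_reals.
From mathcomp Require Import topology normedtype derive trigo.
From mathcomp Require Import ring zify.
Set Implicit Arguments. Unset Strict Implicit. Unset Printing Implicit Defensive.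
Import Order.TTheory GRing.Theory Num.Theory.
Local Open Scope ring_scope.

(** Write D for q d/dq, A for the logarithmic z-derivative of theta at alpha and
    P, P', P'' for the values at alpha of the Weierstrass function and its derivatives, so that A,
    P, P' and s = P''/P' are (quasi)modular of weights 1, 2, 3, 1; let eps be the Eisenstein series
    of weight 2 given by theta'''(0)/(3 theta'(0)). The heat equation makes R[A, P, P', s, eps]
    stable under D, the series Rser is a rational function of the weight 0 quantities X = P/s^2,
    Y = P'/s^3 and a = A/s, and tser is a combination of s and eps/s with coefficients rational in
    X, Y, a. Moreover d/dRser = D/(D Rser) maps the span of s and eps/s over R(X, Y, a) to itself.
    Since alpha is a torsion point, the addition theorem shows that a is rational in X and Y and
    that X, Y satisfy a polynomial relation; the relation is nontrivial because it fails for a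
    cuspidal curve, whose smooth points have infinite order. Hence, after clearing denominators,
    the series Rser^j (d/dRser)^i tser with i <= m, j <= n lie in a space of dimension
    O(m + n), and for large m, n there is a linear relation between these (m+1)(n+1) series:
    this is the differential equation. *)

(** Both [Rser] and [tser] are series in q; t as a series in Rser is the [T] with T(Rser) = tser,
    and d/dRser acts on composites T(Rser) by the chain rule. In formal series only the period pi of
    theta is visible, and neither convergence nor Liouville's theorem is at hand. All elliptic
    function theory is therefore drawn from one bilinear identity: Jacobi's triple product turns
    theta into an alternating sine series, and sorting the double series of theta(x + y) theta(x -
    y) by parity makes it a 2 x 2 determinant. Its derivatives give the addition and duplication
    theorems and wp'' = 6 wp^2 - g2/2. The generators are dictated by the heat equation: for a
    quantity u of weight w among s, P, P', P'', D u contains the term -(w/4) eps u. Hence eps drops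
    out of D X and D Y, while in D(eps/s) the terms in eps^2 cancel. The dimension count needs R(X,
    Y, a) to have transcendence degree at most 1 over R, and it is torsion that provides the two
    relations. To see that the relation between X and Y is nontrivial, every rational expression is
    evaluated in parallel at a point of the cuspidal curve. *)

(* fps R unfolds to a function type, which already carries the pointwise ring structure. *)
Definition ps (R : realType) : Type := fps R.

HB.instance Definition _ (R : realType) := GRing.Zmodule.copy (ps R) (nat -> R).

(** * The ring of power series *)

Section PowerSeriesRing.
Variable R : realType.
Implicit Types a b c : ps R.

Definition trunc (n : nat) (a : nat -> R) : {poly R} := \poly_(i < n) a i.

Lemma psP a b : (forall k, a k = b k) -> a = b.
Proof. by move=> ab; apply/funext. Qed.

Lemma smul_trunc (n k : nat) a b : (k < n)%N ->
  smul a b k = (trunc n a * trunc n b)`_k.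
Proof.
move=> kn; rewrite coefM; apply: eq_bigr => i _; rewrite !coef_poly.
by rewrite (leq_trans (ltn_ord i) kn) (leq_ltn_trans (leq_subr _ _) kn).
Qed.

Lemma trunc_smul (n k : nat) a b : (k < n)%N ->
  (trunc n (smul a b))`_k = (trunc n a * trunc n b)`_k.
Proof. by move=> kn; rewrite coef_poly kn; exact: smul_trunc. Qed.

Lemma smulC : commutative (@smul R : ps R -> ps R -> ps R).
Proof. by move=> a b; apply/psP => k; rewrite !(@smul_trunc k.+1)// mulrC. Qed.

Lemma smulA : associative (@smul R : ps R -> ps R -> ps R).
Proof.
move=> a b c; apply/psP => k.
rewrite !(@smul_trunc k.+1)// 2!coefM.
transitivity ((trunc k.+1 a * trunc k.+1 b * trunc k.+1 c)`_k).
  rewrite -mulrA coefM; apply: eq_bigr => i _.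
  by rewrite trunc_smul// ltnS leq_subr.
by rewrite coefM; apply: eq_bigr => i _; rewrite trunc_smul.
Qed.

Lemma smul1 : left_id (sone R : ps R) (@smul R : ps R -> ps R -> ps R).
Proof.
move=> a; apply/psP => k; rewrite /smul big_ord_recl big1 ?addr0 /sone /= ?mul1r ?subn0//.
by move=> i _; rewrite mul0r.
Qed.

Lemma smulDl : left_distributive (@smul R : ps R -> ps R -> ps R) +%R.
Proof.
move=> a b c; apply/psP => k; rewrite [RHS]/= /GRing.add/= /smul -big_split/=.
by apply: eq_bigr => i _; rewrite -mulrDl.
Qed.

Lemma sone_neq0 : (sone R : ps R) != 0.
Proof. by apply/eqP => /(congr1 (fun a : ps R => a 0)) /eqP; rewrite /sone eqxx oner_eq0. Qed.

HB.instance Definition _ := GRing.Zmodule_isComNzRing.Build (ps R) smulA smulC smul1 smulDl sone_neq0.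

Lemma psM a b k : (a * b) k = \sum_(i < k.+1) a i * b (k - i)%N.
Proof. by []. Qed.

Lemma psM0 a b : (a * b) 0 = a 0 * b 0.
Proof. by rewrite psM big_ord1. Qed.

Lemma psM1 a b : (a * b) 1 = a 0 * b 1 + a 1 * b 0.
Proof. by rewrite psM big_ord_recr big_ord1. Qed.

Lemma psD a b k : (a + b) k = a k + b k. Proof. by []. Qed.
Lemma psN a k : (- a) k = - a k. Proof. by []. Qed.
Lemma psB a b k : (a - b) k = a k - b k. Proof. by []. Qed.
Lemma psE0 k : (0 : ps R) k = 0. Proof. by []. Qed.
Lemma psE1 k : (1 : ps R) k = (k == 0)%:R. Proof. by []. Qed.
Lemma ps_sum (I : Type) (r : seq I) (P : pred I) (F : I -> ps R) k :
  (\sum_(i <- r | P i) F i) k = \sum_(i <- r | P i) F i k.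
Proof. by elim/big_ind2: _ => // a x b y <- <-. Qed.
Lemma psMn a n k : (a *+ n) k = a k *+ n.
Proof. by elim: n => // n IH; rewrite !mulrS -IH. Qed.

Lemma size_sinv_aux a n : size (sinv_aux a n) = n.+1.
Proof. by elim: n => //= n IH; rewrite size_rcons IH. Qed.

Lemma nth_sinv_aux a n k : (k <= n)%N -> nth 0 (sinv_aux a n) k = sinv a k.
Proof.
elim: n => [|n IH]; first by rewrite leqn0 => /eqP ->.
rewrite leq_eqVlt => /orP[/eqP ->//|kn].
by rewrite /= nth_rcons size_sinv_aux kn IH.
Qed.

Lemma sinvS a n : sinv a n.+1 = - (a 0)^-1 * \sum_(i < n.+1) a i.+1 * sinv a (n - i)%N.
Proof.
rewrite /sinv /= nth_rcons size_sinv_aux ltnn eqxx; congr (_ * _).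
rewrite big_add1 big_mkord; apply: eq_bigr => i _.
by rewrite subSS nth_sinv_aux// leq_subr.
Qed.

Definition psunit : pred (ps R) := fun a => a 0 != 0.
Definition psinv a : ps R := if psunit a then sinv a else a.

Lemma mul_sinv a : a 0 != 0 -> (sinv a : ps R) * a = 1.
Proof.
move=> a0; rewrite mulrC; apply/psP => -[|n].
  by rewrite psM0 psE1 /sinv/= mulfV.
rewrite psM big_ord_recl /= subn0 sinvS mulrA mulrN mulfV// mulN1r psE1/=.
by apply/eqP; rewrite addrC subr_eq0; apply/eqP/eq_bigr => i _.
Qed.

Lemma psmulVr : {in psunit, left_inverse 1 psinv *%R}.
Proof. by move=> a au; rewrite /psinv (_ : psunit a = true)// mul_sinv. Qed.

Lemma psunitP a b : b * a = 1 -> psunit a.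
Proof.
move=> /(congr1 (fun a : ps R => a 0)); rewrite psM0 psE1/= => ba.
by apply: contra_eq_neq ba => ->; rewrite mulr0 eq_sym oner_eq0.
Qed.

Lemma psinv_out : {in [predC psunit], psinv =1 id}.
Proof. by move=> a au; rewrite /psinv (_ : psunit a = false)//; apply/negbTE. Qed.

HB.instance Definition _ := GRing.ComNzRing_hasMulInverse.Build (ps R) psmulVr psunitP psinv_out.

Lemma ps_unitE a : (a \is a GRing.unit) = (a 0 != 0). Proof. by []. Qed.

Lemma sinvE a : a 0 != 0 -> sinv a = a^-1.
Proof. by move=> a0; rewrite /GRing.inv/= /psinv /psunit a0. Qed.

Lemma ps_leadP a : a != 0 -> exists n, a n != 0 /\ forall k, (k < n)%N -> a k = 0.
Proof.
move=> a0; have /ex_minnP[n an nmin] : exists n, a n != 0.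
  apply: contrapT => H; case/eqP: a0; apply/psP => k; apply/eqP/negPn/negP => ak.
  by apply: H; exists k.
exists n; split => // k kn; apply/eqP/negPn/negP => /nmin.
by rewrite leqNgt kn.
Qed.

Lemma ps_domain a b : a * b = 0 -> (a == 0) || (b == 0).
Proof.
move=> ab0; apply/negPn/negP; rewrite negb_or => /andP[/ps_leadP[n [an na]] /ps_leadP[m [bm mb]]].
move: ab0 => /(congr1 (fun a : ps R => a (n + m)%N)); rewrite psM psE0.
have nm : (n < (n + m).+1)%N by rewrite ltnS leq_addr.
rewrite (bigD1 (Ordinal nm))//= addKn big1 => [|i /eqP ni].
  by rewrite addr0; apply/eqP; rewrite mulf_neq0.
case: (ltngtP i n) => [/na ->|ni'|ni']; first by rewrite mul0r.
  by rewrite mb ?mulr0//; move: (ltn_ord i) ni'; lia.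
by exfalso; apply: ni; apply: val_inj.
Qed.

HB.instance Definition _ := GRing.ComUnitRing_isIntegral.Build (ps R) ps_domain.

Definition pcst (c : R) : ps R := fun k => if k == 0 then c else 0.

Lemma pcstM (c : R) a k : (pcst c * a) k = c * a k.
Proof.
by rewrite psM big_ord_recl big1 ?addr0 /pcst /= ?subn0// => i _; rewrite mul0r.
Qed.

Lemma pcst_zmod : zmod_morphism pcst.
Proof. by move=> c d; apply/psP => -[|k] //=; rewrite psB/= subr0. Qed.

Lemma pcst_monoid : monoid_morphism pcst.
Proof.
split; first by apply/psP => -[|k].
by move=> c d; apply/psP => k; rewrite pcstM /pcst; case: eqP => // _; rewrite mulr0.
Qed.

HB.instance Definition _ := GRing.isZmodMorphism.Build R (ps R) pcst pcst_zmod.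
HB.instance Definition _ := GRing.isMonoidMorphism.Build R (ps R) pcst pcst_monoid.

Lemma sscaleE (c : R) a : sscale c a = pcst c * a.
Proof. by apply/psP => k; rewrite pcstM. Qed.

Lemma psnat0 n : (n%:R : ps R) 0 = n%:R.
Proof. by rewrite psMn psE1. Qed.

Lemma psnat_unit n : (n.+1%:R : ps R) \is a GRing.unit.
Proof. by rewrite ps_unitE psnat0 pnatr_eq0. Qed.

Lemma psnat_neq0 n : (n.+1%:R : ps R) != 0.
Proof. by apply: contraTneq (psnat_unit n) => ->; rewrite unitr0. Qed.

Definition qD a : ps R := fun k => k%:R * a k.

Definition qX : ps R := fun k => (k == 1)%:R.

Lemma qXM a k : (qX * a) k.+1 = a k.
Proof.
rewrite psM big_ord_recl big_ord_recl big1 ?addr0 /qX /= ?mul0r ?mul1r ?add0r//.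
  by rewrite /bump /= subSS subn0.
by move=> i _; rewrite /bump/= mul0r.
Qed.

Definition pder a : ps R := sder a.

Lemma qDE a : qD a = qX * pder a.
Proof.
by apply/psP => -[|k]; rewrite ?qXM// psM0 /qD /qX/= !mul0r.
Qed.

Lemma qX_neq0 : qX != 0.
Proof. by apply/eqP => /(congr1 (fun a : ps R => a 1)) /eqP; rewrite /qX/= oner_eq0. Qed.

Lemma qD_add a b : qD (a + b) = qD a + qD b.
Proof. by apply/psP => k; rewrite /qD !psD mulrDr. Qed.

Lemma qD_mul a b : qD (a * b) = qD a * b + a * qD b.
Proof.
apply/psP => k; rewrite /qD psD !psM big_distrr -big_split/=.
apply: eq_bigr => i _.
have -> : k%:R = (k - i)%:R + i%:R :> R by rewrite -natrD subnK// -ltnS.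
by set x := (k - i)%:R; ring.
Qed.

Lemma qD_cst (c : R) : qD (pcst c) = 0.
Proof. by apply/psP => -[|k]; rewrite /qD /pcst/= ?mul0r ?mulr0. Qed.

(** The operator q d/dq is diagonal on coefficients, so its Leibniz rule is immediate; cancelling q
    in the domain [ps R] gives the rule for d/dq. *)
Lemma pder_mul a b : pder (a * b) = pder a * b + a * pder b.
Proof.
by apply: (mulfI qX_neq0); rewrite -qDE qD_mul !qDE; ring.
Qed.

Lemma pder_add a b : pder (a + b) = pder a + pder b.
Proof. by apply/psP => k; rewrite /pder /sder psD mulrDr. Qed.

Lemma pder_cst (c : R) : pder (pcst c) = 0.
Proof. by apply: (mulfI qX_neq0); rewrite -qDE qD_cst mulr0. Qed.

End PowerSeriesRing.

(** * Composition of power series and the chain rule *)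

Section Composition.
Variable R : realType.
Implicit Types a b S T : ps R.

Lemma ps_eval a b k : a = b -> a k = b k.
Proof. by move->. Qed.

Lemma psM_eq a b b' k : (forall i, (i <= k)%N -> b i = b' i) -> (a * b) k = (a * b') k.
Proof. by move=> bb; rewrite !psM; apply: eq_bigr => i _; rewrite bb// leq_subr. Qed.

Lemma spowE S j : spow S j = S ^+ j.
Proof. by elim: j => [//|j IH]; rewrite exprS -IH. Qed.

Lemma ps_exp_low S j k : S 0 = 0 -> (k < j)%N -> (S ^+ j) k = 0.
Proof.
move=> S0; elim: j k => // j IH k kj; rewrite exprS psM big_ord_recl S0 mul0r add0r.
by rewrite big1// => i _; rewrite IH ?mulr0// lift0; move: (ltn_ord i) kj; lia.
Qed.

Lemma ps_exp_diag S k : S 0 = 0 -> (S ^+ k) k = S 1 ^+ k.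
Proof.
move=> S0; elim: k => [//|k IH]; rewrite exprS psM big_ord_recl S0 mul0r add0r.
rewrite big_ord_recl lift0 subSS subn0 IH exprS big1 ?addr0// => i _.
by rewrite ps_exp_low ?mulr0// !lift0; move: (ltn_ord i); lia.
Qed.

Definition pcomp T S : ps R := scomp T S.

(** As [S ^+ j] has order at least j, a composite agrees up to degree n with a finite sum in the
    ring [ps R], at any cut-off n >= k. Statements on composition thus reduce to ring identities. *)
Lemma pcompE T S n k : S 0 = 0 -> (k <= n)%N ->
  pcomp T S k = (\sum_(j < n.+1) pcst (T j) * S ^+ j) k.
Proof.
move=> S0 kn; rewrite ps_sum /pcomp /scomp.
rewrite -(subnKC kn) -addSn big_split_ord/= [X in _ = _ + X]big1 ?addr0 => [|i _].
  by apply: eq_bigr => i _; rewrite pcstM spowE.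
by rewrite pcstM ps_exp_low ?mulr0//; lia.
Qed.

Lemma pcompD T T' S : pcomp (T + T') S = pcomp T S + pcomp T' S.
Proof.
apply/psP => k; rewrite psD /pcomp /scomp -big_split/=.
by apply: eq_bigr => i _; rewrite psD mulrDl.
Qed.

Lemma pcomp0 S : pcomp 0 S = 0.
Proof. by apply/psP => k; rewrite /pcomp /scomp big1// => i _; rewrite psE0 mul0r. Qed.

Lemma pcomp_sum (n : nat) (F : nat -> ps R) S :
  pcomp (\sum_(i < n) F i) S = \sum_(i < n) pcomp (F i) S.
Proof.
elim: n => [|n IH]; first by rewrite !big_ord0 pcomp0.
by rewrite !big_ord_recr pcompD IH.
Qed.

Lemma pcompZ (c : R) T S : pcomp (pcst c * T) S = pcst c * pcomp T S.
Proof.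
apply/psP => k; rewrite pcstM /pcomp /scomp big_distrr/=.
by apply: eq_bigr => i _; rewrite pcstM mulrA.
Qed.

Lemma pcomp_qX T S : S 0 = 0 -> pcomp (qX R * T) S = S * pcomp T S.
Proof.
move=> S0; apply/psP => k; rewrite (@pcompE _ _ k.+1)// big_ord_recl.
rewrite psM0 {1}/qX/= mul0r rmorph0 mul0r add0r.
transitivity ((S * \sum_(j < k.+1) pcst (T j) * S ^+ j) k).
  apply: (@ps_eval _ _ k); rewrite big_distrr; apply: eq_bigr => i _.
  by rewrite /bump add1n qXM exprS /= mulrCA.
by apply: psM_eq => i ik; rewrite (@pcompE _ _ k).
Qed.

(** Substituting S turns a polynomial coefficient of a differential equation for T into the same
    polynomial evaluated at S. *)
Lemma pcomp_spmul (p : {poly R}) T S : S 0 = 0 ->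
  pcomp (spmul p T) S = (map_poly (@pcst R) p).[S] * pcomp T S.
Proof.
move=> S0; pose c (p : {poly R}) : ps R := fun j => p`_j.
have -> : spmul p T = (c p * T : ps R) by [].
elim/poly_ind: p => [|p x IH].
  have -> : c 0 = 0 by apply/psP => k; rewrite /c coef0.
  by rewrite rmorph0 horner0 !mul0r pcomp0.
have -> : c (p * 'X + x%:P) = qX R * c p + pcst x.
  apply/psP => -[|k]; rewrite psD ?qXM ?psM0 /c coefD coefMX coefC/=.
    by rewrite /qX/= mul0r.
  by [].
rewrite mulrDl -mulrA pcompD pcomp_qX// IH pcompZ.
by rewrite rmorphD rmorphM/= map_polyX map_polyC/= hornerMXaddC mulrDl mulrAC (mulrC S).
Qed.

Lemma pder_exp S j : pder (S ^+ j.+1) = j.+1%:R * S ^+ j * pder S.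
Proof.
elim: j => [|j IH]; first by rewrite expr1 expr0 !mul1r.
by rewrite exprS pder_mul IH -[j.+2]addn1 natrD (exprS _ j); ring.
Qed.

Lemma pder_sum (n : nat) (F : nat -> ps R) :
  pder (\sum_(i < n) F i) = \sum_(i < n) pder (F i).
Proof.
elim: n => [|n IH]; last by rewrite !big_ord_recr pder_add IH.
by rewrite !big_ord0; apply/psP => k; rewrite /pder /sder mulr0.
Qed.

Lemma pder_comp T S : S 0 = 0 -> pder (pcomp T S) = pcomp (pder T) S * pder S.
Proof.
move=> S0; apply/psP => k.
have -> : pder (pcomp T S) k = pder (\sum_(j < k.+2) pcst (T j) * S ^+ j) k.
  by rewrite /pder /sder (@pcompE _ _ k.+1).
rewrite (pder_sum k.+2 (fun j => pcst (T j) * S ^+ j)) big_ord_recl.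
rewrite expr0 mulr1 pder_cst add0r mulrC.
have <- : (pder S * \sum_(j < k.+1) pcst (pder T j) * S ^+ j) k = (pder S * pcomp (pder T) S) k.
  by apply: psM_eq => i ik; rewrite (@pcompE _ _ k).
apply: (@ps_eval _ _ k); rewrite big_distrr; apply: eq_bigr => i _.
rewrite lift0 [X in _ = X]/= pder_mul pder_cst mul0r add0r pder_exp.
have -> : pder T i = i.+1%:R * T i.+1 by [].
rewrite rmorphM/= rmorph_nat.
by ring.
Qed.

(** The coefficients of T(S) depend on those of T through a triangular system with diagonal entries
    [S 1 ^+ k]. *)
Lemma pcomp_inj T S : S 0 = 0 -> S 1 != 0 -> pcomp T S = 0 -> T = 0.
Proof.
move=> S0 S1 TS; apply/psP; elim/ltn_ind => k IH.
move: (congr1 (fun a : ps R => a k) TS); rewrite /pcomp /scomp big_ord_recr big1/=.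
  rewrite add0r spowE ps_exp_diag// => /eqP; rewrite mulf_eq0 expf_eq0 (negbTE S1) andbF orbF.
  by move=> /eqP.
by move=> i _; rewrite IH// psE0 mul0r.
Qed.

Lemma pcomp_surj (t S : ps R) : S 0 = 0 -> S 1 != 0 -> exists T, pcomp T S = t.
Proof.
move=> S0 S1.
(* [s n] lists the first n coefficients of the solution; the next one solves row n of the triangular
   system, with diagonal entry [S 1 ^+ n]. *)
have [s sP] : exists s : nat -> seq R, forall n, size (s n) = n /\ s n.+1 =
    rcons (s n) ((t n - \sum_(j < n) (s n)`_j * spow S j n) / S 1 ^+ n).
  exists (fun n => iteri n (fun n s => rcons s ((t n - \sum_(j < n) s`_j * spow S j n) / S 1 ^+ n)) [::]).
  move=> n; split=> //; elim: n => //= n IH; by rewrite size_rcons IH.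
pose T : ps R := fun n => (s n.+1)`_n.
have sT : forall n j, (j < n)%N -> (s n)`_j = T j.
  elim=> // n IH j; rewrite ltnS leq_eqVlt => /orP[/eqP ->//|jn].
  by rewrite (sP n).2 nth_rcons (sP n).1 jn IH.
exists T; apply/psP => k; rewrite /pcomp /scomp big_ord_recr/= spowE ps_exp_diag//.
rewrite {2}/T (sP k).2 nth_rcons (sP k).1 ltnn eqxx divfK ?expf_neq0//.
have -> : \sum_(i < k) T i * spow S i k = \sum_(i < k) (s k)`_i * spow S i k.
  by apply: eq_bigr => j _; rewrite sT.
exact: subrKC.
Qed.

End Composition.

(** * A dimension count *)

Lemma kernel_nontrivial (K : fieldType) (T E : finType) (A : T -> E -> K) :
  (#|E| < #|T|)%N ->
  exists c : T -> K, (exists t, c t != 0) /\ forall e, \sum_t c t * A t e = 0.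
Proof.
move=> ET; pose M := \matrix_(i < #|T|, j < #|E|) A (enum_val i) (enum_val j).
have : kermx M != 0.
  by rewrite -mxrank_eq0 mxrank_ker -lt0n subn_gt0 (leq_ltn_trans (rank_leq_col M)).
move=> /rowV0Pn[v /sub_kermxP vM v0].
exists (fun t => v 0 (enum_rank t)); split.
  apply: contrapT => H; case/eqP: v0; apply/rowP => i; rewrite mxE; apply/eqP/negPn/negP => vi.
  by apply: H; exists (enum_val i); rewrite enum_valK.
move=> e; have := congr1 (fun N : 'M_(_, _) => N 0 (enum_rank e)) vM.
rewrite !mxE => {2}<-; rewrite (reindex (@enum_val _ T)) /=; last first.
  by apply: onW_bij; exact: enum_val_bij.
by apply: eq_bigr => i _; rewrite mxE enum_valK enum_rankK.
Qed.

(** * Linear dependence of bivariate polynomials modulo a relation *)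

Section Bidegree.
Variable K : fieldType.
Implicit Types p q : {poly {poly K}}.

Definition bdeg p (d : nat) := (size p <= d.+1)%N /\ forall i, (size (p`_i)%R <= d.+1)%N.

Lemma bdeg_le p d e : (d <= e)%N -> bdeg p d -> bdeg p e.
Proof.
move=> de [p1 p2]; split=> [|i]; first exact: leq_trans p1 _.
exact: leq_trans (p2 i) _.
Qed.

Lemma bdegD p q d : bdeg p d -> bdeg q d -> bdeg (p + q) d.
Proof.
move=> [p1 p2] [q1 q2]; split=> [|i].
  by rewrite (leq_trans (size_polyD _ _))// geq_max p1.
by rewrite coefD (leq_trans (size_polyD _ _))// geq_max p2 q2.
Qed.

Lemma bdegN p d : bdeg p d -> bdeg (- p) d.
Proof. by move=> [p1 p2]; split=> [|i]; rewrite ?coefN size_polyN. Qed.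

Lemma bdegM p q d e : bdeg p d -> bdeg q e -> bdeg (p * q) (d + e).
Proof.
move=> [p1 p2] [q1 q2]; split=> [|i].
  by rewrite (leq_trans (size_polyMleq _ _))//; lia.
rewrite coefM; apply: (big_ind (fun u : {poly K} => (size u <= (d + e).+1)%N)).
- by rewrite size_poly0.
- by move=> u v u1 v1; rewrite (leq_trans (size_polyD _ _))// geq_max u1.
- move=> j _; rewrite (leq_trans (size_polyMleq _ _))//.
  by move: (p2 j) (q2 (i - j)%N); lia.
Qed.

Lemma bdeg_ex p : exists d, bdeg p d.
Proof.
exists (size p + \sum_(i < size p) size (p`_i)%R)%N; split=> [|i]; first by lia.
case: (ltnP i (size p)) => ip; last by rewrite nth_default ?size_poly0.
by rewrite (bigD1 (Ordinal ip))//=; lia.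
Qed.

Lemma bdeg_deriv p d : bdeg p d -> bdeg p^`() d.
Proof.
move=> [p1 p2]; split=> [|i].
  have [-> |p0] := eqVneq p 0; first by rewrite linear0 size_poly0.
  by rewrite (leq_trans (ltnW (lt_size_deriv p0))).
rewrite coef_deriv; move: (p2 i.+1); move: (p`_i.+1) => u u2; elim: i.+1 => [|n IH]; first by rewrite mulr0n size_poly0.
by rewrite mulrSr (leq_trans (size_polyD _ _))// geq_max IH u2.
Qed.

Lemma bdeg_deriv_coef p d : bdeg p d -> bdeg (map_poly (@deriv K) p) d.
Proof.
move=> [p1 p2]; split=> [|i]; first by rewrite (leq_trans (size_poly _ _)).
rewrite coef_map_id0 ?linear0//.
have [-> |p0] := eqVneq p`_i 0; first by rewrite linear0 size_poly0.
by rewrite (leq_trans (ltnW (lt_size_deriv p0))).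
Qed.

Lemma bdeg1 : bdeg 1 0.
Proof.
by split=> [|i]; rewrite ?size_poly1// coef1; case: eqP; rewrite ?size_poly1 ?size_poly0.
Qed.

Lemma bdegXn p d n : bdeg p d -> bdeg (p ^+ n) (d * n).
Proof.
move=> pd; elim: n => [|n IH]; last by rewrite exprS mulnS; exact: bdegM.
by rewrite muln0 expr0; exact: bdeg1.
Qed.

Lemma bdegMn p d n : bdeg p d -> bdeg (p *+ n) d.
Proof.
move=> pd; elim: n => [|n IH]; last by rewrite mulrSr; exact: bdegD.
by split=> [|i]; rewrite ?coef0 size_poly0.
Qed.

Definition bmon i j : {poly {poly K}} := 'X^j *: 'X^i.

Lemma coef_bmon i j i' j' : (bmon i j)`_i'`_j' = ((i' == i) && (j' == j))%:R.
Proof. by rewrite coefZ !coefXn; case: eqP; rewrite ?mulr1 ?mulr0 ?coef0// coefXn. Qed.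

Lemma bdeg_bmon i j d : (i <= d)%N -> (j <= d)%N -> bdeg (bmon i j) d.
Proof.
move=> id jd; split=> [|k]; first by rewrite (leq_trans (size_scale_leq _ _))// size_polyXn.
rewrite coefZ coefXn; case: eqP => _; last by rewrite mulr0 size_poly0.
by rewrite mulr1 size_polyXn.
Qed.

(* The multiples p * w with w in a box of side d + 1 - k occupy all but O(d) dimensions of a box
   of side d + 1: this is where the algebraic relation between the two generators enters. *)
Lemma dependent_mod p (k d : nat) (I : finType) (G : bool -> I -> {poly {poly K}}) :
  p != 0 -> bdeg p k -> (k <= d)%N -> (forall b i, bdeg (G b i) d) ->
  (2 * d.+1 ^ 2 < #|I| + 2 * (d.+1 - k) ^ 2)%N ->
  exists c : I -> K, (exists i, c i != 0) /\
    forall b, exists w, \sum_i (c i)%:P%:P * G b i = p * w.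
Proof.
move=> p0 pk kd Gd card; set n := (d.+1 - k)%N.
(* The unknowns are the coefficients of the [G b i] and those of a cofactor of [p] for each of the
   two values of b; the equations are the coefficients in two boxes. *)
pose T : finType := (I + bool * ('I_n * 'I_n))%type.
pose E : finType := (bool * ('I_d.+1 * 'I_d.+1))%type.
pose g b (t : T) := match t with inl i => G b i
  | inr (b', (i, j)) => if b == b' then p * bmon i j else 0 end.
have gd b t : bdeg (g b t) d.
  case: t => [i|[b' [i j]]] /=; first exact: Gd.
  case: eqP => _; last by split=> [|?]; rewrite ?coef0 size_poly0.
  have -> : d = (k + n.-1)%N by rewrite /n; lia.
  by apply: bdegM => //; apply: bdeg_bmon; [move: (ltn_ord i)|move: (ltn_ord j)]; lia.
have [|c [[t ct] cE]] := @kernel_nontrivial K T E (fun t e => (g e.1 t)`_e.2.1`_e.2.2).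
  rewrite card_sum !card_prod card_bool !card_ord.
  by move: card; rewrite -/n !expnS !expn0; lia.
have sum0 b : \sum_t (c t)%:P%:P * g b t = 0.
  apply/polyP => i; apply/polyP => j; rewrite !coef0.
  have HG : bdeg (\sum_t (c t)%:P%:P * g b t) d.
    apply: (big_ind (fun q => bdeg q d)); first by split=> [|?]; rewrite ?coef0 size_poly0.
      by move=> u v; apply: bdegD.
    move=> s _; rewrite -[d]add0n; apply: bdegM => //.
    by split=> [|l]; rewrite ?size_polyC_leq1// coefC; case: eqP; rewrite ?size_poly0// size_polyC_leq1.
  case: (leqP i d) => id; last first.
    by move/leq_sizeP: HG.1 => ->//; rewrite coef0.
  case: (leqP j d) => jd; last by rewrite nth_default// (leq_trans (HG.2 i)).
  rewrite coef_sum coef_sum -[RHS](cE (b, (Ordinal (id : (i < d.+1)%N), Ordinal (jd : (j < d.+1)%N)))).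
  by apply: eq_bigr => s _; rewrite coefCM coefCM.
pose W b := \sum_(ij : 'I_n * 'I_n) (c (inr (b, ij)))%:P%:P * bmon ij.1 ij.2.
have GW b : \sum_i (c (inl i))%:P%:P * G b i = p * - W b.
  move: (sum0 b); rewrite big_sumType/= => /eqP; rewrite addr_eq0 => /eqP ->.
  rewrite mulrN; congr (- _).
  transitivity (\sum_b' \sum_ij (c (inr (b', ij)))%:P%:P * g b (inr (b', ij))).
    by rewrite pair_bigA; apply: eq_bigr => -[].
  rewrite (bigD1 b)//= [X in _ + X]big1 ?addr0.
    rewrite /W big_distrr/=; apply: eq_bigr => -[i j] _ /=.
    by rewrite eqxx mulrCA.
  by move=> b' /negbTE bb; apply: big1 => -[i j] _; rewrite eq_sym bb mulr0.
exists (fun i => c (inl i)); split; last by move=> b; exists (- W b).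
(* If all the coefficients of the [G b i] were zero, then [p * W b] would vanish for both b; since
   [p] is nonzero the cofactors would vanish too, and with them the whole kernel vector. *)
apply: contrapT => H.
have cl i : c (inl i) = 0 by apply/eqP/negPn/negP => ci; apply: H; exists i.
case: t ct => [i|[b [i j]]]; first by rewrite cl eqxx.
move: (GW b); rewrite big1 => [|i' _]; last by rewrite cl !mul0r.
move/esym/eqP; rewrite mulf_eq0 (negbTE p0) oppr_eq0/= => /eqP /(congr1 (fun q : {poly {poly K}} => q`_i`_j)).
rewrite coef0 coef0 /W coef_sum coef_sum (bigD1 (i, j))//= coefCM coefCM coef_bmon !eqxx mulr1 big1.
  by rewrite addr0 => ->; rewrite eqxx.
move=> -[i' j'] ij; rewrite coefCM coefCM coef_bmon.
case: eqP => [ii|]; last by rewrite mulr0.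
case: eqP => [jj|]; last by rewrite mulr0.
by case/eqP: ij; congr (_, _); apply: val_inj.
Qed.

End Bidegree.

(** * Rational functions of two elements and their derivations *)

Section RationalElements.
Variables (K : fieldType) (L : idomainType) (iota : {rmorphism K -> L}) (x y : L).

Definition evxy : {rmorphism {poly {poly K}} -> L} :=
  horner_eval y \o map_poly (horner_eval x \o map_poly iota).

Lemma evxyC (c : {poly K}) : evxy c%:P = (map_poly iota c).[x].
Proof. by rewrite /= map_polyC /horner_eval/= hornerC. Qed.

Lemma evxyX : evxy 'X = y.
Proof. by rewrite /= map_polyX /horner_eval hornerX. Qed.

Lemma evxy_cst (c : K) : evxy c%:P%:P = iota c.
Proof. by rewrite evxyC map_polyC hornerC. Qed.

Lemma evxy_x : evxy 'X%:P = x.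
Proof. by rewrite evxyC map_polyX hornerX. Qed.

Opaque evxy.

(** As [L] is only a domain, a fraction is stated by its cleared equation. The denominator must be
    nonzero after evaluation, which is stronger than [b != 0] when x and y are algebraically
    dependent. *)
Definition rational (u : L) := exists b p, evxy b != 0 /\ evxy b * u = evxy p.

Lemma rational_ev p : rational (evxy p).
Proof. by exists 1, p; rewrite rmorph1 oner_neq0 mul1r. Qed.

Lemma rational_cst c : rational (iota c).
Proof. by rewrite -evxy_cst; exact: rational_ev. Qed.

Lemma rational_x : rational x. Proof. by rewrite -evxy_x; exact: rational_ev. Qed.
Lemma rational_y : rational y. Proof. by rewrite -[y]evxyX; exact: rational_ev. Qed.

Lemma rationalD u v : rational u -> rational v -> rational (u + v).
Proof.
move=> [b [p [b0 bp]]] [c [q [c0 cq]]]; exists (b * c), (c * p + b * q).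
by rewrite rmorphM mulf_neq0//= rmorphD !rmorphM -bp -cq; split=> //; ring.
Qed.

Lemma rationalM u v : rational u -> rational v -> rational (u * v).
Proof.
move=> [b [p [b0 bp]]] [c [q [c0 cq]]]; exists (b * c), (p * q).
by rewrite rmorphM mulf_neq0//= rmorphM -bp -cq; split=> //; ring.
Qed.

Lemma rationalN u : rational u -> rational (- u).
Proof. by move=> [b [p [b0 bp]]]; exists b, (- p); rewrite mulrN bp rmorphN. Qed.

Lemma rationalB u v : rational u -> rational v -> rational (u - v).
Proof. by move=> ? ?; apply: rationalD => //; exact: rationalN. Qed.

Lemma rationalX u n : rational u -> rational (u ^+ n).
Proof.
move=> ru; elim: n => [|n IH]; last by rewrite exprS; exact: rationalM.
by rewrite expr0 -(rmorph1 evxy); exact: rational_ev.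
Qed.

Lemma rational_div u v w : v != 0 -> v * u = w -> rational v -> rational w -> rational u.
Proof.
move=> v0 vu [b [p [b0 bp]]] [c [q [c0 cq]]]; exists (c * p), (b * q); split.
  by rewrite rmorphM mulf_neq0// -bp mulf_neq0.
by rewrite !rmorphM -bp -cq -vu; ring.
Qed.

Lemma common_denominator (s : seq L) : (forall u, u \in s -> rational u) ->
  exists b k, [/\ evxy b != 0, bdeg b k &
    forall u, u \in s -> exists2 p, bdeg p k & evxy b * u = evxy p].
Proof.
elim: s => [|u s IH] us.
  by exists 1, 0; split=> //; [rewrite rmorph1 oner_neq0|exact: bdeg1].
have [|b [k [b0 bk bP]]] := IH; first by move=> v vs; apply: us; rewrite inE vs orbT.
have [|c [p [c0 cp]]] := us u; first by rewrite inE eqxx.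
have [kp pk] := bdeg_ex p; have [kc ck] := bdeg_ex c.
exists (b * c), (k + (kp + kc))%N; split.
- by rewrite rmorphM mulf_neq0.
- by apply: bdegM => //; apply: bdeg_le ck; lia.
- move=> v; rewrite inE => /predU1P[->|/bP[q qk bq]].
    by exists (b * p); [apply: bdegM => //; apply: bdeg_le pk; lia|rewrite !rmorphM -mulrA cp].
  by exists (q * c); [apply: bdegM => //; apply: bdeg_le ck; lia|rewrite !rmorphM -bq mulrAC].
Qed.

Section Derivation.
Variable der : L -> L.
Hypothesis derD : forall u v, der (u + v) = der u + der v.
Hypothesis derM : forall u v, der (u * v) = der u * v + u * der v.
Hypothesis der_cst : forall c, der (iota c) = 0.

Lemma der0 : der 0 = 0.
Proof. by have := der_cst 0; rewrite rmorph0. Qed.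

Lemma derXn u n : der (u ^+ n.+1) = n.+1%:R * (u ^+ n * der u).
Proof.
elim: n => [|n IH]; first by rewrite expr1 expr0 !mul1r.
by rewrite exprS derM IH -[n.+2]addn1 natrD (exprS _ n); ring.
Qed.

(** Chain rule: mapping [deriv] over the coefficients differentiates in the inner variable, which
    stands for x; the derivative of [p] itself is in the outer one, which stands for y. *)
Lemma der_ev p : der (evxy p) =
  evxy (map_poly (@deriv K) p) * der x + evxy p^`() * der y.
Proof.
have derC (c : {poly K}) : der (evxy c%:P) = evxy c^`()%:P * der x.
  elim/poly_ind: c => [|c a IH]; first by rewrite linear0 !rmorph0 der0 mul0r.
  have -> : (c * 'X + a%:P)%:P = c%:P * 'X%:P + a%:P%:P :> {poly {poly K}}.
    by rewrite polyCD polyCM.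
  rewrite rmorphD rmorphM derD derM IH evxy_x evxy_cst der_cst addr0.
  rewrite derivD derivM derivX derivC mulr1 addr0 polyCD polyCM rmorphD rmorphM evxy_x.
  by ring.
elim/poly_ind: p => [|p c IH].
  by rewrite linear0 map_poly0 !rmorph0 der0 !mul0r addr0.
have -> : map_poly (@deriv K) (p * 'X + c%:P) = map_poly (@deriv K) p * 'X + c^`()%:P.
  apply/polyP => i; rewrite coef_map_id0 ?linear0// !coefD !coefMX !coefC.
  case: i => [|i]/=; rewrite ?add0r ?addr0//.
  by rewrite coef_map_id0 ?linear0.
rewrite rmorphD rmorphM derD derM IH derC evxyX.
rewrite derivD derivM derivX derivC mulr1 addr0 !rmorphD !rmorphM evxyX/=.
by ring.
Qed.

Lemma rational_der u : rational (der x) -> rational (der y) -> rational u -> rational (der u).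
Proof.
move=> rx ry [b [p [b0 bp]]].
have rev q : rational (der (evxy q)).
  by rewrite der_ev; apply: rationalD; apply: rationalM => //; exact: rational_ev.
apply: (@rational_div _ (evxy b) (der (evxy p) - der (evxy b) * u)) => //.
- by rewrite -bp derM; ring.
- exact: rational_ev.
- by apply: rationalB => //; apply: rationalM => //; exists b, p.
Qed.

Variables (p : {poly {poly K}}) (m1 m2 t r a1 a2 a3 a4 t1 t2 : L).
Hypotheses (p0 : p != 0) (evp : evxy p = 0).
Hypotheses (rx : rational (der x)) (ry : rational (der y)) (rr : rational r).
Hypotheses (ra1 : rational a1) (ra2 : rational a2) (ra3 : rational a3) (ra4 : rational a4).
Hypotheses (rt1 : rational t1) (rt2 : rational t2).
Hypotheses (der1 : der m1 = a1 * m1 + a2 * m2) (der2 : der m2 = a3 * m1 + a4 * m2).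
Hypothesis tE : t = t1 * m1 + t2 * m2.

Theorem dependent_derivatives : exists (m : nat) (P : nat -> {poly K}),
  (exists2 i, (i <= m)%N & P i != 0) /\
  \sum_(i < m.+1) (map_poly iota (P i)).[r] * iter i der t = 0.
Proof.
have [|b [k0 [b0 bk0 bP0]]] := @common_denominator [:: der x; der y; r; a1; a2; a3; a4; t1; t2].
  by move=> u; rewrite !inE; do ?[case/orP=> [/eqP ->//|]]; move/eqP ->.
have [kp pkp] := bdeg_ex p.
pose k := (k0 + kp + 1)%N.
have pk : bdeg p k by apply: bdeg_le pkp; rewrite /k; lia.
have bk : bdeg b k by apply: bdeg_le bk0; rewrite /k; lia.
have bP u : u \in [:: der x; der y; r; a1; a2; a3; a4; t1; t2] ->
    exists2 q, bdeg q k & evxy b * u = evxy q.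
  by move=> /bP0[q qk qE]; exists q => //; apply: bdeg_le qk; rewrite /k; lia.
set B := evxy b in b0 bP.
have [qx qxk qxE] := bP (der x) ltac:(by rewrite !inE eqxx ?orbT).
have [qy qyk qyE] := bP (der y) ltac:(by rewrite !inE eqxx ?orbT).
have [qr qrk qrE] := bP r ltac:(by rewrite !inE eqxx ?orbT).
have [q1 q1k q1E] := bP a1 ltac:(by rewrite !inE eqxx ?orbT).
have [q2 q2k q2E] := bP a2 ltac:(by rewrite !inE eqxx ?orbT).
have [q3 q3k q3E] := bP a3 ltac:(by rewrite !inE eqxx ?orbT).
have [q4 q4k q4E] := bP a4 ltac:(by rewrite !inE eqxx ?orbT).
have [s1 s1k s1E] := bP t1 ltac:(by rewrite !inE eqxx ?orbT).
have [s2 s2k s2E] := bP t2 ltac:(by rewrite !inE eqxx ?orbT).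
have Bder q d : bdeg q d -> exists2 q', bdeg q' (d + k) & B * der (evxy q) = evxy q'.
  move=> qd; exists (map_poly (@deriv K) q * qx + q^`() * qy).
    by apply: bdegD; apply: bdegM => //; [exact: bdeg_deriv_coef|exact: bdeg_deriv].
  by rewrite der_ev rmorphD !rmorphM -qxE -qyE; ring.
have [b' b'k b'E] := Bder _ _ bk.
have tP i : exists u v, [/\ bdeg u (k * (2 * i + 1)), bdeg v (k * (2 * i + 1)) &
    B ^+ (2 * i + 1) * iter i der t = evxy u * m1 + evxy v * m2].
  elim: i => [|i [u [v [ud vd uvE]]]].
    by exists s1, s2; rewrite !muln0 !add0n !muln1 expr1 /= tE; split=> //; rewrite -s1E -s2E; ring.
  have [u' u'd u'E] := Bder _ _ ud; have [v' v'd v'E] := Bder _ _ vd.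
  set N := (2 * i + 1)%N in ud vd uvE u'd v'd.
  have H n z : B ^+ n.+3 * der z =
      B ^+ 2 * der (B ^+ n.+1 * z) - n.+1%:R * ((B * der B) * (B ^+ n.+1 * z)).
    by rewrite derM derXn !exprS; ring.
  have {}H z : B ^+ N.+2 * der z = B ^+ 2 * der (B ^+ N * z) - N%:R * ((B * der B) * (B ^+ N * z)).
    have -> : N = (2 * i).+1 by rewrite /N addn1.
    exact: H.
  exists (b * u' + u * b * q1 + v * b * q3 - (b' * u) *+ N),
         (b * v' + u * b * q2 + v * b * q4 - (b' * v) *+ N).
  have -> : (2 * i.+1 + 1)%N = N.+2 by rewrite /N; lia.
  clearbody N.
  have dE : (k * N.+2 = k + (k * N + k))%N by lia.
  have dE2 : (k * N.+2 = k * N + k + k)%N by lia.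
  have dE3 : (k * N.+2 = k + k + k * N)%N by lia.
  split.
  - apply: bdegD; last by apply: bdegN; apply: bdegMn; rewrite dE3; exact: bdegM.
    by apply: bdegD; [apply: bdegD; [rewrite dE|rewrite dE2; apply: bdegM => //]|rewrite dE2; apply: bdegM => //]; exact: bdegM.
  - apply: bdegD; last by apply: bdegN; apply: bdegMn; rewrite dE3; exact: bdegM.
    by apply: bdegD; [apply: bdegD; [rewrite dE|rewrite dE2; apply: bdegM => //]|rewrite dE2; apply: bdegM => //]; exact: bdegM.
  rewrite iterS H uvE derD !derM der1 der2 b'E.
  rewrite !rmorphB !rmorphD !rmorphMn.
  rewrite -[evxy (b' * u) *+ N]mulr_natl -[evxy (b' * v) *+ N]mulr_natl.
  rewrite !rmorphM -u'E -v'E -q1E -q2E -q3E -q4E -/B.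
  by ring.
(* Modulo multiples of [p], two boxes of side k N + 1 have at most 4 k (k N + 1) dimensions. By the
   choice of m this is m n + m (2 m + 1) + 4 k, by the choice of n it is m n + n, and this is less
   than (m + 1) (n + 1). *)
pose m := (4 * k * k)%N; pose n := (4 * k * k * (2 * m + 1) + 4 * k)%N.
pose N := (2 * m + 1 + n)%N.
have [u uP] := choice tP; have [v vP] := choice uP.
(* The coordinates on [m1] (for [true]) and [m2] (for [false]) of [B ^+ N] times r^j der^i t. The
   spare powers of [b] bring all pairs (i, j) to the same denominator and the same bidegree k N. *)
pose G (c : bool) (ij : 'I_m.+1 * 'I_n.+1) : {poly {poly K}} :=
  b ^+ (2 * (m - ij.1) + (n - ij.2)) * qr ^+ ij.2 * (if c then u ij.1 else v ij.1).
have Gd c ij : bdeg (G c ij) (k * N).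
  have [ud vd _] := vP ij.1.
  have -> : (k * N = k * (2 * (m - ij.1) + (n - ij.2)) + k * ij.2 + k * (2 * ij.1 + 1))%N.
    have i1 : (ij.1 <= m)%N by rewrite -ltnS ltn_ord.
    have i2 : (ij.2 <= n)%N by rewrite -ltnS ltn_ord.
    by rewrite -!mulnDr /N; congr (_ * _)%N; lia.
  by apply: bdegM; [apply: bdegM; exact: bdegXn|case: c].
have [||c [[ij cij] cP]] := @dependent_mod K p k (k * N) _ G p0 pk _ Gd.
- by rewrite /N; nia.
- rewrite card_prod !card_ord.
  have k1 : (0 < k)%N by rewrite /k; lia.
  have : (4 * k * (k * N).+1 < m.+1 * n.+1)%N by rewrite /N /n /m; nia.
  have -> : ((k * N).+1 - k = (k * (2 * m + n)).+1)%N by rewrite /N; nia.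
  have -> : ((k * N).+1 = (k * (2 * m + n)).+1 + k)%N by rewrite /N; nia.
  move: (k * _).+1 (m.+1 * n.+1)%N => A C; rewrite !expnS !expn0; nia.
have [w1 w1E] := cP true; have [w2 w2E] := cP false.
exists m, (fun i => \poly_(j < n.+1) (if insub i is Some i' then
                                    if insub j is Some j' then c (i', j') else 0 else 0)).
split.
  exists (val ij.1); first by rewrite -ltnS ltn_ord.
  apply/eqP => /polyP/(_ (val ij.2)); rewrite coef_poly ltn_ord coef0 !valK.
  by move/eqP; rewrite -surjective_pairing (negbTE cij).
apply: (mulfI (expf_neq0 N b0)); rewrite mulr0 big_distrr/=.
(* In both coordinates the combination is a multiple of [p], which evaluates to 0. *)
transitivity (\sum_ij iota (c ij) * (evxy (G true ij) * m1 + evxy (G false ij) * m2)); last first.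
  transitivity (evxy (\sum_ij (c ij)%:P%:P * G true ij) * m1 + evxy (\sum_ij (c ij)%:P%:P * G false ij) * m2).
    rewrite !rmorph_sum/= !big_distrl/= -big_split/=; apply: eq_bigr => i _.
    by rewrite !rmorphM !evxy_cst; ring.
  by rewrite w1E w2E !rmorphM evp !mul0r addr0.
transitivity (\sum_(i < m.+1) \sum_(j < n.+1) iota (c (i, j)) *
    (evxy (G true (i, j)) * m1 + evxy (G false (i, j)) * m2)); last first.
  by rewrite pair_bigA; apply: eq_bigr => -[].
apply: eq_bigr => i _.
rewrite (@horner_coef_wide _ n.+1); last first.
  by rewrite (leq_trans (size_poly _ _))// size_poly.
rewrite mulrA mulrAC big_distrr/=; apply: eq_bigr => j _.
rewrite coef_map coef_poly ltn_ord !valK /G/= !rmorphM !rmorphXn -qrE -/B.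
have [_ _ E] := vP i.
have i1 : (i <= m)%N by rewrite -ltnS ltn_ord.
have i2 : (j <= n)%N by rewrite -ltnS ltn_ord.
have -> : N = ((2 * (m - i) + (n - j)) + j + (2 * i + 1))%N by rewrite /N; lia.
rewrite (exprD B _ (2 * i + 1)) (exprD B _ j); move: (B ^+ (_ + _)) => X1.
transitivity (iota (c (i, j)) * (X1 * ((B * r) ^+ j * (B ^+ (2 * i + 1) * iter i der t)))).
  by rewrite exprMn; move: (B ^+ (2 * i + 1)) => X2; ring.
by rewrite E; ring.
Qed.

End Derivation.
End RationalElements.

(** * Derivations on fraction fields *)

Section QuotientRule.
Variable K : fieldType.
Implicit Types a b c d : K.

Lemma quotient_wd a b c d a' b' c' d' : b != 0 -> d != 0 -> a * d = c * b ->
  a' * d + a * d' = c' * b + c * b' -> (a' * b - a * b') / b ^+ 2 = (c' * d - c * d') / d ^+ 2.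
Proof.
move=> b0 d0 /(canRL (mulfK d0)) -> H; have -> : a' = (c' * b + c * b' - c * b / d * d') / d.
  by apply: (canRL (mulfK d0)); rewrite -H addrK.
by field; rewrite b0 d0.
Qed.

Lemma quotient_add a b c d a' b' c' d' : b != 0 -> d != 0 ->
  ((a' * d + a * d' + (c' * b + c * b')) * (b * d) - (a * d + c * b) * (b' * d + b * d')) / (b * d) ^+ 2
  = (a' * b - a * b') / b ^+ 2 + (c' * d - c * d') / d ^+ 2.
Proof. by move=> b0 d0; field; rewrite b0 d0. Qed.

Lemma quotient_mul a b c d a' b' c' d' : b != 0 -> d != 0 ->
  ((a' * c + a * c') * (b * d) - (a * c) * (b' * d + b * d')) / (b * d) ^+ 2
  = (a' * b - a * b') / b ^+ 2 * (c / d) + a / b * ((c' * d - c * d') / d ^+ 2).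
Proof. by move=> b0 d0; field; rewrite b0 d0. Qed.

End QuotientRule.

Section FractionDerivation.
Variables (A : idomainType) (D : A -> A).
Hypothesis D_add : forall a b, D (a + b) = D a + D b.
Hypothesis D_mul : forall a b, D (a * b) = D a * b + a * D b.

Let F := {fraction A}.
Let fr : A -> F := @tofrac A.

Lemma fracP (u : F) : exists n d, fr d != 0 /\ u = fr n / fr d.
Proof.
elim/quotW: u => r; exists (\n_r), (\d_r).
have d0 : fr (\d_r) != 0 by rewrite tofrac_eq0 denom_ratioP.
split=> //; apply: (canRL (mulfK d0)).
rewrite /fr; unlock tofrac; rewrite -[LHS]FracField.pi_mul; apply/eqmodP.
by rewrite /= FracField.equivfE /FracField.mulf !numden_Ratio ?mulf_neq0 ?oner_neq0 ?denom_ratioP// !mulr1 mulrC.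
Qed.

Lemma fr_inj : injective fr.
Proof. by move=> a b /eqP; rewrite tofrac_eq => /eqP. Qed.

(** Numerator and denominator are picked by choice; [derFE] shows that the quotient rule gives the
    same value for every representation. *)
Definition derF (u : F) : F :=
  let n := projT1 (cid (fracP u)) in let d := projT1 (cid (projT2 (cid (fracP u)))) in
  (fr (D n) * fr d - fr n * fr (D d)) / fr d ^+ 2.

Lemma derFE n d : fr d != 0 ->
  derF (fr n / fr d) = (fr (D n) * fr d - fr n * fr (D d)) / fr d ^+ 2.
Proof.
move=> d0; rewrite /derF; set u := fr n / fr d.
case: (cid (fracP u)) => n' [d1 H]; case: cid => d' [d'0 uE]; move: uE.
rewrite /= /u {u H d1} => uE.
have E : n * d' = n' * d.
  by apply: fr_inj; rewrite /fr !rmorphM; apply/eqP; rewrite -eqr_div ?uE.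
apply/esym/quotient_wd => //; first by rewrite /fr -!rmorphM E.
by rewrite /fr -!rmorphM -!rmorphD -!D_mul E.
Qed.

Lemma derF_tofrac a : derF (fr a) = fr (D a).
Proof.
have D1 : D 1 = 0.
  have := D_mul 1 1; rewrite !mulr1 mul1r => /eqP.
  by rewrite -subr_eq0 opprD addNKr oppr_eq0 => /eqP.
have -> : fr a = fr a / fr 1 by rewrite /fr rmorph1 divr1.
rewrite derFE ?D1 /fr ?rmorph1 ?oner_neq0// rmorph0 mulr0 subr0 expr1n divr1 mulr1.
by [].
Qed.

Lemma derF_add u v : derF (u + v) = derF u + derF v.
Proof.
have [n [d [d0 ->]]] := fracP u; have [m [c [c0 ->]]] := fracP v.
rewrite addf_div// -!rmorphM -rmorphD !derFE ?D_add ?D_mul//; last by rewrite /fr rmorphM mulf_neq0.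
by rewrite /fr !(rmorphD, rmorphM) quotient_add.
Qed.

Lemma derF_mul u v : derF (u * v) = derF u * v + u * derF v.
Proof.
have [n [d [d0 ->]]] := fracP u; have [m [c [c0 ->]]] := fracP v.
rewrite mulf_div -!rmorphM !derFE ?D_mul//; last by rewrite /fr rmorphM mulf_neq0.
by rewrite /fr !(rmorphD, rmorphM) quotient_mul.
Qed.

End FractionDerivation.


(** * Elliptic functions *)

(** Lets [ring] exploit a known equation a' = b': what remains to be checked is a polynomial
    identity between the differences. *)
Lemma eq_by (V : zmodType) (a b a' b' : V) : a' = b' -> a - b = a' - b' -> a = b.
Proof. by move=> -> /eqP; rewrite subrr subr_eq0 => /eqP. Qed.

Section WeierstrassJets.
Variable F : fieldType.
Hypotheses (two0 : 2 != 0 :> F) (three0 : 3 != 0 :> F).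

(* Logarithmic jets: A_j stands for theta^(j) / theta at a point, e3 for theta'''(0) / (3 theta'(0)).
   In these terms the zeta, wp, wp', wp'' functions are A_1 + const, jp, jp1, jp2. *)
Definition jp (e3 A1 A2 : F) := e3 - (A2 - A1 ^+ 2).
Definition jp1 (A1 A2 A3 : F) := - (A3 - 3 * A1 * A2 + 2 * A1 ^+ 3).
Definition jp2 (A1 A2 A3 A4 : F) :=
  - (A4 - 4 * A1 * A3 - 3 * A2 ^+ 2 + 12 * A1 ^+ 2 * A2 - 6 * A1 ^+ 4).

Lemma four0 : 4 != 0 :> F.
Proof. by rewrite (_ : 4 = 2 * 2) ?mulf_neq0//; ring. Qed.

(** * Addition and duplication theorems in terms of jets *)

Section Addition.
Variables (e3 C A1 A2 A3 A4 B1 B2 B3 B4 S1 S2 : F).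
Let delta := (A2 - A1 ^+ 2) - (B2 - B1 ^+ 2).
Hypothesis delta0 : delta != 0.
Hypothesis odeA : A4 - 4 * (A1 * A3) + 3 * A2 ^+ 2 = C + 12 * e3 * (A2 - A1 ^+ 2).
Hypothesis odeB : B4 - 4 * (B1 * B3) + 3 * B2 ^+ 2 = C + 12 * e3 * (B2 - B1 ^+ 2).
Hypothesis H1 : 2 * (S1 * delta) = (A3 - A1 * A2) - 2 * (B2 - B1 ^+ 2) * A1
   - ((B3 - B1 * B2) - 2 * (A2 - A1 ^+ 2) * B1).
Hypothesis H2 : 4 * (S2 * delta) = (A4 - A2 ^+ 2) - 2 * (B2 - B1 ^+ 2) * (A1 ^+ 2 + A2)
   - ((B4 - B2 ^+ 2) - 2 * (A2 - A1 ^+ 2) * (B1 ^+ 2 + B2))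
   + 4 * ((A3 - A1 * A2) * B1 - (B3 - B1 * B2) * A1).

Lemma jet_add1 : 2 * (jp e3 A1 A2 - jp e3 B1 B2) * (S1 - A1 - B1) = jp1 A1 A2 A3 - jp1 B1 B2 B3.
Proof.
transitivity (- (2 * (S1 * delta)) + 2 * delta * (A1 + B1)); first by rewrite /jp /delta; ring.
by rewrite H1 /jp1 /delta; ring.
Qed.

(** The classical wp(u + v) = (zeta(u + v) - zeta u - zeta v)^2 - wp u - wp v. The fourth
    derivatives in [H2] are eliminated by [odeA] and [odeB], which are wp'' = 6 wp^2 - g2/2 in
    bilinear form. *)
Lemma jet_add2 : jp e3 S1 S2 = (S1 - A1 - B1) ^+ 2 - jp e3 A1 A2 - jp e3 B1 B2.
Proof.
have d4 : 4 * delta != 0 by rewrite mulf_neq0 ?four0.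
apply: (mulfI d4).
have eA : A4 = C + 12 * e3 * (A2 - A1 ^+ 2) + 4 * (A1 * A3) - 3 * A2 ^+ 2 by rewrite -odeA; ring.
have eB : B4 = C + 12 * e3 * (B2 - B1 ^+ 2) + 4 * (B1 * B3) - 3 * B2 ^+ 2 by rewrite -odeB; ring.
transitivity (4 * delta * e3 + 4 * delta * S1 ^+ 2 - 4 * (S2 * delta)); first by rewrite /jp; ring.
transitivity (4 * delta * S1 ^+ 2 - 4 * (2 * (S1 * delta)) * (A1 + B1)
  + 4 * delta * (A1 + B1) ^+ 2 - 4 * delta * jp e3 A1 A2 - 4 * delta * jp e3 B1 B2); last by ring.
by rewrite H1 H2 eA eB /jp /delta; ring.
Qed.

End Addition.

Section Duplication.
Variables (e3 C A1 A2 A3 A4 A5 S1 S2 : F).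
Let l3 := A3 - 3 * A1 * A2 + 2 * A1 ^+ 3.
Hypothesis l30 : l3 != 0.
Hypothesis odeA : A4 - 4 * (A1 * A3) + 3 * A2 ^+ 2 = C + 12 * e3 * (A2 - A1 ^+ 2).
Hypothesis odeA1 : A5 - 3 * (A1 * A4) + 2 * (A2 * A3) = 2 * C * A1 + 12 * e3 * (A3 - A1 * A2).
Hypothesis H1 : 2 * (S1 * l3) = A4 - 3 * A2 ^+ 2 + 2 * A1 ^+ 4.
Hypothesis H2 : 4 * (S2 * l3) = A5 + 3 * (A1 * A4) - 6 * (A2 * A3) - 6 * (A1 * A2 ^+ 2) + 8 * (A1 ^+ 3 * A2).

Lemma jet_double1 : 2 * jp1 A1 A2 A3 * (S1 - 2 * A1) = jp2 A1 A2 A3 A4.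
Proof.
transitivity (- (2 * (S1 * l3)) + 4 * A1 * l3); first by rewrite /jp1 /l3; ring.
by rewrite H1 /jp2 /l3; ring.
Qed.

Lemma jet_double2 : jp e3 S1 S2 = (S1 - 2 * A1) ^+ 2 - 2 * jp e3 A1 A2.
Proof.
have d4 : 4 * l3 != 0 by rewrite mulf_neq0 ?four0.
apply: (mulfI d4).
have eC : C = A4 - 4 * (A1 * A3) + 3 * A2 ^+ 2 - 12 * e3 * (A2 - A1 ^+ 2) by rewrite odeA; ring.
have e5 : A5 = 2 * C * A1 + 12 * e3 * (A3 - A1 * A2) + 3 * (A1 * A4) - 2 * (A2 * A3) by rewrite -odeA1; ring.
transitivity (4 * l3 * e3 + 4 * l3 * S1 ^+ 2 - 4 * (S2 * l3)); first by rewrite /jp; ring.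
transitivity (4 * l3 * S1 ^+ 2 - 8 * (2 * (S1 * l3)) * A1 + 16 * l3 * A1 ^+ 2 - 8 * l3 * jp e3 A1 A2); last by ring.
by rewrite H1 H2 e5 eC /jp /l3; ring.
Qed.

End Duplication.

(** * The q-derivatives of the Weierstrass functions *)

Section HeatFlow.
Variable D : F -> F.
Hypothesis D_add : forall u v, D (u + v) = D u + D v.
Hypothesis D_mul : forall u v, D (u * v) = D u * v + u * D v.

Lemma D_0 : D 0 = 0.
Proof. by have := D_add 0 0; rewrite addr0 => /esym/eqP; rewrite -subr_eq0 addrK => /eqP. Qed.

Lemma D_opp u : D (- u) = - D u.
Proof. by apply/eqP; rewrite -addr_eq0 -D_add addNr D_0. Qed.

Lemma D_sub u v : D (u - v) = D u - D v.
Proof. by rewrite D_add D_opp. Qed.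

Lemma D_1 : D 1 = 0.
Proof.
by have := D_mul 1 1; rewrite !mulr1 mul1r => /esym/eqP; rewrite -subr_eq0 addrK => /eqP.
Qed.

Lemma D_nat n : D n%:R = 0.
Proof. by elim: n => [|n IH]; rewrite ?D_0// -natr1 D_add IH D_1 addr0. Qed.

Lemma D_natM n u : D (n%:R * u) = n%:R * D u.
Proof. by rewrite D_mul D_nat mul0r add0r. Qed.

Lemma D_exp u n : D (u ^+ n.+1) = n.+1%:R * (u ^+ n * D u).
Proof.
elim: n => [|n IH]; first by rewrite expr1 expr0 !mul1r.
by rewrite exprS D_mul IH -[n.+2]addn1 natrD (exprS _ n); ring.
Qed.

Lemma D_inv u : u != 0 -> D u^-1 = - D u / u ^+ 2.
Proof.
move=> u0; have : D (u * u^-1) = 0 by rewrite mulfV ?D_1.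
rewrite D_mul => /eqP; rewrite addrC addr_eq0 => /eqP H.
by apply: (mulfI u0); rewrite H; field.
Qed.

Lemma D_div u v : v != 0 -> D (u / v) = (D u * v - u * D v) / v ^+ 2.
Proof. by move=> v0; rewrite D_mul D_inv//; field. Qed.

(** The undifferentiated terms of the two heat equations, due to the omitted factor q^(1/8), cancel
    in the quotient. *)
Lemma jet_heat (a0 aj aj2 a2 : F) : a0 != 0 ->
  8 * D aj = - (aj2 + aj) -> 8 * D a0 = - (a2 + a0) ->
  8 * D (aj / a0) = - (aj2 / a0 - (aj / a0) * (a2 / a0)).
Proof.
move=> a00 Hj H0; rewrite D_div//.
transitivity ((8 * D aj * a0 - aj * (8 * D a0)) / a0 ^+ 2); first by field.
by rewrite Hj H0; field.
Qed.

Variables (e3 C A1 A2 A3 A4 A5 A6 : F).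
Hypothesis ode : A4 - 4 * (A1 * A3) + 3 * A2 ^+ 2 = C + 12 * e3 * (A2 - A1 ^+ 2).
Hypothesis ode1 : A5 - 3 * (A1 * A4) + 2 * (A2 * A3) = 2 * C * A1 + 12 * e3 * (A3 - A1 * A2).
Hypothesis ode2 : A6 - 2 * (A1 * A5) - A2 * A4 + 2 * A3 ^+ 2 =
  2 * C * (A1 ^+ 2 + A2) + 12 * e3 * (A4 - A2 ^+ 2).
Hypothesis D1 : 8 * D A1 = - (A3 - A1 * A2).
Hypothesis D2 : 8 * D A2 = - (A4 - A2 * A2).
Hypothesis D3 : 8 * D A3 = - (A5 - A3 * A2).
Hypothesis D4 : 8 * D A4 = - (A6 - A4 * A2).
Hypothesis De : 24 * D e3 = C.

Let x := jp e3 A1 A2.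
Let y := jp1 A1 A2 A3.
Let v := jp2 A1 A2 A3 A4.

Let eight0 : 8 != 0 :> F.
Proof. by rewrite (_ : 8 = 2 * 4) ?mulf_neq0 ?four0//; ring. Qed.

Let n24 : 24 != 0 :> F.
Proof. by rewrite (_ : 24 = 3 * 8) ?mulf_neq0//; ring. Qed.

Let C_E : C = A4 - 4 * (A1 * A3) + 3 * A2 ^+ 2 - 12 * e3 * (A2 - A1 ^+ 2).
Proof. by rewrite ode; ring. Qed.

Let A5_E : A5 = 3 * (A1 * A4) - 2 * (A2 * A3) + 2 * C * A1 + 12 * e3 * (A3 - A1 * A2).
Proof. by rewrite -[12 * e3 * _](addKr (2 * C * A1)) -ode1; ring. Qed.

Let A6_E : A6 = 2 * (A1 * A5) + A2 * A4 - 2 * A3 ^+ 2 + 2 * C * (A1 ^+ 2 + A2) + 12 * e3 * (A4 - A2 ^+ 2).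
Proof. by rewrite -[12 * e3 * _](addKr (2 * C * (A1 ^+ 2 + A2))) -ode2; ring. Qed.

(** This is wp'' = 6 wp^2 - g2/2 with g2/2 = C + 6 e3^2. *)
Let C_xv : C = - v + 6 * x ^+ 2 - 6 * e3 ^+ 2.
Proof. by rewrite C_E /v /x /jp2 /jp; ring. Qed.

(** Ramanujan's equation for the Eisenstein series of weight 2, with g2/2 written as
    [6 * x ^+ 2 - v]. *)
Lemma heat_e3 : 24 * D e3 = 6 * x ^+ 2 - v - 6 * e3 ^+ 2.
Proof. by rewrite De C_xv; ring. Qed.

Lemma heat_x : 24 * D x = - 4 * v + 12 * x ^+ 2 - 6 * A1 * y - 12 * e3 * x.
Proof.
rewrite {1}/x /jp !(D_sub, D_exp).
transitivity (24 * D e3 - 3 * (8 * D A2) + 6 * (A1 * (8 * D A1))); first by ring.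
by rewrite De D1 D2 C_E /v /x /y /jp2 /jp1 /jp; ring.
Qed.

Lemma heat_y : 8 * D y = - 6 * e3 * y - 6 * x * y - 2 * A1 * v.
Proof.
rewrite {1}/y /jp1 !(D_opp, D_add, D_sub, D_natM, D_exp, D_mul, D_nat).
transitivity (- (8 * D A3) + 3 * (8 * D A1 * A2 + A1 * (8 * D A2)) - 6 * (A1 ^+ 2 * (8 * D A1))); first by ring.
by rewrite D3 D1 D2 A5_E C_E /v /x /y /jp2 /jp1 /jp; ring.
Qed.

Lemma heat_v : 8 * D v = - 8 * e3 * v - 6 * y ^+ 2 - 4 * x * v - 24 * A1 * x * y.
Proof.
rewrite {1}/v /jp2 !(D_opp, D_add, D_sub, D_natM, D_exp, D_mul, D_nat).
transitivity (- (8 * D A4) + 4 * (8 * D A1 * A3 + A1 * (8 * D A3)) + 6 * A2 * (8 * D A2)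
  - 12 * (2 * A1 * (8 * D A1) * A2 + A1 ^+ 2 * (8 * D A2)) + 24 * A1 ^+ 3 * (8 * D A1)); first by ring.
by rewrite D4 D3 D1 D2 A6_E A5_E C_E /v /x /y /jp2 /jp1 /jp; ring.
Qed.

End HeatFlow.

(** * Weight 0 coordinates normalised by the tangent slope *)

Section SlopeCoordinates.
Variable D : F -> F.
Hypothesis D_add : forall u v, D (u + v) = D u + D v.
Hypothesis D_mul : forall u v, D (u * v) = D u * v + u * D v.
Variables (e3 A1 x y v s : F).
Hypothesis heat_e3 : 24 * D e3 = 6 * x ^+ 2 - v - 6 * e3 ^+ 2.
Hypothesis heat_x : 24 * D x = - 4 * v + 12 * x ^+ 2 - 6 * A1 * y - 12 * e3 * x.
Hypothesis heat_y : 8 * D y = - 6 * e3 * y - 6 * x * y - 2 * A1 * v.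
Hypothesis heat_v : 8 * D v = - 8 * e3 * v - 6 * y ^+ 2 - 4 * x * v - 24 * A1 * x * y.
Hypotheses (y0 : y != 0) (s0 : s != 0) (v_E : v = s * y).

Let X := x / s ^+ 2.
Let Y := y / s ^+ 3.
Let a := A1 / s.

Let eight0 : 8 != 0 :> F.
Proof. by rewrite (_ : 8 = 2 * 4) ?mulf_neq0 ?four0//; ring. Qed.

Let n24 : 24 != 0 :> F.
Proof. by rewrite (_ : 24 = 3 * 8) ?mulf_neq0//; ring. Qed.

(** The part of D s / s^3 that is free of [e3], as [heat_s] shows. *)
Definition sigma (X Y a : F) := (X - 3 * Y - 12 * a * X + a) / 4.

Lemma heat_s : D s = s ^+ 3 * sigma X Y a - e3 * s / 4.
Proof.
apply: (mulfI (mulf_neq0 eight0 y0)).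
transitivity (8 * D v - s * (8 * D y)); first by rewrite v_E D_mul; ring.
rewrite heat_v heat_y v_E /sigma /X /Y /a.
by field; rewrite s0 four0.
Qed.

(** The terms -(w/4) e3 u in D u, for u = x of weight w = 2 and for u = s of weight 1, cancel in the
    quotient x / s^2 of weight 0. *)
Lemma heat_X : D X = s ^+ 2 * (X ^+ 2 / 2 - Y / 6 - a * Y / 4 - 2 * X * sigma X Y a).
Proof.
have s20 : s ^+ 2 != 0 by rewrite expf_neq0.
have six0 : 6 != 0 :> F by rewrite (_ : 6 = 3 * 2) ?mulf_neq0//; ring.
apply: (mulfI n24); rewrite {1}/X (D_div D_mul)// (D_exp D_mul) heat_s.
transitivity ((24 * D x * s ^+ 2 - x * (24 * (2 * (s ^+ 1 * (s ^+ 3 * sigma X Y a - e3 * s / 4))))) / (s ^+ 2) ^+ 2).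
  by move: (sigma _ _ _) => sg; field; rewrite s0 four0.
rewrite heat_x v_E /sigma /X /Y /a.
by field; rewrite s0 four0 two0 six0.
Qed.

Lemma heat_Y : D Y = s ^+ 2 * (- 3 * X * Y / 4 - a * Y / 4 - 3 * Y * sigma X Y a).
Proof.
have s30 : s ^+ 3 != 0 by rewrite expf_neq0.
apply: (mulfI eight0); rewrite {1}/Y (D_div D_mul)// (D_exp D_mul) heat_s.
transitivity ((8 * D y * s ^+ 3 - y * (8 * (3 * (s ^+ 2 * (s ^+ 3 * sigma X Y a - e3 * s / 4))))) / (s ^+ 3) ^+ 2).
  by move: (sigma _ _ _) => sg; field; rewrite s0 four0.
rewrite heat_y v_E /sigma /X /Y /a.
by field; rewrite s0 four0.
Qed.

Lemma heat_m1 : D s = s ^+ 2 * (sigma X Y a * s - e3 / s / 4).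
Proof. by rewrite heat_s; field; rewrite s0 four0. Qed.

(** The terms in [e3 ^+ 2] coming from [heat_e3] and from [heat_s] cancel, so the result stays
    linear in [e3 / s]. *)
Lemma heat_m2 : D (e3 / s) = s ^+ 2 * ((6 * X ^+ 2 - Y) / 24 * s - sigma X Y a * (e3 / s)).
Proof.
apply: (mulfI n24); rewrite (D_div D_mul)// heat_s.
transitivity ((24 * D e3 * s - e3 * (24 * (s ^+ 3 * sigma X Y a - e3 * s / 4))) / s ^+ 2).
  by move: (sigma _ _ _) => sg; field; rewrite s0 four0.
rewrite heat_e3 v_E /X /Y.
move: (sigma _ _ _) => sg.
by field; rewrite s0 four0 n24.
Qed.

End SlopeCoordinates.
End WeierstrassJets.

(** * Weierstrass functions from bilinear theta identities *)

Section EllipticFunctions.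
Variables (Z : zmodType) (A : comNzRingType) (F : fieldType) (f : {rmorphism A -> F}).
Hypotheses (two0 : 2 != 0 :> F) (three0 : 3 != 0 :> F).
Implicit Types u v z : Z.

Variables (t : nat -> Z -> A) (e C : A).
(** theta^2 (log theta)''; [K1] and [K2] are its first two z-derivatives. *)
Let K z := t 0 z * t 2 z - t 1 z ^+ 2.
Let K1 z := t 0 z * t 3 z - t 1 z * t 2 z.
Let K2 z := t 0 z * t 4 z - t 2 z ^+ 2.
Hypothesis w0 : f (t 1 0) != 0.
Hypothesis parity : forall j z, t j (- z) = (-1) ^+ j.+1 * t j z.
Hypothesis product0 : forall u v, t 1 0 ^+ 2 * (t 0 (u + v) * t 0 (u - v)) =
  K u * t 0 v ^+ 2 - K v * t 0 u ^+ 2.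
Hypothesis product1 : forall u v, 2 * t 1 0 ^+ 2 * (t 1 (u + v) * t 0 (u - v)) =
  K1 u * t 0 v ^+ 2 - 2 * K v * (t 0 u * t 1 u) - (K1 v * t 0 u ^+ 2 - 2 * K u * (t 0 v * t 1 v)).
Hypothesis product2 : forall u v, 4 * t 1 0 ^+ 2 * (t 2 (u + v) * t 0 (u - v)) =
  K2 u * t 0 v ^+ 2 - 2 * K v * (t 1 u ^+ 2 + t 0 u * t 2 u)
  - (K2 v * t 0 u ^+ 2 - 2 * K u * (t 1 v ^+ 2 + t 0 v * t 2 v))
  + 4 * (K1 u * (t 0 v * t 1 v) - K1 v * (t 0 u * t 1 u)).
Hypothesis double0 : forall z, t 1 0 ^+ 3 * t 0 (z + z) =
  t 0 z * (t 0 z ^+ 2 * t 3 z - 3 * (t 0 z * t 1 z * t 2 z) + 2 * t 1 z ^+ 3).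
Hypothesis double1 : forall z, 2 * t 1 0 ^+ 3 * t 1 (z + z) =
  t 0 z ^+ 3 * t 4 z - 3 * (t 0 z ^+ 2 * t 2 z ^+ 2) + 2 * t 1 z ^+ 4.
Hypothesis double2 : forall z, 4 * t 1 0 ^+ 3 * t 2 (z + z) =
  t 0 z ^+ 3 * t 5 z + 3 * (t 0 z ^+ 2 * t 1 z * t 4 z) - 6 * (t 0 z ^+ 2 * t 2 z * t 3 z)
  - 6 * (t 0 z * t 1 z * t 2 z ^+ 2) + 8 * (t 1 z ^+ 3 * t 2 z).
Hypothesis ode0 : forall z, t 0 z * t 4 z - 4 * (t 1 z * t 3 z) + 3 * t 2 z ^+ 2 =
  C * t 0 z ^+ 2 + 4 * e * K z.
Hypothesis ode1 : forall z, t 0 z * t 5 z - 3 * (t 1 z * t 4 z) + 2 * (t 2 z * t 3 z) =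
  2 * C * (t 0 z * t 1 z) + 4 * e * K1 z.
Hypothesis ode2 : forall z, t 0 z * t 6 z - 2 * (t 1 z * t 5 z) - t 2 z * t 4 z + 2 * t 3 z ^+ 2 =
  2 * C * (t 1 z ^+ 2 + t 0 z * t 2 z) + 4 * e * K2 z.

Definition jet j z : F := f (t j z) / f (t 0 z).
Definition e3 : F := f e / 3.
Definition zeta z := jet 1 z.
Definition wp z := jp e3 (jet 1 z) (jet 2 z).
Definition wp1 z := jp1 (jet 1 z) (jet 2 z) (jet 3 z).
Definition wp2 z := jp2 (jet 1 z) (jet 2 z) (jet 3 z) (jet 4 z).

Local Notation regular z := (f (t 0 z) != 0).

Lemma ftE j z : regular z -> f (t j.+1 z) = f (t 0 z) * jet j.+1 z.
Proof. by move=> z0; rewrite /jet mulrC divfK. Qed.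

Lemma jetN j z : jet j (- z) = (-1) ^+ j * jet j z.
Proof.
have E i : f (t i (- z)) = - ((-1) ^+ i * f (t i z)).
  by rewrite parity rmorphM rmorphXn rmorphN1 exprS mulN1r mulNr.
by rewrite /jet !E expr0 mul1r invrN mulrNN mulrA.
Qed.

Lemma wpN z : wp (- z) = wp z.
Proof. by rewrite /wp /jp !jetN; ring. Qed.
Lemma zetaN z : zeta (- z) = - zeta z.
Proof. by rewrite /zeta !jetN; ring. Qed.
Lemma wp1N z : wp1 (- z) = - wp1 z.
Proof. by rewrite /wp1 /jp1 !jetN; ring. Qed.

Let fe : f e = 3 * e3. Proof. by rewrite /e3 mulrC divfK. Qed.

Lemma jet_ode0 z : regular z ->
  jet 4 z - 4 * (jet 1 z * jet 3 z) + 3 * jet 2 z ^+ 2 = f C + 12 * e3 * (jet 2 z - jet 1 z ^+ 2).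
Proof.
move=> rz; have a20 : f (t 0 z) ^+ 2 != 0 by rewrite expf_neq0.
apply: (mulfI a20); have := congr1 f (ode0 z); rewrite /K.
rewrite !(rmorphB f, rmorphD f, rmorphM f, rmorph_nat f) !(ftE _ rz) fe => E.
by apply: (eq_by E); ring.
Qed.

Lemma jet_ode1 z : regular z ->
  jet 5 z - 3 * (jet 1 z * jet 4 z) + 2 * (jet 2 z * jet 3 z) =
  2 * f C * jet 1 z + 12 * e3 * (jet 3 z - jet 1 z * jet 2 z).
Proof.
move=> rz; have a20 : f (t 0 z) ^+ 2 != 0 by rewrite expf_neq0.
apply: (mulfI a20); have := congr1 f (ode1 z); rewrite /K1.
rewrite !(rmorphB f, rmorphD f, rmorphM f, rmorph_nat f) !(ftE _ rz) fe => E.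
by apply: (eq_by E); ring.
Qed.

Lemma jet_ode2 z : regular z ->
  jet 6 z - 2 * (jet 1 z * jet 5 z) - jet 2 z * jet 4 z + 2 * jet 3 z ^+ 2 =
  2 * f C * (jet 1 z ^+ 2 + jet 2 z) + 12 * e3 * (jet 4 z - jet 2 z ^+ 2).
Proof.
move=> rz; have a20 : f (t 0 z) ^+ 2 != 0 by rewrite expf_neq0.
apply: (mulfI a20); have := congr1 f (ode2 z); rewrite /K2.
rewrite !(rmorphB f, rmorphD f, rmorphM f, rmorph_nat f) !(ftE _ rz) fe => E.
by apply: (eq_by E); ring.
Qed.

(** By [product0], wp u - wp v is theta(u + v) theta(u - v) up to nonzero factors, so regularity at
    u + v and u - v makes it nonzero. [product1] and [product2], divided by [product0], are the
    hypotheses of [jet_add1] and [jet_add2]. *)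
Lemma wp_addition u v : regular u -> regular v -> regular (u + v) -> regular (u - v) ->
  [/\ wp u - wp v != 0,
      2 * (wp u - wp v) * (zeta (u + v) - zeta u - zeta v) = wp1 u - wp1 v &
      wp (u + v) = (zeta (u + v) - zeta u - zeta v) ^+ 2 - wp u - wp v].
Proof.
move=> ru rv rp rm.
have := congr1 f (product2 u v); have := congr1 f (product1 u v); have := congr1 f (product0 u v).
rewrite /K2 /K1 /K !(rmorphB f, rmorphD f, rmorphM f, rmorph_nat f).
rewrite !(ftE _ ru) !(ftE _ rv) !(ftE _ rp) => H0 H1 H2.
have W0 := w0; set W := f (t 1 0) in W0 H0 H1 H2.
set m := f (t 0 (u - v)) in rm H0 H1 H2; set s0 := f (t 0 (u + v)) in rp H0 H1 H2.
set a0 := f (t 0 u) in ru H0 H1 H2; set b0 := f (t 0 v) in rv H0 H1 H2.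
pose delta := (jet 2 u - jet 1 u ^+ 2) - (jet 2 v - jet 1 v ^+ 2).
have H0' : W ^+ 2 * (s0 * m) = a0 ^+ 2 * b0 ^+ 2 * delta by apply: (eq_by H0); rewrite /delta; ring.
have ab0 : a0 ^+ 2 * b0 ^+ 2 != 0 by rewrite mulf_neq0 ?expf_neq0.
have delta0 : delta != 0.
  have : W ^+ 2 * (s0 * m) != 0 by rewrite !mulf_neq0 ?expf_neq0.
  by rewrite H0' mulf_eq0 negb_or => /andP[].
have E1 : 2 * (jet 1 (u + v) * delta) = (jet 3 u - jet 1 u * jet 2 u) - 2 * (jet 2 v - jet 1 v ^+ 2) * jet 1 u
   - ((jet 3 v - jet 1 v * jet 2 v) - 2 * (jet 2 u - jet 1 u ^+ 2) * jet 1 v).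
  apply: (mulfI ab0).
  transitivity (2 * jet 1 (u + v) * (W ^+ 2 * (s0 * m))); first by rewrite H0'; ring.
  by apply: (eq_by H1); ring.
have E2 : 4 * (jet 2 (u + v) * delta) = (jet 4 u - jet 2 u ^+ 2) - 2 * (jet 2 v - jet 1 v ^+ 2) * (jet 1 u ^+ 2 + jet 2 u)
   - ((jet 4 v - jet 2 v ^+ 2) - 2 * (jet 2 u - jet 1 u ^+ 2) * (jet 1 v ^+ 2 + jet 2 v))
   + 4 * ((jet 3 u - jet 1 u * jet 2 u) * jet 1 v - (jet 3 v - jet 1 v * jet 2 v) * jet 1 u).
  apply: (mulfI ab0).
  transitivity (4 * jet 2 (u + v) * (W ^+ 2 * (s0 * m))); first by rewrite H0'; ring.
  by apply: (eq_by H2); ring.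
split.
- rewrite /wp /jp; suff -> : e3 - (jet 2 u - jet 1 u ^+ 2) - (e3 - (jet 2 v - jet 1 v ^+ 2)) = - delta.
    by rewrite oppr_eq0.
  by rewrite /delta; ring.
- exact: jet_add1 E1.
- exact: (jet_add2 two0 delta0 (jet_ode0 ru) (jet_ode0 rv) E1 E2).
Qed.

(** By [double0], wp' u is theta(2u) / theta(u)^4 up to a nonzero factor, which is why it cannot
    vanish here. *)
Lemma wp_duplication u : regular u -> regular (u + u) ->
  [/\ wp1 u != 0, 2 * wp1 u * (zeta (u + u) - 2 * zeta u) = wp2 u &
      wp (u + u) = (zeta (u + u) - 2 * zeta u) ^+ 2 - 2 * wp u].
Proof.
move=> ru rp.
have := congr1 f (double2 u); have := congr1 f (double1 u); have := congr1 f (double0 u).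
rewrite !(rmorphB f, rmorphD f, rmorphM f, rmorph_nat f).
rewrite !(ftE _ ru) !(ftE _ rp) => H0 H1 H2.
have W0 := w0; set W := f (t 1 0) in W0 H0 H1 H2; set s0 := f (t 0 (u + u)) in rp H0 H1 H2.
set a0 := f (t 0 u) in ru H0 H1 H2.
pose l3 := jet 3 u - 3 * jet 1 u * jet 2 u + 2 * jet 1 u ^+ 3.
have H0' : W ^+ 3 * s0 = a0 ^+ 4 * l3 by apply: (eq_by H0); rewrite /l3; ring.
have a40 : a0 ^+ 4 != 0 by rewrite expf_neq0.
have l30 : l3 != 0.
  have : W ^+ 3 * s0 != 0 by rewrite mulf_neq0 ?expf_neq0.
  by rewrite H0' mulf_eq0 negb_or => /andP[].
have E1 : 2 * (jet 1 (u + u) * l3) = jet 4 u - 3 * jet 2 u ^+ 2 + 2 * jet 1 u ^+ 4.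
  apply: (mulfI a40).
  transitivity (2 * jet 1 (u + u) * (W ^+ 3 * s0)); first by rewrite H0'; ring.
  by apply: (eq_by H1); ring.
have E2 : 4 * (jet 2 (u + u) * l3) = jet 5 u + 3 * (jet 1 u * jet 4 u) - 6 * (jet 2 u * jet 3 u)
    - 6 * (jet 1 u * jet 2 u ^+ 2) + 8 * (jet 1 u ^+ 3 * jet 2 u).
  apply: (mulfI a40).
  transitivity (4 * jet 2 (u + u) * (W ^+ 3 * s0)); first by rewrite H0'; ring.
  by apply: (eq_by H2); ring.
split.
- by rewrite /wp1 /jp1 oppr_eq0.
- exact: jet_double1 E1.
- exact: (jet_double2 two0 l30 (jet_ode0 ru) (jet_ode1 ru) E1 E2).
Qed.

End EllipticFunctions.

(** * Multiples of a torsion point *)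

Section TorsionRecursion.
Variables (R : numFieldType) (F : fieldType) (iota : {rmorphism R -> F}).
Variables (n : nat) (E P Q : nat -> F) (s A x y : F).
Hypotheses (n3 : (2 < n)%N) (s0 : s != 0) (y0 : y != 0).
Hypotheses (E1 : E 1 = A) (P1 : P 1 = x) (Q1 : Q 1 = y).
(** Half the slope of the chord through the points with arguments z and k z, or of the tangent at z
    when k = 1. *)
Let lam k := E k.+1 - A - E k.
Hypothesis lam1 : 2 * y * lam 1 = s * y.
Hypothesis lamS : forall k, (1 < k)%N -> (k.+1 < n)%N ->
  x - P k != 0 /\ 2 * (x - P k) * lam k = y - Q k.
Hypothesis PS : forall k, (0 < k)%N -> (k.+1 < n)%N -> P k.+1 = lam k ^+ 2 - x - P k.
Hypothesis QS : forall k, (0 < k)%N -> (k.+2 < n)%N -> 2 * (x - P k.+1) * lam k = y + Q k.+1.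
Hypotheses (En : E n.-1 = - A) (Pn : P n.-1 = x).

Let X := x / s ^+ 2.
Let Y := y / s ^+ 3.
Let ev := evxy iota X Y.
(* the cuspidal curve y^2 = 4 x^3, where the point has infinite order and wp(k z) = 1/(k z)^2 with z = -3 *)
Let es : {rmorphism {poly {poly R}} -> R} := evxy (idfun : {rmorphism R -> R}) (9^-1) (2 / 27).

(** One and the same fraction p / b yields [u] at (X, Y) and [c] at the cuspidal point. Carrying
    both values detects that a fraction is not formally zero although it vanishes at (X, Y). *)
Definition corational (u : F) (c : R) := exists b p,
  [/\ ev b != 0, es b != 0, ev b * u = ev p & es b * c = es p].

Lemma corational_ev p : corational (ev p) (es p).
Proof. by exists 1, p; rewrite !rmorph1 !oner_neq0 !mul1r. Qed.

Lemma corational_X : corational X 9^-1.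
Proof. by have := corational_ev 'X%:P; rewrite /ev /es !evxy_x. Qed.

Lemma corational_Y : corational Y (2 / 27).
Proof. by have := corational_ev 'X; rewrite /ev /es !evxyX. Qed.

Lemma corational_nat k : corational k%:R k%:R.
Proof. by have := corational_ev k%:R; rewrite !rmorph_nat. Qed.

Lemma corationalD u c v d : corational u c -> corational v d -> corational (u + v) (c + d).
Proof.
move=> [b [p [b1 b2 b3 b4]]] [b' [p' [b1' b2' b3' b4']]]; exists (b * b'), (b' * p + b * p').
rewrite !rmorphM !rmorphD !rmorphM !mulf_neq0// -b3 -b4 -b3' -b4'; split=> //; ring.
Qed.

Lemma corationalM u c v d : corational u c -> corational v d -> corational (u * v) (c * d).
Proof.
move=> [b [p [b1 b2 b3 b4]]] [b' [p' [b1' b2' b3' b4']]]; exists (b * b'), (p * p').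
rewrite !rmorphM !mulf_neq0// -b3 -b4 -b3' -b4'; split=> //; ring.
Qed.

Lemma corationalN u c : corational u c -> corational (- u) (- c).
Proof.
move=> [b [p [b1 b2 b3 b4]]]; exists b, (- p).
by rewrite !rmorphN !mulrN b3 b4.
Qed.

Lemma corationalB u c v d : corational u c -> corational v d -> corational (u - v) (c - d).
Proof. by move=> uc vd; apply: corationalD => //; exact: corationalN. Qed.

Lemma corational_div u c v d w g : v != 0 -> d != 0 -> v * u = w -> d * c = g ->
  corational v d -> corational w g -> corational u c.
Proof.
move=> v0 d0 vu dc [b [p [b1 b2 b3 b4]]] [b' [p' [b1' b2' b3' b4']]]; exists (b' * p), (b * p').
rewrite !rmorphM -b3 -b4 !mulf_neq0// -b3' -b4' -vu -dc; split=> //; ring.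
Qed.

Lemma corational_rational u c : corational u c -> rational iota X Y u.
Proof. by move=> [b [p [b1 _ b3 _]]]; exists b, p. Qed.

Let two0 : 2 != 0 :> F.
Proof. by rewrite -(rmorph_nat iota) fmorph_eq0 pnatr_eq0. Qed.

(** On the cuspidal curve zeta u = 1/u, wp u = 1/u^2, wp' u = -2/u^3; with z = -3 the slope s is 1,
    and [sp], [sq], [sl] are the values of wp(k z), wp'(k z) and zeta((k + 1) z) - zeta z - zeta(k
    z). *)
Let sp k : R := (9 * k%:R ^+ 2)^-1.
Let sq k : R := 2 / (27 * k%:R ^+ 3).
Let sl k : R := (k%:R ^+ 2 + k%:R + 1) / (3 * k%:R * (k%:R + 1)).

Let k0 (k : nat) : (0 < k)%N -> k%:R != 0 :> R. Proof. by rewrite pnatr_eq0 lt0n. Qed.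
Let k10 (k : nat) : k%:R + 1 != 0 :> R. Proof. by rewrite natr1 pnatr_eq0. Qed.

Lemma lam_corational k : (0 < k)%N -> (k.+1 < n)%N ->
  corational (P k / s ^+ 2) (sp k) -> corational (Q k / s ^+ 3) (sq k) ->
  corational (lam k / s) (sl k).
Proof.
move=> kpos kn cP cQ; have kz := k0 kpos; have kz1 := k10 k.
case: (ltnP 1 k) => k1.
  have [xP lamk] := lamS k1 kn.
  apply: (@corational_div _ _ (2 * (X - P k / s ^+ 2)) (2 * (9^-1 - sp k)) (Y - Q k / s ^+ 3) (2 / 27 - sq k)).
  - by rewrite mulf_neq0// -mulrBl mulf_neq0// invr_eq0 expf_neq0.
  (* The denominator must survive on the cuspidal curve as well: there it compares 1/9 with 1/(9
     k^2), distinct for k > 1. *)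
  - rewrite mulf_neq0 ?pnatr_eq0// subr_eq0 /sp (inj_eq invr_inj).
    rewrite -[X in X == _]mulr1 (inj_eq (mulfI _)) ?pnatr_eq0// -natrX -[1]/(1%:R) eqr_nat.
    by rewrite neq_ltn -{1}(exp1n 2) ltn_exp2r ?k1.
  - transitivity (2 * (x - P k) * lam k / s ^+ 3); first by rewrite /X; field.
    by rewrite lamk mulrBl.
  - by rewrite /sp /sq /sl; field; rewrite kz kz1.
  - by apply: corationalM; [exact: corational_nat|apply: corationalB => //; exact: corational_X].
  - by apply: corationalB => //; exact: corational_Y.
(* The tangent case: [lam1] says that lam 1 / s is 1/2. *)
have -> : k = 1%N by lia.
apply: (@corational_div _ _ 2 2 1 1); rewrite ?pnatr_eq0//.
- apply: (mulfI y0); transitivity (2 * y * lam 1 / s); first by field.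
  by rewrite lam1; field.
- by rewrite /sl; field.
- exact: (corational_nat 2).
- exact: (corational_nat 1).
Qed.

(** The abscissa comes from the chord through z and k z, the ordinate from the chord through z and
    -(k + 1) z. The latter involves theta at (k + 2) z, so ordinates stop one index earlier. The
    differences E k - k A telescope into sums of the [lam]. *)
Lemma torsion_corational k : (0 < k)%N -> (k < n)%N ->
  [/\ corational (P k / s ^+ 2) (sp k), (k.+1 < n)%N -> corational (Q k / s ^+ 3) (sq k) &
      rational iota X Y ((E k - k%:R * A) / s)].
Proof.
elim: k => // -[_ _ _|k IH _ kn].
  split.
  - by rewrite P1 /sp expr1n mulr1; exact: corational_X.
  - by move=> _; rewrite Q1 /sq expr1n mulr1; exact: corational_Y.
  - by rewrite E1 mul1r subrr mul0r; apply: (@corational_rational _ 0); exact: (corational_nat 0).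
have [//||cP cQ rE] := IH; first exact: ltnW.
have kz := k0 (ltn0Sn k); have kz1 := k10 k.+1.
have {}cQ := cQ kn; have cL := lam_corational (ltn0Sn k) kn cP cQ.
have cP' : corational (P k.+2 / s ^+ 2) (sp k.+2).
  have -> : P k.+2 / s ^+ 2 = (lam k.+1 / s) * (lam k.+1 / s) - X - P k.+1 / s ^+ 2.
    by rewrite PS// /X; field.
  have -> : sp k.+2 = sl k.+1 * sl k.+1 - 9^-1 - sp k.+1.
    by rewrite /sp /sl -[k.+2%:R]natr1; move: (k.+1%:R) kz kz1 => K K0 K1; field; rewrite K0 K1.
  by apply: corationalB => //; apply: corationalB; [exact: corationalM|exact: corational_X].
split=> [//|kn2|].
  have -> : Q k.+2 / s ^+ 3 = 2 * (X - P k.+2 / s ^+ 2) * (lam k.+1 / s) - Y.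
    apply: (canRL (addrK _)); rewrite -mulrDl addrC -QS// /X.
    by move: (lam k.+1) (P k.+2) => l p; field.
  have -> : sq k.+2 = 2 * (9^-1 - sp k.+2) * sl k.+1 - 2 / 27.
    by rewrite /sp /sl /sq -[k.+2%:R]natr1; move: (k.+1%:R) kz kz1 => K K0 K1; field; rewrite K0 K1.
  apply: corationalB; last exact: corational_Y.
  apply: corationalM => //; apply: corationalM; first exact: corational_nat.
  by apply: corationalB => //; exact: corational_X.
have -> : (E k.+2 - k.+2%:R * A) / s = (E k.+1 - k.+1%:R * A) / s + lam k.+1 / s.
  by rewrite /lam -[k.+2%:R]natr1; field.
by apply: rationalD => //; exact: corational_rational cL.
Qed.

Theorem torsion_relation :
  (exists p, p != 0 /\ evxy iota X Y p = 0) /\ rational iota X Y (A / s).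
Proof.
have n1 : (0 < n.-1)%N by lia.
have n2 : (n.-1 < n)%N by lia.
have [cP _ rE] := torsion_corational n1 n2; split.
  rewrite Pn in cP; have [b [p [b1 b2 b3 b4]]] := corationalB cP corational_X.
  exists p; split; last by rewrite -[LHS]b3 subrr mulr0.
  (* A zero numerator would force the cuspidal values 1/(9 (n-1)^2) and 1/9 to agree, impossible for
     n > 2. *)
  apply: contra_neq b2 => p0; move: b4; rewrite p0 rmorph0 => /eqP.
  rewrite mulf_eq0 => /orP[/eqP //|]; rewrite subr_eq0 /sp (inj_eq invr_inj).
  rewrite -[X in _ == X]mulr1 (inj_eq (mulfI _)) ?pnatr_eq0// -natrX -[1]/(1%:R) eqr_nat => H.
  by move: H; rewrite gtn_eqF// -{1}(exp1n 2) ltn_exp2r//; lia.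
have nF : n%:R != 0 :> F by rewrite -(rmorph_nat iota) fmorph_eq0 pnatr_eq0; lia.
(* Since [E n.-1] is -A, the telescoped sum at n - 1 is - n A / s. *)
apply: (@rational_div _ _ _ _ _ _ (- n%:R) ((E n.-1 - n.-1%:R * A) / s)) => //.
- by rewrite oppr_eq0.
- have -> : n%:R = n.-1%:R + 1 :> F by rewrite natr1; congr (_%:R); lia.
  by rewrite En; field.
- by apply: rationalN; rewrite -(rmorph_nat iota); exact: rational_cst.
Qed.

End TorsionRecursion.

(** * The theta function *)

Section TripleProduct.
Variable R : realType.
Implicit Types (z : R) (m k : nat).

Fixpoint tri n : nat := if n is m.+1 then (tri m + m.+1)%N else 0.

Lemma tri2 n : (2 * tri n = n * n.+1)%N.
Proof. by elim: n => //= n IH; rewrite mulnDr IH; lia. Qed.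

Lemma leq_tri n : (n <= tri n)%N.
Proof. by elim: n => //= n IH; lia. Qed.

Definition qfac (j : nat) : {poly R} := 1 - 'X^j.

Lemma qfac_neq0 j : (0 < j)%N -> qfac j != 0.
Proof.
move=> j0; apply/eqP => /(congr1 (fun p : {poly R} => p`_0)) /eqP.
by rewrite coefB coef1 coefXn coef0 -(prednK j0) subr0 oner_eq0.
Qed.

(* (q)_m [2m+1 choose m-k]_q as a polynomial *)
Definition jcoef m k : {poly R} := if (k <= m)%N then
  (\prod_((m - k).+1 <= j < m.+1) qfac j) * (\prod_((m + k).+2 <= j < (2 * m).+2) qfac j) else 0.

Lemma jcoef_next m k : (k <= m)%N ->
  qfac (m + k).+2 * jcoef m k.+1 = qfac (m - k) * jcoef m k.
Proof.
move=> km; rewrite /jcoef km; case: (ltnP k m) => km'; last first.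
  have -> : (m - k = 0)%N by lia.
  by rewrite mulr0 /qfac expr0 subrr mul0r.
have -> : ((m - k.+1).+1 = m - k)%N by lia.
rewrite [in LHS]big_ltn; last by lia.
rewrite [in RHS](@big_ltn _ _ _ (m + k).+2); last by lia.
by rewrite addnS; ring.
Qed.

Lemma jcoef_prev m k : (k <= m)%N ->
  qfac (m - k).+1 * (if k is k'.+1 then jcoef m k' else jcoef m 0) = qfac (m + k).+1 * jcoef m k.
Proof.
case: k => [|k] km; first by rewrite subn0 addn0.
by rewrite addnS jcoef_next ?(ltnW km)// subnSK.
Qed.

Lemma jcoef_step m k : (k <= m)%N ->
  qfac (m - k).+1 * qfac (m + k).+2 * jcoef m.+1 k =
  qfac m.+1 * qfac (2 * m).+2 * qfac (2 * m).+3 * jcoef m k.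
Proof.
move=> km; rewrite /jcoef km (leqW km) (subSn km) addSn.
have -> : (2 * m.+1 = (2 * m).+2)%N by lia.
have E1 : \prod_((m - k).+1 <= j < m.+1) qfac j * qfac m.+1 =
          qfac (m - k).+1 * \prod_((m - k).+2 <= j < m.+2) qfac j.
  transitivity (\prod_((m - k).+1 <= j < m.+2) qfac j).
    by rewrite [RHS]big_nat_recr//; lia.
  by rewrite big_ltn//; lia.
have E2 : \prod_((m + k).+2 <= j < (2 * m).+2) qfac j * qfac (2 * m).+2 * qfac (2 * m).+3 =
          qfac (m + k).+2 * \prod_((m + k).+3 <= j < (2 * m).+4) qfac j.
  transitivity (\prod_((m + k).+2 <= j < (2 * m).+4) qfac j).
    rewrite [RHS]big_nat_recr; last by lia.
    by rewrite [in RHS]big_nat_recr//; lia.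
  by rewrite big_ltn//; lia.
transitivity ((qfac (m - k).+1 * \prod_((m - k).+2 <= j < m.+2) qfac j) *
  (qfac (m + k).+2 * \prod_((m + k).+3 <= j < (2 * m).+4) qfac j)); first by ring.
by rewrite -E1 -E2; ring.
Qed.

Definition odd_sin z k : R := 2 * sin ((2 * k + 1)%:R * z).

Lemma odd_sin_rec z k : 2 * cos (2 * z) * odd_sin z k.+1 = odd_sin z k.+2 + odd_sin z k.
Proof.
rewrite /odd_sin.
have -> : (2 * k.+2 + 1)%:R * z = (2 * k.+1 + 1)%:R * z + 2 * z.
  by rewrite -mulrDl -natrD; congr (_%:R * _); lia.
have -> : (2 * k + 1)%:R * z = (2 * k.+1 + 1)%:R * z - 2 * z.
  by apply/eqP; rewrite eq_sym subr_eq -mulrDl -natrD; apply/eqP; congr (_%:R * _); lia.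
by rewrite sinD sinB; ring.
Qed.

Lemma odd_sin_rec0 z : 2 * cos (2 * z) * odd_sin z 0 = odd_sin z 1 - odd_sin z 0.
Proof.
rewrite /odd_sin.
have -> : (2 * 1 + 1)%:R * z = 2 * z + z by rewrite (_ : (2 * 1 + 1)%N = (2 + 1)%N)// natrD; ring.
rewrite (_ : (2 * 0 + 1)%:R = 1)// mul1r.
have E : sin z = sin (2 * z - z) by congr sin; ring.
by rewrite [X in _ - _ * X]E sinD sinB; ring.
Qed.

Definition jterm m k : {poly R} := (-1) ^+ k * 'X^(tri k) * jcoef m k.

(** The sign at k = 0 extends the terms to index -1, where sin((2k + 1) z) is - sin z. *)
Definition jprev m k : {poly R} := if k is k'.+1 then jterm m k' else - jterm m 0.

Lemma jterm_rec m k : (k <= m.+1)%N -> jterm m.+1 k =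
  qfac m.+1 * ((1 + 'X^(2 * m.+1)) * jterm m k - 'X^(m.+1) * (jterm m k.+1 + jprev m k)).
Proof.
rewrite leq_eqVlt => /orP[/eqP ->|].
  have jm n : (m < n)%N -> jterm m n = 0.
    by move=> mn; rewrite /jterm /jcoef leqNgt mn mulr0.
  have jE : jcoef m.+1 m.+1 = jcoef m m * qfac m.+1.
    rewrite /jcoef !leqnn !subnn !addnn -!mul2n.
    rewrite [\prod_((2 * m.+1).+2 <= _ < _) _]big_geq// [\prod_((2 * m).+2 <= _ < _) _]big_geq//.
    by rewrite !mulr1 big_nat_recr.
  rewrite (jm m.+1)// (jm m.+2)// /jprev /jterm jE /= exprD exprS.
  by ring.
rewrite ltnS => km.
(* After multiplication by these two factors, the coefficients at (m, k + 1), (m, k - 1) and (m + 1,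
   k) all become multiples of [jcoef m k]. *)
have a0 : qfac (m - k).+1 * qfac (m + k).+2 != 0 by rewrite mulf_neq0// qfac_neq0.
apply: (mulfI a0).
have := jcoef_step km; have := jcoef_prev km; have := jcoef_next km.
set J := jcoef m k => nx pv st.
have pvE : jprev m k * 'X^(m.+1) =
    - ((-1) ^+ k * 'X^(tri k) * 'X^((m - k).+1) * (if k is k'.+1 then jcoef m k' else jcoef m 0)).
  rewrite /jprev /jterm; case: k km {a0 nx pv st J} => [|k] km.
    by rewrite !expr0 /= subn0; ring.
  have -> : 'X^(m.+1) = 'X^((m - k.+1).+1) * 'X^(k.+1) :> {poly R}.
    by rewrite -exprD; congr ('X^_); lia.
  by rewrite /= exprD (exprS (-1) k); ring.
have nxE : jterm m k.+1 * 'X^(m.+1) =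
    - ((-1) ^+ k * 'X^(tri k) * 'X^((m + k).+2) * jcoef m k.+1).
  have -> : 'X^((m + k).+2) = 'X^(m.+1) * 'X^(k.+1) :> {poly R}.
    by rewrite -exprD; congr ('X^_); lia.
  by rewrite /jterm /= exprD (exprS (-1) k); ring.
move: pvE nxE pv nx.
set P := (if k is _.+1 then _ else _); set N := jcoef m k.+1; set JN := jterm m k.+1.
set JP := jprev m k => pvE nxE pv nx.
rewrite {1}/jterm {1}/jterm -/J.
set sg := (-1) ^+ k in pvE nxE *; set XT := 'X^(tri k) in pvE nxE *.
transitivity (sg * XT * (qfac m.+1 * qfac (2 * m).+2 * qfac (2 * m).+3 * J)); first by rewrite -st; ring.
pose D : {poly R} := 'X^(m - k); pose B : {poly R} := 'X^((m + k).+1).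
have DE : 'X^((m - k).+1) = 'X * D by rewrite exprS.
have BE : 'X^((m + k).+2) = 'X * B by rewrite exprS.
have Q2 : 'X^(2 * m.+1) = 'X * D * B by rewrite -exprS -exprD; congr ('X^_); lia.
have E2 : 'X^((2 * m).+2) = 'X * D * B by rewrite -exprS -exprD; congr ('X^_); lia.
have E3 : 'X^((2 * m).+3) = 'X * 'X * D * B by rewrite -mulrA -exprD mulrAC -!exprS -!exprSr; congr ('X^_); lia.
transitivity (qfac m.+1 * (qfac (m - k).+1 * qfac (m + k).+2 * (1 + 'X^(2 * m.+1)) * (sg * XT * J) -
   qfac (m - k).+1 * qfac (m + k).+2 * (JN * 'X^(m.+1) + JP * 'X^(m.+1)))); last by ring.
rewrite pvE nxE.
transitivity (qfac m.+1 * sg * XT * (qfac (m - k).+1 * qfac (m + k).+2 * (1 + 'X^(2 * m.+1)) * J +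
   (qfac (m - k).+1 * 'X^((m + k).+2) * (qfac (m + k).+2 * N) +
    qfac (m + k).+2 * 'X^((m - k).+1) * (qfac (m - k).+1 * P)))); last by ring.
rewrite nx pv /qfac -/D -/B DE BE Q2 E2 E3; move: 'X^(m.+1) => Q; ring.
Qed.

(** Finite form of Jacobi's triple product, by induction on m. The factor 2 cos 2z acts on the sines
    by a three-term recurrence; summation by parts ([shift]) moves it to the coefficients, where it
    becomes [jterm_rec]. *)
Lemma thetaP_expand z m :
  thetaP z m = \sum_(k < m.+1) (odd_sin z k)%:P * jterm m k.
Proof.
elim: m => [|m IH].
  rewrite /thetaP big_geq// big_ord1 /jterm /jcoef /= !big_geq// /odd_sin.
  by rewrite (_ : (2 * 0 + 1)%:R = 1)// mul1r !expr0 !mulr1.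
have -> : thetaP z m.+1 = thetaP z m *
   (((1 + 'X^(2 * m.+1)) - (2 * cos (2 * z))%:P * 'X^(m.+1)) * qfac m.+1).
  by rewrite /thetaP big_nat_recr//= /qfac; ring.
have shift (C : nat -> {poly R}) n :
    \sum_(k < n.+1) (2 * cos (2 * z))%:P * ((odd_sin z k)%:P * C k) =
    \sum_(k < n.+1) (odd_sin z k)%:P * (C k.+1 + if (k : nat) is k'.+1 then C k' else - C 0)
    - (odd_sin z n)%:P * C n.+1 + (odd_sin z n.+1)%:P * C n.
  elim: n => [|n IHn].
    by rewrite !big_ord1 mulrA -polyCM odd_sin_rec0 polyCB /=; ring.
  rewrite big_ord_recr IHn [in RHS]big_ord_recr/= mulrA -polyCM odd_sin_rec polyCD.
  by ring.
have jm n : (m < n)%N -> jterm m n = 0.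
  by move=> mn; rewrite /jterm /jcoef leqNgt mn mulr0.
have {}IH : thetaP z m = \sum_(k < m.+2) (odd_sin z k)%:P * jterm m k.
  by rewrite big_ord_recr/= jm// mulr0 addr0.
rewrite [RHS](eq_bigr (fun k : 'I_m.+2 => qfac m.+1 * (1 + 'X^(2 * m.+1)) * ((odd_sin z k)%:P * jterm m k) -
   qfac m.+1 * 'X^(m.+1) * ((odd_sin z k)%:P * (jterm m k.+1 + jprev m k)))); last first.
  move=> k _; have km : (k <= m.+1)%N by rewrite -ltnS.
  by rewrite jterm_rec//; ring.
rewrite sumrB -!big_distrr/= -IH.
have := shift (jterm m) m.+1; rewrite -big_distrr/= -IH (jm m.+1)// (jm m.+2)// !mulr0 subr0 addr0.
rewrite /jprev => <-; ring.
Qed.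

Definition one_mod n (p : {poly R}) := forall k, (k < n)%N -> p`_k = (k == 0)%:R.

Lemma one_modM n p q : one_mod n p -> one_mod n q -> one_mod n (p * q).
Proof.
move=> pP qP k kn; rewrite coefM big_ord_recl pP ?mul1r ?subn0 ?qP// ?big1 ?addr0//.
  by move=> i _; rewrite pP ?mul0r// lift0 (leq_ltn_trans (ltn_ord i)).
by rewrite (leq_ltn_trans _ kn).
Qed.

Lemma one_mod_prod n (a b : nat) (F : nat -> {poly R}) :
  (forall j, (a <= j < b)%N -> one_mod n (F j)) -> one_mod n (\prod_(a <= j < b) F j).
Proof.
move=> FP; rewrite big_nat_cond; apply: big_ind => [k _|p q|j].
- by rewrite coef1.
- exact: one_modM.
- by rewrite andbT; exact: FP.
Qed.

Lemma jcoef_mod m k : (k <= m)%N -> one_mod (m - k).+1 (jcoef m k).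
Proof.
move=> km; rewrite /jcoef km.
have qf j : ((m - k).+1 <= j)%N -> one_mod (m - k).+1 (qfac j).
  move=> jm l lm; rewrite coefB coef1 coefXn.
  by rewrite [l == j]ltn_eqF ?subr0// (leq_trans lm).
by apply: one_modM; apply: one_mod_prod => j jm; apply: qf; lia.
Qed.

(** [jcoef k n] is 1 modulo X^(k - n + 1) and tri n >= n, so in degree k - tri n at most its
    constant term contributes. *)
Lemma thetacE k z :
  thetac k z = \sum_(n < k.+1) (tri n == k)%:R * ((-1) ^+ n * odd_sin z n).
Proof.
rewrite /thetac thetaP_expand coef_sum; apply: eq_bigr => n _.
have nk : (n <= k)%N by rewrite -ltnS.
rewrite coefCM /jterm.
have -> : (-1) ^+ n = ((-1) ^+ n)%:P :> {poly R} by rewrite polyC_exp polyCN.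
rewrite -mulrA coefCM coefXnM; case: ltnP => nt.
  by rewrite gtn_eqF// !mulr0 mul0r.
have ln := leq_tri n.
rewrite jcoef_mod//; last by lia.
have -> : (k - tri n == 0)%N = (tri n == k) by lia.
by ring.
Qed.

End TripleProduct.

Import numFieldNormedType.Exports.

(** * Termwise differentiation in z *)

Section Termwise.
Variable R : realType.

Lemma is_derive_affine (f : R -> R) (a b x df : R) :
  is_derive (a * x + b) 1 f df -> is_derive x 1 (fun z => f (a * z + b)) (a * df).
Proof.
move=> fd; have fdd : derivable f (a * x + b) 1 by case: fd.
have H : is_derive x 1 (fun z : R => a * z + b) (a *: 1 + 0).
  by apply: is_deriveD; apply: is_deriveZ.
have ad : derivable (fun z : R => a * z + b) x 1 by case: H.
have cd : derivable (f \o (fun z : R => a * z + b)) x 1.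
  apply/derivable1_diffP; apply: differentiable_comp; apply/derivable1_diffP.
    exact: ad.
  exact: fdd.
apply: DeriveDef; first exact: cd.
rewrite -derive1E (derive1_comp ad fdd) !derive1E mulrC (@derive_val _ _ _ _ _ _ _ fd).
by rewrite (@derive_val _ _ _ _ _ _ _ H) addr0 /GRing.scale/= mulr1.
Qed.

Lemma is_derive_sumr n (f : 'I_n -> R -> R) (x : R) (df : 'I_n -> R) :
  (forall i, is_derive x 1 (f i) (df i)) ->
  is_derive x 1 (fun z => \sum_(i < n) f i z) (\sum_(i < n) df i).
Proof.
move=> fd; have -> : (fun z => \sum_(i < n) f i z) = \sum_(i < n) f i.
  by apply/funext => z; rewrite fct_sumE.
exact: is_derive_sum.
Qed.

(** The z-derivative is taken coefficient by coefficient in q, so no convergence in q is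
    involved. *)
Definition dz (F F' : R -> ps R) := forall k (z : R), is_derive z 1 (fun z => F z k : R) (F' z k).

(** The device for differentiating identities: two families equal for all z have equal
    derivatives. *)
Lemma dz_uniq F F' G G' : dz F F' -> dz G G' -> F =1 G -> F' =1 G'.
Proof.
move=> dF dG FG z; apply/psP => k.
have -> : F' z k = 'D_1 (fun z => F z k : R) z by rewrite (@derive_val _ _ _ _ _ _ _ (dF k z)).
have -> : G' z k = 'D_1 (fun z => G z k : R) z by rewrite (@derive_val _ _ _ _ _ _ _ (dG k z)).
by congr ('D_1 _ z); apply/funext => y; rewrite FG.
Qed.

Lemma dz_cst c : dz (fun=> c) (fun=> 0).
Proof. by move=> k z; exact: is_derive_cst. Qed.

Lemma dz_add F F' G G' : dz F F' -> dz G G' -> dz (fun z => F z + G z) (fun z => F' z + G' z).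
Proof. by move=> dF dG k z; exact: is_deriveD. Qed.

Lemma dz_opp F F' : dz F F' -> dz (fun z => - F z) (fun z => - F' z).
Proof. by move=> dF k z; exact: is_deriveN. Qed.

Lemma dz_sub F F' G G' : dz F F' -> dz G G' -> dz (fun z => F z - G z) (fun z => F' z - G' z).
Proof. by move=> dF dG; apply: dz_add => //; exact: dz_opp. Qed.

Lemma dz_mul F F' G G' : dz F F' -> dz G G' ->
  dz (fun z => F z * G z) (fun z => F' z * G z + F z * G' z).
Proof.
move=> dF dG k z.
have -> : (fun z => (F z * G z) k) = \sum_(i < k.+1) (fun z => F z i * G z (k - i)%N : R).
  by apply/funext => y; rewrite psM fct_sumE.
rewrite psD !psM -big_split/=; apply: is_derive_sum => i.
apply: is_derive_eq; first by apply: is_deriveM; [exact: dF|exact: dG].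
by rewrite /GRing.scale/=; ring.
Qed.

Lemma dz_affine F F' (a b : R) : dz F F' ->
  dz (fun z => F (a * z + b)) (fun z => pcst a * F' (a * z + b)).
Proof.
by move=> dF k z; rewrite pcstM; apply: (@is_derive_affine (fun z => F z k)); exact: dF.
Qed.

Lemma dz_ext F F' G G' : F =1 G -> F' =1 G' -> dz F F' -> dz G G'.
Proof. by move=> /funext <- /funext <-. Qed.

Lemma dz_shiftl F F' x : dz F F' -> dz (fun z => F (x + z)) (fun z => F' (x + z)).
Proof.
move=> /(@dz_affine _ _ 1 x); apply: dz_ext => z; rewrite mul1r addrC//.
by rewrite rmorph1 mul1r.
Qed.

Lemma dz_shiftr F F' x : dz F F' -> dz (fun z => F (z + x)) (fun z => F' (z + x)).
Proof. by move=> /(@dz_shiftl _ _ x); apply: dz_ext => z; rewrite addrC. Qed.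

Lemma dz_refl F F' x : dz F F' -> dz (fun z => F (x - z)) (fun z => - F' (x - z)).
Proof.
move=> /(@dz_affine _ _ (-1) x); apply: dz_ext => z; rewrite mulN1r addrC//.
by rewrite rmorphN1 mulN1r.
Qed.

Lemma dz_double F F' : dz F F' -> dz (fun z => F (z + z)) (fun z => 2 * F' (z + z)).
Proof.
move=> /(@dz_affine _ _ 2 0); have E (z : R) : 2 * z + 0 = z + z by ring.
by apply: dz_ext => z; rewrite E// rmorph_nat.
Qed.

End Termwise.

(** * Heat equation, parity and period of theta *)

Section ThetaSeries.
Variable R : realType.

Definition dsin (j : nat) (u : R) : R :=
  (-1) ^+ j./2 * (if odd j then cos u else sin u).

Lemma is_derive_dsin j (u : R) : is_derive u 1 (dsin j) (dsin j.+1 u).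
Proof.
have -> : dsin j = (-1) ^+ j./2 \*: (if odd j then cos else sin : R -> R).
  by apply/funext => y; rewrite /dsin; case: odd.
rewrite /dsin /= uphalf_half; case: (odd j) => /=.
  by apply: is_derive_eq; rewrite /GRing.scale/= exprS; ring.
exact: is_derive_eq.
Qed.

Lemma dsin_addpi j (u : R) m : dsin j (u + m%:R * pi) = (-1) ^+ m * dsin j u.
Proof.
elim: m => [|m IH]; first by rewrite mul0r addr0 mul1r.
rewrite -natr1 mulrDl mul1r addrA exprS -mulrA -IH /dsin.
by case: odd; rewrite ?cosDpi ?sinDpi; ring.
Qed.

Lemma dsinN j (u : R) : dsin j (- u) = (-1) ^+ j.+1 * dsin j u.
Proof.
by rewrite /dsin exprS -(signr_odd _ j); case: (odd j); rewrite ?cosN ?sinN/=; ring.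
Qed.

Lemma dsinSS j (u : R) : dsin j.+2 u = - dsin j u.
Proof. by rewrite /dsin /= negbK exprS; case: odd; ring. Qed.

(** Jacobi's series 2 sum (-1)^n q^(n(n+1)/2) sin((2n+1) z), differentiated j times in z; [thetaE]
    identifies it with [theta j]. *)
Definition th j z : ps R := fun k =>
  \sum_(n < k.+1) (tri n == k)%:R * ((-1) ^+ n * (2 * ((2 * n + 1)%:R ^+ j * dsin j ((2 * n + 1)%:R * z)))).

Lemma dz_th j : dz (th j) (th j.+1).
Proof.
move=> k z.
pose c (n : nat) : R := (tri n == k)%:R * (-1) ^+ n * 2 * (2 * n + 1)%:R ^+ j.
have -> : (fun z => th j z k) = (fun z => \sum_(n < k.+1) c n * dsin j ((2 * n + 1)%:R * z + 0)).
  by apply/funext => y; apply: eq_bigr => n _; rewrite addr0 /c; ring.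
have -> : th j.+1 z k = \sum_(n < k.+1) c n * ((2 * n + 1)%:R * dsin j.+1 ((2 * n + 1)%:R * z + 0)).
  by apply: eq_bigr => n _; rewrite addr0 /c exprS; ring.
apply: (@is_derive_sumr _ k.+1 (fun n z => c n * dsin j ((2 * n + 1)%:R * z + 0))) => n.
by apply: is_deriveZ; apply: is_derive_affine; exact: is_derive_dsin.
Qed.

Lemma thetaE j z : theta j z = th j z.
Proof.
apply/funext => k; rewrite /theta; elim: j z => [|j IH] z.
  rewrite derive1n0 thetacE; apply: eq_bigr => n _.
  by rewrite /odd_sin /dsin /= !expr0 !mul1r.
rewrite derive1nS derive1E.
have -> : @derive1n R R^o j (thetac k) = (fun z => th j z k) by apply/funext.
by rewrite (@derive_val _ _ _ _ _ _ _ (dz_th j k z)).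
Qed.

(** An exponent k = n(n+1)/2 satisfies 8 k + 1 = (2n+1)^2. The summand [th j z] makes up for the
    factor q^(1/8) absent from theta. *)
Lemma th_heat j z : 8 * qD (th j z) + th j z = - th j.+2 z.
Proof.
apply/psP => k.
have -> : (8 * qD (th j z) + th j z) k = (8 * k%:R + 1) * th j z k.
  by rewrite psD mulr_natl psMn /qD -mulr_natl; ring.
rewrite psN /th big_distrr -sumrN; apply: eq_bigr => n _ /=.
case: eqP => [tk|]; last by rewrite !mul0r ?mulr0 oppr0.
have E : 8 * k%:R + 1 = (2 * n + 1)%:R ^+ 2 :> R.
  rewrite -natrM -natrX natr1; congr (_%:R).
  by have := tri2 n; rewrite tk !expnS !expn0; lia.
by rewrite E dsinSS !exprS expr0; ring.
Qed.

Lemma th_addpi_nat j z m : th j (z + m%:R * pi) = (-1) ^+ m * th j z.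
Proof.
apply/psP => k.
have -> : ((-1) ^+ m * th j z) k = (-1) ^+ m * th j z k.
  by rewrite -pcstM rmorphXn rmorphN1.
rewrite /th big_distrr; apply: eq_bigr => n _ /=.
have -> : (2 * n + 1)%:R * (z + m%:R * pi) = (2 * n + 1)%:R * z + ((2 * n + 1) * m)%:R * pi.
  by rewrite (natrM _ (2 * n + 1)%N m); ring.
rewrite dsin_addpi.
have -> : (-1) ^+ ((2 * n + 1) * m) = (-1) ^+ m :> R.
  by rewrite -signr_odd oddM oddD oddM /= signr_odd.
by ring.
Qed.

Lemma th_addpi (k : int) : exists s : ps R, s \is a GRing.unit /\
  forall j z, th j (z + k%:~R * pi) = s * th j z.
Proof.
case: k => m.
  exists ((-1) ^+ m); split; first by rewrite unitrX// unitrN1.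
  by move=> j z; rewrite th_addpi_nat.
exists ((-1) ^+ m.+1); split; first by rewrite unitrX// unitrN1.
move=> j z; rewrite -[in RHS](subrK (m.+1%:R * pi) z) th_addpi_nat mulrA -expr2 sqrr_sign mul1r.
by rewrite NegzE mulrNz mulNr.
Qed.

Lemma thN j z : th j (- z) = (-1) ^+ j.+1 * th j z.
Proof.
apply/psP => k.
have -> : ((-1) ^+ j.+1 * th j z) k = (-1) ^+ j.+1 * th j z k.
  by rewrite -pcstM rmorphXn rmorphN1.
rewrite /th big_distrr; apply: eq_bigr => n _ /=.
by rewrite mulrN dsinN; ring.
Qed.

Lemma th_coef0 j z : th j z 0 = 2 * dsin j z.
Proof. by rewrite /th big_ord1 /= expr0 (_ : (2 * 0 + 1)%:R = 1)// expr1n !mul1r. Qed.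

Lemma th_coef1 j z : th j z 1 = - (2 * (3 ^+ j * dsin j (3 * z))).
Proof.
rewrite /th big_ord_recr big_ord1 /= mul0r add0r mul1r expr1.
by rewrite (_ : (2 * 1 + 1)%:R = 3)//; ring.
Qed.

Lemma th_unit z : sin z != 0 -> th 0 z \is a GRing.unit.
Proof. by move=> sz; rewrite ps_unitE th_coef0 /dsin/= expr0 mul1r mulf_neq0 ?pnatr_eq0. Qed.

Lemma sin_eq0 z : sin z = 0 :> R -> exists k : int, z = k%:~R * pi.
Proof.
move=> sz; pose k := Num.floor (z / pi); exists k.
have pi0 : 0 < pi :> R := pi_gt0 R.
have r0 : 0 <= z - k%:~R * pi by rewrite subr_ge0 -ler_pdivlMr// ge_floor.
have r1 : z - k%:~R * pi < pi.
  by have := floorD1_gt (z / pi); rewrite intrD ltr_pdivrMr// mulrDl mul1r ltrBlDl.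
have sr : sin (z - k%:~R * pi) = 0.
  have nat_case (u : R) m : sin u = 0 -> sin (u + m%:R * pi) = 0.
    by have := dsin_addpi 0 u m; rewrite /dsin /= !expr0 !mul1r => -> ->; rewrite mulr0.
  case: (k) => m; last by rewrite NegzE mulrNz mulNr opprK; exact: nat_case.
  have := dsin_addpi 0 (z - m%:R * pi) m; rewrite /dsin /= !expr0 !mul1r subrK sz => /esym/eqP.
  by rewrite mulf_eq0 signr_eq0 => /eqP.
apply/eqP; rewrite -subr_eq0 eq_sym; apply: contra_eqT sr => r00.
by rewrite gt_eqF// sin_gt0_pi// r1 andbT lt_neqAle r00.
Qed.

End ThetaSeries.

(** * Theta products as sums over the integer lattice *)

Section LatticeSums.
Variable R : realType.
Implicit Types (F a b : int -> R) (x y z : R).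

(** The range -n <= m < n is stable under m -> -1 - m, which swaps [Posz i] and [Negz i] and fixes m
    (m + 1); the cancellations in the sums below come from this involution. *)
Definition box (n : nat) : seq int := [seq Posz i | i <- iota 0 n] ++ [seq Negz i | i <- iota 0 n].

Lemma mem_box n (m : int) : (m \in box n) = (- n%:Z <= m < n%:Z).
Proof.
rewrite mem_cat; case: m => m.
  rewrite mem_map ?mem_iota; last by move=> ? ? [].
  have -> : (Posz m \in [seq Negz i | i <- iota 0 n]) = false by apply/negP => /mapP[].
  lia.
rewrite (mem_map (f := Negz)) ?mem_iota; last by move=> ? ? [].
have -> : (Negz m \in [seq Posz i | i <- iota 0 n]) = false by apply/negP => /mapP[].
rewrite NegzE /=; lia.
Qed.

Lemma uniq_box n : uniq (box n).
Proof.
rewrite cat_uniq !map_inj_uniq ?iota_uniq/= ?andbT; try by move=> ? ? [].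
by apply/hasPn => m /mapP[i _ ->]; apply/negP => /mapP[].
Qed.

Lemma sum_box n F : \sum_(m <- box n) F m = \sum_(i < n) (F (Posz i) + F (Negz i)).
Proof.
have E : iota 0 n = index_iota 0 n by rewrite /index_iota subn0.
by rewrite big_cat !big_map E !big_mkord big_split.
Qed.

Lemma sum_box_widen n p F : (n <= p)%N -> (forall m, m \notin box n -> F m = 0) ->
  \sum_(m <- box n) F m = \sum_(m <- box p) F m.
Proof.
move=> np F0; rewrite !sum_box -(subnKC np) big_split_ord/= [X in _ + X]big1 ?addr0// => i _.
by rewrite !F0 ?addr0// mem_box ?NegzE; apply/negP; lia.
Qed.

Lemma sum_box_odd n F : (forall i, F (Negz i) = - F (Posz i)) -> \sum_(m <- box n) F m = 0.
Proof. by move=> Fo; rewrite sum_box big1// => i _; rewrite Fo subrr. Qed.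

Lemma conv_box (s : seq int) (u v : int -> nat) a b k :
  \sum_(i < k.+1) (\sum_(m <- s) (u m == i)%:R * a m) * (\sum_(n <- s) (v n == k - i)%N%:R * b n) =
  \sum_(m <- s) \sum_(n <- s) (u m + v n == k)%:R * (a m * b n).
Proof.
under eq_bigr do rewrite big_distrlr/=.
rewrite exchange_big; apply: eq_bigr => m _; rewrite exchange_big; apply: eq_bigr => n _ /=.
transitivity ((\sum_(i < k.+1) (u m == i)%:R * (v n == k - i)%N%:R) * (a m * b n) : R).
  by rewrite big_distrl; apply: eq_bigr => i _ /=; ring.
congr (_ * _); case: (leqP (u m) k) => uk.
  rewrite (bigD1 (Ordinal (uk : (u m < k.+1)%N)))//= eqxx mul1r big1 ?addr0.
    by congr (_%:R); lia.
  move=> i ui; have -> : (u m == i) = false by apply/negbTE; rewrite eq_sym; exact: ui.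
  by rewrite mul0r.
rewrite big1 => [|i _]; first by rewrite [_ == k]gtn_eqF//; lia.
by rewrite [_ == _ :> nat]gtn_eqF ?mul0r//; move: (ltn_ord i); lia.
Qed.

Definition itri (m : int) : nat := match m with Posz n => tri n | Negz n => tri n end.

Lemma itri2 (m : int) : (2 * itri m)%:Z = m * (m + 1).
Proof. by case: m => n /=; rewrite tri2 ?NegzE; nia. Qed.

Definition podd (m : int) := odd `|m|.

Definition sg (m : int) : R := (-1) ^+ podd m.

(** The terms at m and -1 - m are equal, which absorbs the factor 2 of the one-sided series. *)
Lemma th0_box z k n : (k < n)%N ->
  th 0 z k = \sum_(m <- box n) (itri m == k)%:R * (sg m * sin ((2 * m + 1)%:~R * z)).
Proof.
move=> kn; rewrite -(@sum_box_widen k.+1)//; last first.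
  move=> m; rewrite mem_box => mk; have -> : (itri m == k) = false; last by rewrite mul0r.
  by apply/negP => /eqP ik; have := itri2 m; rewrite ik => E; move/negP: mk; apply; nia.
rewrite sum_box /th; apply: eq_bigr => i _ /=.
rewrite /sg /podd /= -(signr_odd _ i) -mulrDr; congr (_ * _).
have -> : (2 * Negz i + 1)%:~R * z = - ((2 * Posz i + 1)%:~R * z).
  by rewrite -mulNr -mulrNz; congr (_%:~R * _); rewrite NegzE; lia.
rewrite sinN expr0 mul1r /dsin /= expr0 mul1r.
have -> : (2 * Posz i + 1)%:~R = (2 * i + 1)%:R :> R by [].
by case: (odd i) => /=; ring.
Qed.

Definition cw (k : nat) (l : int) : R := (l * l == k%:Z)%:R.
Definition dw (k : nat) (r : int) : R := (r * (r + 1) == k%:Z)%:R.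
Definition cf (l : int) : R := (4 * l)%:~R.
Definition df (r : int) : R := (4 * r + 2)%:~R.

(* For (w, f) = (cw, cf) and (dw, df) these are the j-th z-derivatives of
   sum_l q^(l^2) cos(4lz) and sum_r q^(r(r+1)) cos((4r+2)z), with l and r in Z. *)
Definition trig (w : nat -> int -> R) (f : int -> R) (j : nat) z : ps R := fun k =>
  \sum_(l <- box k.+1) w k l * (f l ^+ j * dsin j.+1 (f l * z)).

Lemma dz_trig w f j : dz (trig w f j) (trig w f j.+1).
Proof.
move=> k z; pose t j z (l : int) : R := w k l * (f l ^+ j * dsin j.+1 (f l * z)).
have -> : (fun z => trig w f j z k) = (fun z => \sum_(i < k.+1) (t j z (Posz i) + t j z (Negz i))).
  by apply/funext => y; rewrite /trig (sum_box _ (t j y)).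
have -> : trig w f j.+1 z k = \sum_(i < k.+1) (t j.+1 z (Posz i) + t j.+1 z (Negz i)).
  by rewrite /trig (sum_box _ (t j.+1 z)).
have dt l : is_derive (z : R) 1 (fun z : R => t j z l : R) (t j.+1 z l).
  have -> : (fun z => t j z l) = (fun z => (w k l * f l ^+ j) * dsin j.+1 (f l * z + 0)).
    by apply/funext => y; rewrite addr0 /t mulrA.
  have -> : t j.+1 z l = (w k l * f l ^+ j) * (f l * dsin j.+2 (f l * z + 0)).
    by rewrite addr0 /t exprS; ring.
  by apply: is_deriveZ; apply: is_derive_affine; exact: is_derive_dsin.
exact: (@is_derive_sumr _ k.+1 (fun i z => t j z (Posz i) + t j z (Negz i))).
Qed.

Lemma dsin1 (u : R) : dsin 1 u = cos u. Proof. by rewrite /dsin /= mul1r. Qed.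

Lemma trig_box w f z k n : (k < n)%N -> (forall l, l \notin box k.+1 -> w k l = 0) ->
  trig w f 0 z k = \sum_(l <- box n) w k l * cos (f l * z).
Proof.
move=> kn w0; rewrite -(@sum_box_widen k.+1)//; last by move=> l /w0 ->; rewrite mul0r.
by apply: eq_bigr => l _; rewrite expr0 mul1r dsin1.
Qed.

Lemma podd_add (m n : int) : podd (m + n) = podd m (+) podd n.
Proof. by rewrite /podd; lia. Qed.

Lemma sq_bound (l : int) (k : nat) : l * l <= k%:Z -> - k.+1%:Z <= l < k.+1%:Z.
Proof. by nia. Qed.

Lemma pronic_ge0 (r : int) : 0 <= r * (r + 1).
Proof. by nia. Qed.

Lemma pronic_bound (r : int) (k : nat) : r * (r + 1) <= 2 * k%:Z -> - k.+1%:Z <= r < k.+1%:Z.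
Proof. by nia. Qed.

(** [phi] is a bijection from the lattice to one parity class that matches the two quadratic forms.
    Each form bounds its own variables, so both sums may be cut off at the same box. *)
Lemma lattice_sum k (P : bool) (phi : int * int -> int * int) (E : int * int -> R) :
  (forall l r, podd ((phi (l, r)).1 + (phi (l, r)).2) = P) ->
  (forall l r, (phi (l, r)).1 * ((phi (l, r)).1 + 1) + (phi (l, r)).2 * ((phi (l, r)).2 + 1)
     = 2 * (l * l + r * (r + 1)) ) ->
  (forall m n, podd (m + n) = P -> exists lr, phi lr = (m, n)) -> injective phi ->
  \sum_(p <- [seq (m, n) | m <- box k.+1, n <- box k.+1] | (itri p.1 + itri p.2 == k)%N && (podd (p.1 + p.2) == P)) E p =
  \sum_(p <- [seq (l, r) | l <- box k.+1, r <- box k.+1] | p.1 * p.1 + p.2 * (p.2 + 1) == k%:Z) E (phi p).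
Proof.
move=> phiP phiQ phiS phiI; move: (box k.+1) (mem_box k.+1) (uniq_box k.+1) => B mem_B uniq_B.
rewrite -[LHS]big_filter -[RHS]big_filter -(big_map phi xpredT E); apply: perm_big.
have tE m n : (itri m + itri n == k)%N = (m * (m + 1) + n * (n + 1) == 2 * k%:Z).
  by rewrite -!itri2; lia.
have pair_uniq : uniq [seq (m, n) | m <- B, n <- B].
  by rewrite allpairs_uniq ?uniq_B// => -[? ?] [? ?] _ _ [-> ->].
apply: uniq_perm; first exact: filter_uniq.
  by rewrite map_inj_uniq// filter_uniq.
move=> [m n]; rewrite mem_filter /= tE; apply/idP/mapP => [|[[l r]]].
  move=> /andP[/andP[/eqP mn /eqP /phiS [[l r] lrE]] _]; exists (l, r); last by rewrite lrE.
  have := phiQ l r; rewrite lrE /= mn => Q.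
  rewrite mem_filter /=; apply/andP; split; first by apply/eqP; lia.
  have r0 := pronic_ge0 r; have l0 : 0 <= l * l by nia.
  apply/allpairsP; exists (l, r); rewrite !mem_B; split=> //=; first by apply: sq_bound; lia.
  by apply: pronic_bound; lia.
rewrite mem_filter /= => /andP[/eqP lr _] mnE.
have := phiQ l r; have := phiP l r; rewrite -mnE /= => -> mn.
rewrite eqxx andbT; apply/andP; split; first by apply/eqP; lia.
have m0 := pronic_ge0 m; have n0 := pronic_ge0 n.
by apply/allpairsP; exists (m, n); rewrite !mem_B; split=> //=; apply: pronic_bound; lia.
Qed.

(* The double series on the left is sorted by the parity of m + n, substituting
   (m, n) = (l + r, l - r - 1) and (m, n) = (r + l, r - l). *)
Lemma theta_determinant x y :
  th 0 (x + y) * th 0 (x - y) =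
  trig cw cf 0 x * trig dw df 0 y - trig dw df 0 x * trig cw cf 0 y.
Proof.
apply/psP => k; rewrite psB !psM.
pose B := box k.+1.
have cw0 i l : l \notin box i.+1 -> cw i l = 0.
  rewrite mem_box /cw => li; have -> : (l * l == i%:Z) = false => //.
  by apply/negP => /eqP; move/negP: li; nia.
have dw0 i l : l \notin box i.+1 -> dw i l = 0.
  rewrite mem_box /dw => li; have -> : (l * (l + 1) == i%:Z) = false => //.
  by apply/negP => /eqP; move/negP: li; nia.
have sqE (l : int) (i : nat) : (l * l == i%:Z) = (absz (l * l) == i).
  have : 0 <= l * l by nia.
  by move: (l * l) => u u0; lia.
have prE (l : int) (i : nat) : (l * (l + 1) == i%:Z) = (absz (l * (l + 1)) == i).
  by move: (pronic_ge0 l); move: (l * (l + 1)) => u u0; lia.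
have kl (i : 'I_k.+1) : (i < k.+1)%N by [].
have kr (i : 'I_k.+1) : (k - i < k.+1)%N by rewrite ltnS leq_subr.
pose ang m n : R := (2 * (m + n + 1))%:~R * x + (2 * (m - n))%:~R * y.
(* With sin a sin b = cos a cos b - cos(a + b), the terms cos a cos b cancel in pairs under n -> -1
   - n, which fixes the cosine and flips [sg n]. *)
transitivity (- \sum_(m <- B) \sum_(n <- B) (itri m + itri n == k)%:R * (sg m * sg n * cos (ang m n))).
  under eq_bigr => i _ do rewrite (th0_box _ (kl i)) (th0_box _ (kr i)).
  rewrite conv_box -sumrN; apply: eq_bigr => m _; apply/eqP; rewrite -subr_eq0 opprK -big_split/=.
  apply/eqP; set a := (2 * m + 1)%:~R * (x + y).
  transitivity (\sum_(n <- B) (itri m + itri n == k)%:R * (sg m * sg n * (cos a * cos ((2 * n + 1)%:~R * (x - y))))).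
    apply: eq_bigr => n _; have -> : ang m n = a + (2 * n + 1)%:~R * (x - y).
      by rewrite /ang /a !intrD !intrM !intrD; ring.
    by rewrite cosD; ring.
  apply: sum_box_odd => i /=.
  have -> : (2 * Negz i + 1)%:~R * (x - y) = - ((2 * Posz i + 1)%:~R * (x - y)).
    by rewrite -mulNr -mulrNz; congr (_%:~R * _); rewrite NegzE; lia.
  by rewrite cosN /sg /podd /=; case: (odd i) => /=; ring.
pose W l r : R := (l * l + r * (r + 1) == k%:Z)%:R.
(* Likewise cos a cos b = cos(a + b) + sin a sin b, and the products of sines cancel under r -> -1 -
   r. *)
transitivity (\sum_(l <- B) \sum_(r <- B) W l r * cos (cf l * x + df r * y)
   - \sum_(l <- B) \sum_(r <- B) W l r * cos (df r * x + cf l * y)); last first.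
  have WE l r : W l r = (absz (l * l)%R + absz (r * (r + 1))%R == k)%N%:R.
    rewrite /W; have l0 : 0 <= l * l by nia.
    move: (pronic_ge0 r).
    by move: (l * l) (r * (r + 1)) l0 => u v u0 v0; congr (_%:R); lia.
  congr (_ - _).
    under [RHS]eq_bigr => i _ do rewrite (trig_box cf x (kl i) (cw0 i)) (trig_box df y (kr i) (dw0 (k - i)%N)) /cw /dw.
    under [RHS]eq_bigr => i _.
      under eq_bigr => l _ do rewrite sqE.
      under [X in _ * X]eq_bigr => l _ do rewrite prE.
      over.
    rewrite conv_box; apply: eq_bigr => l _; apply/eqP; rewrite eq_sym -subr_eq0 -sumrB.
    apply/eqP; transitivity (\sum_(r <- B) W l r * (sin (cf l * x) * sin (df r * y))).
      by apply: eq_bigr => r _; rewrite WE cosD; ring.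
    apply: sum_box_odd => i; rewrite -mulrN -mulrN -sinN /W.
    have -> : df (Negz i) * y = - (df i * y).
      by rewrite -mulNr /df -mulrNz; congr (_%:~R * _); rewrite NegzE; lia.
    by congr (_%:R * _); rewrite NegzE; congr (_ == _); ring.
  under [RHS]eq_bigr => i _ do rewrite (trig_box df x (kl i) (dw0 i)) (trig_box cf y (kr i) (cw0 (k - i)%N)) /cw /dw.
  under [RHS]eq_bigr => i _.
    under eq_bigr => l _ do rewrite prE.
    under [X in _ * X]eq_bigr => l _ do rewrite sqE.
    over.
  rewrite conv_box [RHS]exchange_big; apply: eq_bigr => l _; apply/eqP; rewrite eq_sym -subr_eq0 -sumrB.
  apply/eqP; transitivity (\sum_(r <- B) W l r * (sin (df r * x) * sin (cf l * y))).
    by apply: eq_bigr => r _; rewrite WE cosD addnC; ring.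
  apply: sum_box_odd => i; rewrite -mulrN -mulNr -sinN /W.
  have -> : df (Negz i) * x = - (df i * x).
    by rewrite -mulNr /df -mulrNz; congr (_%:~R * _); rewrite NegzE; lia.
  by congr (_%:R * _); rewrite NegzE; congr (_ == _); ring.
have pairs (C : int -> int -> bool) (F : int -> int -> R) :
    \sum_(m <- B) \sum_(n <- B) (C m n)%:R * F m n =
    \sum_(p <- [seq (m, n) | m <- B, n <- B] | C p.1 p.2) F p.1 p.2.
  rewrite [RHS]big_mkcond big_allpairs; apply: eq_bigr => m _; apply: eq_bigr => n _ /=.
  by case: C; rewrite ?mul1r ?mul0r.
(* The sign [sg m * sg n] depends only on the parity of m + n: odd pairs give the first term of the
   determinant, even pairs the second. *)
rewrite !pairs (bigID (fun p => podd (p.1 + p.2))) opprD/=.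
pose phi1 (p : int * int) := (p.1 + p.2, p.1 - p.2 - 1).
pose phi2 (p : int * int) := (p.2 + p.1, p.2 - p.1).
have /= L1 := @lattice_sum k true phi1 (fun p => cos (ang p.1 p.2)) _ _ _ _.
have /= L2 := @lattice_sum k false phi2 (fun p => cos (ang p.1 p.2)) _ _ _ _.
congr (_ + _).
  rewrite -sumrN.
  transitivity (\sum_(p <- [seq (m, n) | m <- B, n <- B] | (itri p.1 + itri p.2 == k)%N && (podd (p.1 + p.2) == true)) cos (ang p.1 p.2)).
    apply: eq_big => [p|p /andP[_ pp]]; first by rewrite eqb_id.
    rewrite /sg -mulNr; suff -> : - ((-1) ^+ podd p.1 * (-1) ^+ podd p.2) = 1 :> R by rewrite mul1r.
    by rewrite -signr_addb -podd_add pp expr1 opprK.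
  rewrite L1.
  - apply: eq_bigr => -[l r] _; rewrite /ang /phi1 /cf /df /=; congr cos; congr (_%:~R * _ + _%:~R * _); ring.
  - by move=> l r; rewrite /podd; lia.
  - by move=> l r; ring.
  - move=> m n mn; exists (((m + n + 1) %/ 2)%Z, ((m - n - 1) %/ 2)%Z); rewrite /phi1 /=.
    by move: mn; rewrite /podd => mn; congr (_, _); lia.
  - by move=> [a b] [c d] [? ?]; congr (_, _); lia.
congr (- _).
transitivity (\sum_(p <- [seq (m, n) | m <- B, n <- B] | (itri p.1 + itri p.2 == k)%N && (podd (p.1 + p.2) == false)) cos (ang p.1 p.2)).
  apply: eq_big => [p|p /andP[_ pp]]; first by rewrite eqbF_neg.
  rewrite /sg; suff -> : ((-1) ^+ podd p.1 * (-1) ^+ podd p.2) = 1 :> R by rewrite mul1r.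
  by rewrite -signr_addb -podd_add (negbTE pp).
rewrite L2.
- apply: eq_bigr => -[l r] _; rewrite /ang /phi2 /cf /df /=; congr cos; congr (_%:~R * _ + _%:~R * _); ring.
- by move=> l r; rewrite /podd; lia.
- by move=> l r; ring.
- move=> m n mn; exists (((m - n) %/ 2)%Z, ((m + n) %/ 2)%Z); rewrite /phi2 /=.
  by move: mn; rewrite /podd => mn; congr (_, _); lia.
- by move=> [a b] [c d] [? ?]; congr (_, _); lia.
Qed.

End LatticeSums.

(** * Bilinear identities between derivatives of theta *)

Section ThetaIdentities.
Variable R : realType.
Implicit Types x y z : R.

Local Notation c j := (trig (cw R) (cf R) j).
Local Notation d j := (trig (dw R) (df R) j).
Local Notation t j := (th j).

Let rhs x j y : ps R := c 0 x * d j y - d 0 x * c j y.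

Lemma dz_rhs x j : dz (rhs x j) (rhs x j.+1).
Proof.
have := dz_sub (dz_mul (dz_cst (c 0 x)) (dz_trig (dw R) (df R) j)) (dz_mul (dz_cst (d 0 x)) (dz_trig (cw R) (cf R) j)).
by apply: dz_ext => // y; rewrite /rhs !mul0r !add0r.
Qed.

Lemma dz_pair i j x : dz (fun y => t i (x + y) * t j (x - y))
  (fun y => t i.+1 (x + y) * t j (x - y) - t i (x + y) * t j.+1 (x - y)).
Proof.
have := dz_mul (dz_shiftl x (dz_th i)) (dz_refl x (dz_th j)).
by apply: dz_ext => // y; rewrite mulrN.
Qed.

Lemma dz_scale n (G G' : R -> ps R) : dz G G' -> dz (fun y => n%:R * G y) (fun y => n%:R * G' y).
Proof.
move=> dG; have := dz_mul (dz_cst (n%:R : ps R)) dG.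
by apply: dz_ext => // y; rewrite mul0r add0r.
Qed.

(** The successive y-derivatives of [theta_determinant]; at y = 0 those of even order are Hirota's
    bilinear derivatives of theta, still written as determinants in (c, d)(x). *)
Lemma theta_det1 x y : t 1 (x + y) * t 0 (x - y) - t 0 (x + y) * t 1 (x - y) = rhs x 1 y.
Proof. exact: (dz_uniq (dz_pair 0 0 x) (dz_rhs x 0) (theta_determinant x) y). Qed.

Lemma theta_det2 x y : t 2 (x + y) * t 0 (x - y) - 2 * (t 1 (x + y) * t 1 (x - y))
  + t 0 (x + y) * t 2 (x - y) = rhs x 2 y.
Proof.
have E := dz_uniq (dz_sub (dz_pair 1 0 x) (dz_pair 0 1 x)) (dz_rhs x 1) (theta_det1 x) y.
by apply: (eq_by E) => /=; ring.
Qed.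

Lemma theta_det3 x y : t 3 (x + y) * t 0 (x - y) - 3 * (t 2 (x + y) * t 1 (x - y))
  + 3 * (t 1 (x + y) * t 2 (x - y)) - t 0 (x + y) * t 3 (x - y) = rhs x 3 y.
Proof.
have E := dz_uniq (dz_add (dz_sub (dz_pair 2 0 x) (dz_scale 2 (dz_pair 1 1 x))) (dz_pair 0 2 x))
  (dz_rhs x 2) (theta_det2 x) y.
by apply: (eq_by E) => /=; ring.
Qed.

Lemma theta_det4 x y : t 4 (x + y) * t 0 (x - y) - 4 * (t 3 (x + y) * t 1 (x - y))
  + 6 * (t 2 (x + y) * t 2 (x - y)) - 4 * (t 1 (x + y) * t 3 (x - y))
  + t 0 (x + y) * t 4 (x - y) = rhs x 4 y.
Proof.
have E := dz_uniq (dz_sub (dz_add (dz_sub (dz_pair 3 0 x) (dz_scale 3 (dz_pair 2 1 x)))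
  (dz_scale 3 (dz_pair 1 2 x))) (dz_pair 0 3 x)) (dz_rhs x 3) (theta_det3 x) y.
by apply: (eq_by E) => /=; ring.
Qed.

Definition theta_K z : ps R := t 0 z * t 2 z - t 1 z ^+ 2.

Lemma th_even0 j : t j.*2 0 = 0 :> ps R.
Proof.
have := @thN R j.*2 0; rewrite oppr0 exprS -signr_odd odd_double mulr1 mulN1r => /eqP.
rewrite -subr_eq0 opprK -mulr2n -mulr_natl mulf_eq0 (negbTE (psnat_neq0 _ 1)).
by move=> /eqP.
Qed.

Lemma theta_sq x : t 0 x ^+ 2 = c 0 x * d 0 0 - d 0 x * c 0 0.
Proof. by rewrite -theta_determinant addr0 subr0. Qed.

Lemma theta_K2 x : 2 * theta_K x = c 0 x * d 2 0 - d 0 x * c 2 0.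
Proof. by have := theta_det2 x 0; rewrite addr0 subr0 /rhs /theta_K => <-; ring. Qed.

(* Pluecker relation between the vectors (c, d) at x and y and its even derivatives at 0 *)
Lemma theta_product x y : t 1 0 ^+ 2 * (t 0 (x + y) * t 0 (x - y)) =
  theta_K x * t 0 y ^+ 2 - theta_K y * t 0 x ^+ 2.
Proof.
apply: (mulfI (psnat_neq0 R 1)).
have K0 : - 2 * t 1 0 ^+ 2 = c 0 0 * d 2 0 - d 0 0 * c 2 0.
  by rewrite -theta_K2 /theta_K (th_even0 0) mul0r sub0r mulrN mulNr.
transitivity (- ((- 2 * t 1 0 ^+ 2) * (t 0 (x + y) * t 0 (x - y)))); first by ring.
transitivity ((2 * theta_K x) * t 0 y ^+ 2 - (2 * theta_K y) * t 0 x ^+ 2); last by ring.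
rewrite K0 theta_determinant.
by rewrite !theta_K2 !theta_sq; ring.
Qed.

Definition theta_e : ps R := t 3 0 / t 1 0.

Lemma th10_unit : t 1 0 \is a @GRing.unit (ps R).
Proof. by rewrite ps_unitE th_coef0 /dsin /= cos0 expr0 !mulr1 pnatr_eq0. Qed.

(** Twice the left side, theta^2 and 2 K are determinants of (c, d)(z) with the derivatives of (c,
    d) at 0 of orders 4, 0 and 2. These are three vectors in a plane, hence linearly related;
    setting z = 0 identifies two of the coefficients through theta'(0) and theta'''(0), and the
    third gives [C]. *)
Lemma theta_ode : exists C : ps R, forall z,
  t 0 z * t 4 z - 4 * (t 1 z * t 3 z) + 3 * t 2 z ^+ 2 = C * t 0 z ^+ 2 + 4 * theta_e * theta_K z.
Proof.
have wu := th10_unit; set w := t 1 0 in wu.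
pose W := c 4 0 * d 2 0 - d 4 0 * c 2 0.
exists (- W / (4 * w ^+ 2)) => z; rewrite /theta_e -/w.
have w4 : 4 * w ^+ 2 \is a GRing.unit by rewrite unitrM psnat_unit unitrX.
have D4 x : 2 * (t 0 x * t 4 x - 4 * (t 1 x * t 3 x) + 3 * t 2 x ^+ 2) = c 0 x * d 4 0 - d 0 x * c 4 0.
  by have := theta_det4 x 0; rewrite addr0 subr0 /rhs => <-; ring.
have D40 : c 4 0 * d 0 0 - d 4 0 * c 0 0 = 8 * (w * t 3 0).
  have := D4 0; rewrite (th_even0 0) (th_even0 1) -/w => E.
  by apply: (eq_by E); ring.
have K0 : - 2 * w ^+ 2 = c 0 0 * d 2 0 - d 0 0 * c 2 0.
  by rewrite -theta_K2 /theta_K (th_even0 0) -/w; ring.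
apply: (mulrI w4).
have -> : 4 * w ^+ 2 * (- W / (4 * w ^+ 2) * t 0 z ^+ 2 + 4 * (t 3 0 / w) * theta_K z) =
   - W * t 0 z ^+ 2 * ((4 * w ^+ 2) / (4 * w ^+ 2)) + 16 * (w * t 3 0) * theta_K z * (w / w) by ring.
rewrite !divrr// !mulr1.
apply: (eq_by (erefl (0 : ps R))); rewrite subrr.
transitivity (- ((- 2 * w ^+ 2) * (2 * (t 0 z * t 4 z - 4 * (t 1 z * t 3 z) + 3 * t 2 z ^+ 2))) + W * t 0 z ^+ 2
   - (8 * (w * t 3 0)) * (2 * theta_K z)); first by ring.
by rewrite -D40 D4 K0 theta_K2 theta_sq /W; ring.
Qed.

Lemma dz_K : dz theta_K (fun z => t 0 z * t 3 z - t 1 z * t 2 z).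
Proof.
apply: (dz_ext _ _ (dz_sub (dz_mul (dz_th 0) (dz_th 2)) (dz_mul (dz_th 1) (dz_th 1)))) => z.
  by rewrite /theta_K; ring.
by ring.
Qed.

Lemma dz_K1 : dz (fun z => t 0 z * t 3 z - t 1 z * t 2 z) (fun z => t 0 z * t 4 z - t 2 z ^+ 2).
Proof.
by apply: (dz_ext _ _ (dz_sub (dz_mul (dz_th 0) (dz_th 3)) (dz_mul (dz_th 1) (dz_th 2)))) => z //; ring.
Qed.

Lemma theta_ode1 (C : ps R) :
  (forall z, t 0 z * t 4 z - 4 * (t 1 z * t 3 z) + 3 * t 2 z ^+ 2 =
             C * t 0 z ^+ 2 + 4 * theta_e * theta_K z) ->
  forall z, t 0 z * t 5 z - 3 * (t 1 z * t 4 z) + 2 * (t 2 z * t 3 z) =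
            2 * C * (t 0 z * t 1 z) + 4 * theta_e * (t 0 z * t 3 z - t 1 z * t 2 z).
Proof.
move=> ode z.
have dl := dz_add (dz_sub (dz_mul (dz_th 0) (dz_th 4)) (dz_scale 4 (dz_mul (dz_th 1) (dz_th 3))))
  (dz_scale 3 (dz_mul (dz_th 2) (dz_th 2))).
have dr := dz_add (dz_mul (dz_cst C) (dz_mul (dz_th 0) (dz_th 0))) (dz_mul (dz_cst (4 * theta_e)) dz_K).
have E := dz_uniq dl dr ode z.
by apply: (eq_by E) => /=; ring.
Qed.

Lemma theta_ode2 (C : ps R) :
  (forall z, t 0 z * t 4 z - 4 * (t 1 z * t 3 z) + 3 * t 2 z ^+ 2 =
             C * t 0 z ^+ 2 + 4 * theta_e * theta_K z) ->
  forall z, t 0 z * t 6 z - 2 * (t 1 z * t 5 z) - t 2 z * t 4 z + 2 * t 3 z ^+ 2 =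
            2 * C * (t 1 z ^+ 2 + t 0 z * t 2 z) + 4 * theta_e * (t 0 z * t 4 z - t 2 z ^+ 2).
Proof.
move=> /theta_ode1 ode z.
have dl := dz_add (dz_sub (dz_mul (dz_th 0) (dz_th 5)) (dz_scale 3 (dz_mul (dz_th 1) (dz_th 4))))
  (dz_scale 2 (dz_mul (dz_th 2) (dz_th 3))).
have dr := dz_add (dz_mul (dz_cst (2 * C)) (dz_mul (dz_th 0) (dz_th 1))) (dz_mul (dz_cst (4 * theta_e)) dz_K1).
have E := dz_uniq dl dr ode z.
by apply: (eq_by E) => /=; ring.
Qed.

(** Serves to compute D of [theta_e]: the heat equation turns D theta'''(0) into the fifth
    derivative at 0. *)
Lemma th50 (C : ps R) :
  (forall z, t 0 z * t 4 z - 4 * (t 1 z * t 3 z) + 3 * t 2 z ^+ 2 =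
             C * t 0 z ^+ 2 + 4 * theta_e * theta_K z) ->
  t 1 0 * t 5 0 = t 3 0 ^+ 2 - C * t 1 0 ^+ 2.
Proof.
move=> /theta_ode2/(_ 0); rewrite (th_even0 0) (th_even0 1) (th_even0 2) => E.
by apply: (mulfI (psnat_neq0 R 1)); apply: oppr_inj; apply: (eq_by E); ring.
Qed.

(* (d/dx + d/dy) and its square applied to theta_product *)
Lemma theta_product1 x y : 2 * t 1 0 ^+ 2 * (t 1 (x + y) * t 0 (x - y)) =
  (t 0 x * t 3 x - t 1 x * t 2 x) * t 0 y ^+ 2 - 2 * theta_K y * (t 0 x * t 1 x)
  - ((t 0 y * t 3 y - t 1 y * t 2 y) * t 0 x ^+ 2 - 2 * theta_K x * (t 0 y * t 1 y)).
Proof.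
have dl := dz_mul (dz_cst (t 1 0 ^+ 2)) (dz_mul (dz_shiftl x (dz_th 0)) (dz_refl x (dz_th 0))).
have dr := dz_sub (dz_mul (dz_cst (theta_K x)) (dz_mul (dz_th 0) (dz_th 0)))
  (dz_mul dz_K (dz_cst (t 0 x ^+ 2))).
have E1 := dz_uniq dl dr (theta_product x) y.
have dl' := dz_mul (dz_cst (t 1 0 ^+ 2)) (dz_mul (dz_shiftr y (dz_th 0)) (dz_shiftr (- y) (dz_th 0))).
have dr' := dz_sub (dz_mul dz_K (dz_cst (t 0 y ^+ 2)))
  (dz_mul (dz_cst (theta_K y)) (dz_mul (dz_th 0) (dz_th 0))).
have E2 := dz_uniq dl' dr' (fun x => theta_product x y) x.
have {}E1 := congr2 (fun a b => a + b) E1 E2.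
by apply: (eq_by E1) => /=; ring.
Qed.

Lemma theta_product2 x y : 4 * t 1 0 ^+ 2 * (t 2 (x + y) * t 0 (x - y)) =
  (t 0 x * t 4 x - t 2 x ^+ 2) * t 0 y ^+ 2 - 2 * theta_K y * (t 1 x ^+ 2 + t 0 x * t 2 x)
  - ((t 0 y * t 4 y - t 2 y ^+ 2) * t 0 x ^+ 2 - 2 * theta_K x * (t 1 y ^+ 2 + t 0 y * t 2 y))
  + 4 * ((t 0 x * t 3 x - t 1 x * t 2 x) * (t 0 y * t 1 y)
       - (t 0 y * t 3 y - t 1 y * t 2 y) * (t 0 x * t 1 x)).
Proof.
have dl := dz_mul (dz_cst (2 * t 1 0 ^+ 2)) (dz_mul (dz_shiftl x (dz_th 1)) (dz_refl x (dz_th 0))).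
have sq := dz_mul (@dz_th R 0) (@dz_th R 0).
have sq1 := dz_mul (@dz_th R 0) (@dz_th R 1).
have dr := dz_sub (dz_sub (dz_mul (dz_cst (t 0 x * t 3 x - t 1 x * t 2 x)) sq)
     (dz_mul (dz_mul (dz_cst 2) dz_K) (dz_cst (t 0 x * t 1 x))))
  (dz_sub (dz_mul dz_K1 (dz_cst (t 0 x ^+ 2))) (dz_mul (dz_cst (2 * theta_K x)) sq1)).
have E1 := dz_uniq dl dr (theta_product1 x) y.
have dl' := dz_mul (dz_cst (2 * t 1 0 ^+ 2)) (dz_mul (dz_shiftr y (dz_th 1)) (dz_shiftr (- y) (dz_th 0))).
have dr' := dz_sub (dz_sub (dz_mul dz_K1 (dz_cst (t 0 y ^+ 2)))
     (dz_mul (dz_cst (2 * theta_K y)) sq1))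
  (dz_sub (dz_mul (dz_cst (t 0 y * t 3 y - t 1 y * t 2 y)) sq)
     (dz_mul (dz_mul (dz_cst 2) dz_K) (dz_cst (t 0 y * t 1 y)))).
have E2 := dz_uniq dl' dr' (fun x => theta_product1 x y) x.
have {}E1 := congr2 (fun a b => a + b) E1 E2.
by apply: (eq_by E1); rewrite /= /theta_K; ring.
Qed.

(* division of theta_product by x - y as y tends to x *)
Lemma theta_double x : t 1 0 ^+ 3 * t 0 (x + x) =
  t 0 x * (t 0 x ^+ 2 * t 3 x - 3 * (t 0 x * t 1 x * t 2 x) + 2 * t 1 x ^+ 3).
Proof.
have dl := dz_mul (dz_cst (t 1 0 ^+ 2)) (dz_mul (dz_shiftl x (dz_th 0)) (dz_refl x (dz_th 0))).
have dr := dz_sub (dz_mul (dz_cst (theta_K x)) (dz_mul (dz_th 0) (dz_th 0)))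
  (dz_mul dz_K (dz_cst (t 0 x ^+ 2))).
have := dz_uniq dl dr (theta_product x) x; rewrite subrr /= (th_even0 0) => E.
apply: oppr_inj; apply: (eq_by E); rewrite /theta_K; ring.
Qed.

Lemma dz_double_th j : dz (fun x => t j (x + x)) (fun x => 2 * t j.+1 (x + x)).
Proof. exact: dz_double (dz_th j). Qed.

Lemma theta_double1 x : 2 * t 1 0 ^+ 3 * t 1 (x + x) =
  t 0 x ^+ 3 * t 4 x - 3 * (t 0 x ^+ 2 * t 2 x ^+ 2) + 2 * t 1 x ^+ 4.
Proof.
have dl := dz_mul (dz_cst (t 1 0 ^+ 3)) (dz_double_th 0).
have dc := dz_mul (dz_th 1) (dz_mul (dz_th 1) (@dz_th R 1)).
have dr := dz_mul (@dz_th R 0) (dz_add (dz_sub (dz_mul (dz_mul (dz_th 0) (dz_th 0)) (dz_th 3))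
  (dz_scale 3 (dz_mul (dz_mul (dz_th 0) (dz_th 1)) (dz_th 2)))) (dz_scale 2 dc)).
have E := dz_uniq dl dr (fun x => theta_double x) x.
by apply: (eq_by E) => /=; ring.
Qed.

Lemma theta_double2 x : 4 * t 1 0 ^+ 3 * t 2 (x + x) =
  t 0 x ^+ 3 * t 5 x + 3 * (t 0 x ^+ 2 * t 1 x * t 4 x) - 6 * (t 0 x ^+ 2 * t 2 x * t 3 x)
  - 6 * (t 0 x * t 1 x * t 2 x ^+ 2) + 8 * (t 1 x ^+ 3 * t 2 x).
Proof.
have dl := dz_mul (dz_cst (2 * t 1 0 ^+ 3)) (dz_double_th 1).
have ds j := dz_mul (dz_th j) (@dz_th R j).
have dr := dz_add (dz_sub (dz_mul (dz_mul (dz_th 0) (ds 0)) (@dz_th R 4))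
  (dz_scale 3 (dz_mul (ds 0) (ds 2)))) (dz_scale 2 (dz_mul (ds 1) (ds 1))).
have E := dz_uniq dl dr _ x.
apply: eq_by; first apply: E.
  by move=> z; rewrite theta_double1; ring.
by move=> /=; ring.
Qed.

End ThetaIdentities.

(** * The series R and t at a torsion point *)

Section SeriesInJets.
Variables (A : comUnitRingType) (F : fieldType) (f : {rmorphism A -> F}).
Hypotheses (three0 : 3 != 0 :> F).
Variables (a0 a1 a2 a3 a4 b1 b3 : A).
Hypothesis u1 : a1 \is a GRing.unit.
Hypotheses (f0 : f a0 != 0) (f1 : f a1 != 0).
Let J1 := f a1 / f a0.
Let J2 := f a2 / f a0.
Let J3 := f a3 / f a0.
Let J4 := f a4 / f a0.
Let e := f (b3 / b1) / 3.

(** Clearing theta^4 writes wp'' as the image of a power series, so that its nonvanishing can be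
    read off a constant term. *)
Lemma wp2_numerator :
  f (- (a4 * (a0 * a0 * a0) - 4 * (a1 * a3 * a0 * a0) - 3 * (a2 * a2 * a0 * a0)
     + 12 * (a1 * a1 * a2 * a0) - 6 * (a1 * a1 * a1 * a1))) = f a0 ^+ 4 * jp2 J1 J2 J3 J4.
Proof.
rewrite rmorphN !(rmorphB f, rmorphD f, rmorphM f, rmorph_nat f) /jp2 /J1 /J2 /J3 /J4.
by move: f0; move: (f a0) (f a1) (f a2) (f a3) (f a4) => c0 c1 c2 c3 c4 c00; field.
Qed.

Lemma Rseries_jet : f ((a0 * a0) / (a1 * a1) * (- (a3 / a1) + b3 / b1)) =
  (jp1 J1 J2 J3 + 3 * J1 * jp e J1 J2 - J1 ^+ 3) / J1 ^+ 3.
Proof.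
have fe : f (b3 / b1) = 3 * e by rewrite /e [RHS]mulrC divfK.
rewrite rmorphM rmorphD rmorphN fe !rmorphM rmorphV ?unitrM ?u1// (rmorphV f u1) rmorphM.
rewrite /jp1 /jp /J1 /J2 /J3; move: (e) => g.
by move: f0 f1; move: (f a0) (f a1) (f a2) (f a3) => c0 c1 c2 c3 c00 c10; field; rewrite c00 c10.
Qed.

Lemma tseries_jet : f (- ((a0 * a3) / (a1 * a1)) + a2 / a1) =
  (jp1 J1 J2 J3 - 2 * J1 * (e - jp e J1 J2)) / J1 ^+ 2.
Proof.
rewrite rmorphD rmorphN !rmorphM rmorphV ?unitrM ?u1// (rmorphV f u1) rmorphM.
rewrite /jp1 /jp /J1 /J2 /J3; move: (e) => g.
by move: f0 f1; move: (f a0) (f a1) (f a2) (f a3) => c0 c1 c2 c3 c00 c10; field; rewrite c00 c10.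
Qed.

End SeriesInJets.

(** * Leading coefficients in q *)

Section LeadingTerms.
Variables (R : realType) (a : R).
Hypotheses (sa : sin a != 0) (ca : cos a != 0).

Lemma th1_unit (z : R) : cos z != 0 -> th 1 z \is a @GRing.unit (ps R).
Proof. by move=> cz; rewrite ps_unitE th_coef0 /dsin /= expr0 mul1r mulf_neq0 ?pnatr_eq0. Qed.

Let w1 := th1_unit ca.
Let w2 : th 1 a * th 1 a \is a @GRing.unit (ps R). Proof. by rewrite unitrM w1. Qed.

Lemma RserE : Rser a = pcst (cos a ^+ 2 / (96 * sin a ^+ 4)) *
  ((th 0 a * th 0 a) / (th 1 a * th 1 a) * (- (th 3 a / th 1 a) + th 3 0 / th 1 0)) :> ps R.
Proof.
by rewrite -sscaleE /Rser !thetaE /sdiv !sinvE//; exact: th10_unit.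
Qed.

Lemma tserE : tser a = pcst (cos a / (64 * sin a ^+ 3)) *
  (- ((th 0 a * th 3 a) / (th 1 a * th 1 a)) + th 2 a / th 1 a) :> ps R.
Proof. by rewrite -sscaleE /tser !thetaE /sdiv !sinvE. Qed.

(** The quotients theta'''/theta' at a and at 0 both have constant term -1, which cancels. The next
    coefficient of the difference is 384 cos a sin^2 a / (4 cos a) = 96 sin^2 a; the prefactor of
    Rser is designed to normalise it. *)
Lemma Rser_leading : Rser a 0 = 0 /\ Rser a 1 != 0.
Proof.
rewrite RserE !pcstM.
set U := (_ / _ : ps R); set V := (- _ + _ : ps R).
have sz1 z : dsin 1 z = cos z by rewrite /dsin /= mul1r.
have sz3 z : dsin 3 z = - cos z by rewrite /dsin /= expr1 mulN1r.
have sz0 z : dsin 0 z = sin z by rewrite /dsin /= mul1r.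
have VE : (th 1 a * th 1 0) * V = - (th 3 a * th 1 0) + th 3 0 * th 1 a.
  have -> : (th 1 a * th 1 0) * V = - (th 3 a * th 1 0) * (th 1 a / th 1 a)
      + th 3 0 * th 1 a * (th 1 0 / th 1 0) by rewrite /V; ring.
  by rewrite !divrr ?mulr1//; exact: th10_unit.
have UE : U * (th 1 a * th 1 a) = th 0 a * th 0 a by rewrite /U divrK.
have two0 : 2 != 0 :> R by rewrite pnatr_eq0.
have cc : (th 1 a * th 1 0) 0 = 4 * cos a.
  by rewrite psM0 !th_coef0 !sz1 cos0; ring.
have V0 : V 0 = 0.
  have := congr1 (fun u : ps R => u 0) VE.
  rewrite psM0 cc psD psN !psM0 !th_coef0 !sz1 !sz3 cos0 => /eqP.
  have -> : - (2 * - cos a * (2 * 1)) + 2 * - 1 * (2 * cos a) = 0 :> R by ring.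
  by rewrite !mulf_eq0 pnatr_eq0 (negbTE ca) => /eqP.
have c3 : cos (3 * a) = cos a - 4 * cos a * sin a ^+ 2.
  have -> : 3 * a = a + a + a by ring.
  rewrite !cosD sinD; move: (sin2cos2 a); set s := sin a; set c := cos a => H.
  transitivity (c * c ^+ 2 - 3 * c * s ^+ 2); first by ring.
  by rewrite H; ring.
have V1 : V 1 != 0.
  have := congr1 (fun u : ps R => u 1) VE.
  rewrite psM1 cc V0 mulr0 addr0 psD psN !psM1 !th_coef0 !th_coef1 !sz1 !sz3 mulr0 cos0 c3.
  apply: contra_eq_neq => ->; rewrite mulr0 eq_sym.
  have -> : - (2 * - cos a * - (2 * (3 ^+ 1 * 1)) + - (2 * (3 ^+ 3 * - (cos a - 4 * cos a * sin a ^+ 2))) * (2 * 1)) +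
    (2 * - 1 * - (2 * (3 ^+ 1 * (cos a - 4 * cos a * sin a ^+ 2))) + - (2 * (3 ^+ 3 * - 1)) * (2 * cos a)) =
    384 * cos a * sin a ^+ 2 by ring.
  by rewrite !mulf_neq0 ?pnatr_eq0 ?expf_neq0.
have U0 : U 0 != 0.
  have := congr1 (fun u : ps R => u 0) UE; rewrite !psM0 !th_coef0 !sz0.
  by apply: contra_eq_neq => ->; rewrite mul0r eq_sym !mulf_neq0.
split; first by rewrite psM0 V0 !mulr0.
by rewrite psM1 V0 mulr0 addr0 !mulf_neq0// ?invr_eq0 ?mulf_neq0 ?expf_neq0// pnatr_eq0.
Qed.

(** The constant term is 32 sin^4 a + 128 sin^2 a cos^2 a + 96 cos^4 a, hence positive. This gives
    wp''(a) != 0, so one may divide by the slope s. *)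
Lemma wp2_numerator_unit :
  - (th 4 a * (th 0 a * th 0 a * th 0 a) - 4 * (th 1 a * th 3 a * th 0 a * th 0 a)
     - 3 * (th 2 a * th 2 a * th 0 a * th 0 a)
     + 12 * (th 1 a * th 1 a * th 2 a * th 0 a) - 6 * (th 1 a * th 1 a * th 1 a * th 1 a))
  \is a @GRing.unit (ps R).
Proof.
rewrite ps_unitE psN psB psD !psB !psM0 !psnat0 !th_coef0.
have sz1 z : dsin 1 z = cos z by rewrite /dsin /= mul1r.
have sz3 z : dsin 3 z = - cos z by rewrite /dsin /= expr1 mulN1r.
have sz0 z : dsin 0 z = sin z by rewrite /dsin /= mul1r.
have sz2 z : dsin 2 z = - sin z by rewrite /dsin /= expr1 mulN1r.
have sz4 z : dsin 4 z = sin z by rewrite /dsin /= expr2 mulrNN !mul1r.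
rewrite sz0 sz1 sz2 sz3 sz4; set s := sin a; set c := cos a.
set u := - _; have -> : u = 32 * (s ^+ 4) + 128 * (c * s) ^+ 2 + 96 * c ^+ 4 by rewrite /u; ring.
have s4 : 0 < s ^+ 4 by rewrite exprn_even_gt0.
have c4 : 0 < c ^+ 4 by rewrite exprn_even_gt0.
have cs : 0 < (c * s) ^+ 2 by rewrite exprn_even_gt0//= mulf_neq0.
by rewrite gt_eqF// !addr_gt0// mulr_gt0.
Qed.

End LeadingTerms.

Section TorsionAngles.
Variable R : realType.

Lemma th_period (k : int) (z : R) : exists s : ps R, s \is a GRing.unit /\
  forall j, th j (k%:~R * pi - z) = s * th j (- z).
Proof.
have [s [su sE]] := th_addpi R k; exists s; split=> // i.
by rewrite addrC sE.
Qed.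

Lemma sin_int_pi (k : int) : sin (k%:~R * pi) = 0 :> R.
Proof.
have nat_case m : sin (m%:R * pi) = 0 :> R.
  by have := @dsin_addpi R 0 0 m; rewrite add0r /dsin /= !expr0 !mul1r sin0 mulr0.
case: k => m; first exact: nat_case.
by rewrite NegzE mulrNz mulNr sinN; apply/eqP; rewrite oppr_eq0; apply/eqP; exact: nat_case.
Qed.

End TorsionAngles.

(** * The differential equation at a torsion point *)

Section TorsionPoint.
Variables (R : realType) (F : fieldType) (f : {rmorphism ps R -> F}) (D : F -> F).
Hypothesis f_inj : injective f.
Hypothesis D_add : forall u v, D (u + v) = D u + D v.
Hypothesis D_mul : forall u v, D (u * v) = D u * v + u * D v.
Hypothesis D_f : forall a, D (f a) = f (qD a).
Variables (al : R) (n : nat) (k : int).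
Hypotheses (n3 : (2 < n)%N) (nal : n%:R * al = k%:~R * pi).
Hypothesis nmin : forall m, (0 < m)%N -> (m < n)%N -> sin (m%:R * al) != 0.
Hypotheses (sa : sin al != 0) (ca : cos al != 0).

Let iota : {rmorphism R -> F} := f \o @pcst R.

Lemma f_eq0 (a : ps R) : (f a == 0) = (a == 0).
Proof. by rewrite -(rmorph0 f) (inj_eq f_inj). Qed.

Lemma f_unit (a : ps R) : a \is a GRing.unit -> f a != 0.
Proof. by rewrite f_eq0; apply: contraTneq => ->; rewrite unitr0. Qed.

Let nat0 m : m.+1%:R != 0 :> F.
Proof. by rewrite -(rmorph_nat iota) fmorph_eq0 pnatr_eq0. Qed.
Let two0 : 2 != 0 :> F := nat0 1.
Let three0 : 3 != 0 :> F := nat0 2.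

Lemma regular_sin (z : R) : sin z != 0 -> f (th 0 z) != 0.
Proof. by move=> /th_unit; exact: f_unit. Qed.

Let w0 : f (th 1 0) != 0 := f_unit (th10_unit R).
Let e : ps R := theta_e R.
Let pt m : R := m%:R * al.
Let E m := zeta f (@th R) (pt m).
Let P m := wp f (@th R) e (pt m).
Let Q m := wp1 f (@th R) (pt m).
Let A := zeta f (@th R) al.
Let x := wp f (@th R) e al.
Let y := wp1 f (@th R) al.
Let v := wp2 f (@th R) al.
Let s := v / y.
Let X := x / s ^+ 2.
Let Y := y / s ^+ 3.
Let a := A / s.
Let eps := e3 f e.

Let pt1 : pt 1 = al. Proof. by rewrite /pt mul1r. Qed.
Let ptS m : al + pt m = pt m.+1. Proof. by rewrite /pt -natr1 mulrDl mul1r addrC. Qed.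

Let reg m : (0 < m)%N -> (m < n)%N -> f (th 0 (pt m)) != 0.
Proof. by move=> m0 mn; apply: regular_sin; exact: nmin. Qed.

Let regN z : f (th 0 z) != 0 -> f (th 0 (- z)) != 0.
Proof. by rewrite thN expr1 mulN1r rmorphN oppr_eq0. Qed.

Let rega : f (th 0 al) != 0. Proof. exact: regular_sin. Qed.

Let add_law u z : f (th 0 u) != 0 -> f (th 0 z) != 0 -> f (th 0 (u + z)) != 0 ->
  f (th 0 (u - z)) != 0 ->
  [/\ wp f (@th R) e u - wp f (@th R) e z != 0,
      2 * (wp f (@th R) e u - wp f (@th R) e z) *
        (zeta f (@th R) (u + z) - zeta f (@th R) u - zeta f (@th R) z) =
        wp1 f (@th R) u - wp1 f (@th R) z &
      wp f (@th R) e (u + z) = (zeta f (@th R) (u + z) - zeta f (@th R) u - zeta f (@th R) z) ^+ 2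
        - wp f (@th R) e u - wp f (@th R) e z].
Proof.
have [C ode] := theta_ode R.
exact: (wp_addition two0 three0 w0 (@theta_product R) (@theta_product1 R) (@theta_product2 R) ode).
Qed.

Let dup_law u : f (th 0 u) != 0 -> f (th 0 (u + u)) != 0 ->
  [/\ wp1 f (@th R) u != 0,
      2 * wp1 f (@th R) u * (zeta f (@th R) (u + u) - 2 * zeta f (@th R) u) = wp2 f (@th R) u &
      wp f (@th R) e (u + u) =
        (zeta f (@th R) (u + u) - 2 * zeta f (@th R) u) ^+ 2 - 2 * wp f (@th R) e u].
Proof.
have [C ode] := theta_ode R.
exact: (wp_duplication two0 three0 w0 (@theta_double R) (@theta_double1 R) (@theta_double2 R)
  ode (theta_ode1 ode)).
Qed.

Let wp_even z : wp f (@th R) e (- z) = wp f (@th R) e z.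
Proof. by apply: wpN => j u; exact: thN. Qed.
Let zeta_odd z : zeta f (@th R) (- z) = - zeta f (@th R) z.
Proof. by apply: zetaN => j u; exact: thN. Qed.
Let wp1_odd z : wp1 f (@th R) (- z) = - wp1 f (@th R) z.
Proof. by apply: wp1N => j u; exact: thN. Qed.
Let jet_parity j z : jet f (@th R) j (- z) = (-1) ^+ j * jet f (@th R) j z.
Proof. by apply: jetN => i u; exact: thN. Qed.

Let E_1 : E 1 = A. Proof. by rewrite /E pt1. Qed.
Let P_1 : P 1 = x. Proof. by rewrite /P pt1. Qed.
Let Q_1 : Q 1 = y. Proof. by rewrite /Q pt1. Qed.

Let duplication : [/\ y != 0, 2 * y * (E 2 - 2 * A) = v & P 2 = (E 2 - 2 * A) ^+ 2 - 2 * x].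
Proof.
have := dup_law rega.
by rewrite -[X in al + X]pt1 ptS => /(_ (reg (m := 2) isT n3)).
Qed.

Let y0 : y != 0. Proof. by case: duplication. Qed.

Let addition m : (1 < m)%N -> (m.+1 < n)%N ->
  [/\ x - P m != 0, 2 * (x - P m) * (E m.+1 - A - E m) = y - Q m &
      P m.+1 = (E m.+1 - A - E m) ^+ 2 - x - P m].
Proof.
move=> m1 mn; have := add_law rega (reg (ltnW m1) (ltnW mn)).
rewrite ptS => /(_ (reg (ltn0Sn m) mn)); apply.
have -> : al - pt m = - pt m.-1.
  by rewrite -[in pt m](ltn_predK m1) -ptS opprD addNKr.
by apply: regN; apply: reg; lia.
Qed.

(** The addition law for al and -(m + 1) al, whose sum is - m al and whose difference is (m + 2)
    al. *)
Let subtraction m : (0 < m)%N -> (m.+2 < n)%N -> 2 * (x - P m.+1) * (E m.+1 - A - E m) = y + Q m.+1.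
Proof.
move=> m0 mn; have := add_law rega (regN (reg (ltn0Sn m) (ltnW mn))).
rewrite opprK ptS; have -> : al - pt m.+1 = - pt m by rewrite -ptS opprD addNKr.
move=> /(_ (regN (reg m0 (ltn_trans (ltnSn m) (ltnW mn)))) (reg (ltn0Sn m.+1) mn)) [_ H _].
move: H; rewrite wp_even wp1_odd !zeta_odd !opprK => eqn.
by rewrite /y /Q -eqn /P /E /x /A; ring.
Qed.

Let v0 : v != 0.
Proof.
have := f_unit (wp2_numerator_unit sa ca).
by rewrite (wp2_numerator _ _ _ _ rega) mulf_eq0 negb_or => /andP[].
Qed.

Let s0 : s != 0. Proof. by rewrite mulf_neq0// invr_eq0. Qed.
Let v_E : v = s * y. Proof. by rewrite /s divfK. Qed.
Let fth1 : f (th 1 al) != 0. Proof. exact: f_unit (th1_unit ca). Qed.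
Let A0 : A != 0. Proof. by rewrite mulf_neq0// invr_eq0. Qed.
Let a0 : a != 0. Proof. by rewrite mulf_neq0// invr_eq0. Qed.

(** (n - 1) al is - al modulo pi, and the unit by which theta changes under the shift cancels in
    logarithmic jets. *)
Let jet_last j : jet f (@th R) j (pt n.-1) = (-1) ^+ j * jet f (@th R) j al.
Proof.
have -> : pt n.-1 = k%:~R * pi - al.
  by rewrite -nal -[in RHS](ltn_predK n3) -/(pt _) -ptS addrAC subrr add0r.
have [t [tu tE]] := th_period k al.
rewrite -jet_parity /jet !tE !rmorphM -mulf_div divff ?mul1r//; exact: f_unit.
Qed.

Lemma algebraic_relation :
  (exists p, p != 0 /\ evxy iota X Y p = 0) /\ rational iota X Y a.
Proof.
apply: (@torsion_relation _ _ iota n E P Q) => //.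
- have [_ H _] := duplication; rewrite E_1 -v_E -H; ring.
- by move=> m m1 mn; have [H1 H2 _] := addition m1 mn.
- move=> m m0 mn; case: (ltnP 1 m) => m1; first by have [_ _] := addition m1 mn.
  have -> : m = 1%N by apply/eqP; rewrite eqn_leq m1 m0.
  by have [_ _ ->] := duplication; rewrite E_1 P_1; ring.
- by rewrite /E /zeta jet_last /A /zeta; ring.
- by rewrite /P /x /wp /jp !jet_last; ring.
Qed.

Let Dth j z : 8 * D (f (th j z)) = - (f (th j.+2 z) + f (th j z)).
Proof.
have := congr1 f (th_heat j z); rewrite rmorphD rmorphN rmorphM rmorph_nat -D_f => H.
by rewrite opprD -H addrK.
Qed.

Let heat : [/\ 24 * D eps = 6 * x ^+ 2 - v - 6 * eps ^+ 2,
  24 * D x = - 4 * v + 12 * x ^+ 2 - 6 * A * y - 12 * eps * x,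
  8 * D y = - 6 * eps * y - 6 * x * y - 2 * A * v &
  8 * D v = - 8 * eps * v - 6 * y ^+ 2 - 4 * x * v - 24 * A * x * y].
Proof.
have [C ode] := theta_ode R.
have De : 24 * D eps = f C.
  have feps : f e = 3 * eps by rewrite /eps /e3 [RHS]mulrC divfK.
  have fe : f e = f (th 3 0) / f (th 1 0) by rewrite /e /theta_e rmorphM rmorphV ?th10_unit.
  transitivity (8 * D (f e)); first by rewrite feps (D_natM D_add D_mul); ring.
  rewrite fe (D_div D_mul)//.
  transitivity ((8 * D (f (th 3 0)) * f (th 1 0) - f (th 3 0) * (8 * D (f (th 1 0)))) / f (th 1 0) ^+ 2).
    have quot (d3 d1 t3 t1 : F) : t1 != 0 ->
      8 * ((d3 * t1 - t3 * d1) / t1 ^+ 2) = (8 * d3 * t1 - t3 * (8 * d1)) / t1 ^+ 2.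
      by move=> t10; field.
    exact: quot.
  (* The quotient rule and the heat equation leave the fifth derivative of theta at 0; replacing it
     introduces [C]. *)
  have H5 : f (th 1 0) * f (th 5 0) = f (th 3 0) ^+ 2 - f C * f (th 1 0) ^+ 2.
    by rewrite -rmorphM (th50 ode) rmorphB (rmorphM f C) !expr2 !(rmorphM f).
  rewrite !Dth; apply: (mulIf (expf_neq0 2 w0)); rewrite divfK ?expf_neq0//.
  by apply: (eq_by (esym H5)); ring.
have Dj j : 8 * D (jet f (@th R) j.+1 al) = - (jet f (@th R) j.+3 al - jet f (@th R) j.+1 al * jet f (@th R) 2 al).
  exact: (jet_heat D_mul rega (Dth _ _) (Dth _ _)).
have o0 := jet_ode0 three0 ode rega.
have o1 := jet_ode1 three0 (theta_ode1 ode) rega.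
have o2 := jet_ode2 three0 (theta_ode2 ode) rega.
split.
- exact: (heat_e3 (D := D) o0 De).
- exact: (heat_x D_add D_mul o0 (Dj 0) (Dj 1) De).
- exact: (heat_y D_add D_mul o0 o1 (Dj 0) (Dj 1) (Dj 2)).
- exact: (heat_v D_add D_mul o0 o1 o2 (Dj 0) (Dj 1) (Dj 2) (Dj 3)).
Qed.

Let S : ps R := Rser al.
Let S0 : S 0 = 0. Proof. by have [] := Rser_leading sa ca. Qed.
Let S1 : S 1 != 0. Proof. by have [] := Rser_leading sa ca. Qed.

Let fS : f S = iota (cos al ^+ 2 / (96 * sin al ^+ 4)) * ((Y + 3 * a * X - a ^+ 3) / a ^+ 3).
Proof.
rewrite /S (RserE ca) (rmorphM f); congr (_ * _).
rewrite (Rseries_jet three0 (th 2 al) _ _ _ (th1_unit ca) rega fth1).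
transitivity ((y + 3 * A * x - A ^+ 3) / A ^+ 3); first by [].
rewrite /Y /X /a; move: (s) s0 (A) A0 (x) (y) => s' s0' A' A0' x' y'.
by field; rewrite A0' s0'.
Qed.

Let ft : f (tser al) = iota (cos al / (64 * sin al ^+ 3)) * ((Y + 2 * a * X) / a ^+ 2) * s
  - iota (cos al / (64 * sin al ^+ 3)) * (2 / a) * (eps / s).
Proof.
rewrite (tserE ca) (rmorphM f).
rewrite (tseries_jet _ _ (th 1 0) (th 3 0) (th1_unit ca) rega fth1).
transitivity (iota (cos al / (64 * sin al ^+ 3)) * ((y - 2 * A * (eps - x)) / A ^+ 2)); first by [].
rewrite /Y /X /a; move: (s) s0 (A) A0 (x) (y) (eps) (iota _) => s' s0' A' A0' x' y' e' c.
by field; rewrite A0' s0'.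
Qed.

Let rat := rational iota X Y.

Let rat_nat m : rat m%:R.
Proof. by rewrite -(rmorph_nat iota); exact: rational_cst. Qed.

Let rat_inv u : rat u -> rat u^-1.
Proof.
move=> ru; have [->|u0] := eqVneq u 0; first by rewrite invr0; exact: (rat_nat 0).
by apply: (@rational_div _ _ _ _ _ _ u 1) => //; [rewrite mulfV|exact: (rat_nat 1)].
Qed.

Let rat_a : rat a. Proof. by have [] := algebraic_relation. Qed.

Ltac solve_rat := repeat first [exact: rat_a | exact: rational_x | exact: rational_y | exact: rational_cst
  | exact: rat_nat | exact: (rat_nat 1) | apply: rationalD | apply: rationalN | apply: rat_inv
  | apply: rationalX | apply: rationalM].

Let rat_sigma : rat (sigma X Y a). Proof. by rewrite /sigma; solve_rat. Qed.

(** D raises weights by 2, so D / s^2 is a derivation of weight 0; it preserves the rational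
    functions of X and Y. *)
Let delta u := D u / s ^+ 2.
Let deltaE u w : D u = s ^+ 2 * w -> delta u = w.
Proof. by move=> H; rewrite /delta H mulrC mulKf// expf_neq0. Qed.

Let deltaD u w : delta (u + w) = delta u + delta w.
Proof. by rewrite /delta D_add mulrDl. Qed.
Let deltaM u w : delta (u * w) = delta u * w + u * delta w.
Proof. by rewrite /delta D_mul mulrDl mulrA mulrAC. Qed.
Let D_cst c : D (iota c) = 0. Proof. by rewrite D_f qD_cst rmorph0. Qed.
Let delta_cst c : delta (iota c) = 0. Proof. by rewrite /delta D_cst mul0r. Qed.

Let rat_deltaX : rat (delta X).
Proof.
have [he hx hy hv] := heat.
rewrite (deltaE (heat_X two0 three0 D_mul hx hy hv y0 s0 v_E)).
by solve_rat.
Qed.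

Let rat_deltaY : rat (delta Y).
Proof.
have [he hx hy hv] := heat.
rewrite (deltaE (heat_Y two0 D_mul hy hv y0 s0 v_E)).
by solve_rat.
Qed.

Let rat_S : rat (f S). Proof. by rewrite fS; solve_rat. Qed.

Let H := delta (f S).
Let rat_H : rat H.
Proof. exact: (rational_der deltaD deltaM delta_cst rat_deltaX rat_deltaY rat_S). Qed.

Let DS0 : D (f S) != 0.
Proof.
rewrite D_f f_eq0; apply/eqP => /(congr1 (fun u : ps R => u 1)); rewrite /qD mul1r => /eqP.
by rewrite (negbTE S1).
Qed.

Let H0 : H != 0. Proof. by rewrite mulf_neq0// invr_eq0 expf_neq0. Qed.

Let der u := D u / D (f S).
Let derD u w : der (u + w) = der u + der w.
Proof. by rewrite /der D_add mulrDl. Qed.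
Let derM u w : der (u * w) = der u * w + u * der w.
Proof. by rewrite /der D_mul mulrDl mulrA mulrAC. Qed.
Let der_cst c : der (iota c) = 0. Proof. by rewrite /der D_cst mul0r. Qed.

Let derE u : der u = H^-1 * delta u.
Proof.
rewrite /der /H /delta; move: (D u) (D (f S)) DS0 (s) s0 => d1 d2 d20 s' s0'.
by field; rewrite d20 s0'.
Qed.

(** [der] is d/dS: by the chain rule D(T(S)) is T'(S) times D S. *)
Let der_comp (T : ps R) : der (f (pcomp T S)) = f (pcomp (pder T) S).
Proof.
rewrite /der !D_f !qDE pder_comp// mulrCA rmorphM mulfK//.
by rewrite -qDE -D_f.
Qed.

Let iter_der_comp (T : ps R) i : iter i der (f (pcomp T S)) = f (pcomp (iter i (@pder R) T) S).
Proof. by elim: i => // i IH; rewrite !iterS IH der_comp. Qed.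

Theorem compositional_Dfinite (T : ps R) : pcomp T S = tser al -> Dfinite T.
Proof.
move=> TS; have [[p [p0 evp]] _] := algebraic_relation.
have [he hx hy hv] := heat.
have hm1 := deltaE (heat_m1 two0 D_mul hy hv y0 s0 v_E).
have hm2 := deltaE (heat_m2 two0 three0 D_mul he hy hv y0 s0 v_E).
have rd u : rat (delta u) -> rat (der u).
  by rewrite derE => ru; apply: rationalM => //; exact: rat_inv.
have [|||||||||m [Pm [PmN Pm0]]] := dependent_derivatives derD derM der_cst p0 evp (rd _ rat_deltaX) (rd _ rat_deltaY) rat_S
  (m1 := s) (m2 := eps / s)
  (a1 := H^-1 * sigma X Y a) (a2 := H^-1 * - 4^-1) (a3 := H^-1 * ((6 * X ^+ 2 - Y) / 24))
  (a4 := H^-1 * - sigma X Y a) (t1 := iota (cos al / (64 * sin al ^+ 3)) * ((Y + 2 * a * X) / a ^+ 2))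
  (t2 := - (iota (cos al / (64 * sin al ^+ 3)) * (2 / a))) (t := f (tser al)).
- by apply: rationalM; [exact: rat_inv|].
- by apply: rationalM; [exact: rat_inv|solve_rat].
- by apply: rationalM; [exact: rat_inv|solve_rat].
- by apply: rationalM; [exact: rat_inv|exact: rationalN].
- by solve_rat.
- by solve_rat.
- have gen (h g b c d : F) : h * (g * b - c * d) = h * g * b + h * - d * c by ring.
  by rewrite derE hm1; exact: gen.
- have gen (h g b c d : F) : h * (g * b - c * d) = h * g * b + h * - c * d by ring.
  by rewrite derE hm2; exact: gen.
- by rewrite ft mulNr.
exists m, Pm; split=> //.
pose G : ps R := \sum_(i < m.+1) (spmul (Pm i) (iter i (@pder R) T) : ps R).
(* Substituting S is injective and turns d/dq acting on T into [der] acting on tser, where the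
   relation is known. *)
suff G0 : G = 0.
  by move=> j; have := congr1 (fun u : ps R => u j) G0; rewrite /G ps_sum.
apply: (pcomp_inj S0 S1); apply: f_inj; rewrite rmorph0 -[RHS]Pm0.
rewrite (pcomp_sum m.+1 (fun i => spmul (Pm i) (iter i (@pder R) T))) rmorph_sum.
apply: eq_bigr => i _; rewrite pcomp_spmul// rmorphM -TS iter_der_comp.
by congr (_ * _); rewrite -horner_map -map_poly_comp.
Qed.

End TorsionPoint.

Theorem mainTheorem8 (R : realType) (M N : int) :
  N != 0 ->
  ~ (exists k : int, 2 * (M%:~R : R) / N%:~R = k%:~R) ->
  (exists T : fps R, scomp T (Rser (alphaMN R M N)) =1 tser (alphaMN R M N)) /\
  (forall T : fps R,
     scomp T (Rser (alphaMN R M N)) =1 tser (alphaMN R M N) -> Dfinite T).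
Proof.
move=> N0 MN; set al := alphaMN R M N.
have N0R : N%:~R != 0 :> R by rewrite intr_eq0.
have pi0 : pi != 0 :> R by rewrite gt_eqF// pi_gt0.
(* This is the hypothesis that 2M/N is not an integer; it forces both sin al and cos al to be
   nonzero. *)
have s2 : sin (2 * al) != 0.
  apply/eqP => /sin_eq0[k kE]; apply: MN; exists k; apply: (mulIf pi0); rewrite -kE.
  by rewrite /al /alphaMN !mulrA.
have sa : sin al != 0.
  by apply: contraNneq s2 => s0; rewrite mulr_natl mulr2n sinD s0 mul0r mulr0 addr0.
have ca : cos al != 0.
  by apply: contraNneq s2 => c0; rewrite mulr_natl mulr2n sinD c0 mul0r mulr0 addr0.
have [Se0 Se1] := Rser_leading sa ca.
split.
  have [T TE] := pcomp_surj (tser al) Se0 Se1.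
  by exists T => j; rewrite -TE.
move=> T TE.
(* The order of al modulo pi divides |N|; the least n makes theta regular at all smaller multiples
   of al. *)
have ex : exists n, (0 < n)%N && (sin (n%:R * al) == 0).
  exists `|N|%N; rewrite absz_gt0 N0 /=; apply/eqP.
  have -> : `|N|%:R * al = (sgz N * M)%:~R * pi.
    rewrite /al /alphaMN mulrA; congr (_ * _).
    rewrite -[(`|N|%:R)]/((`|N|%N : int)%:~R) abszEsg intrM intrM; field.
    exact: N0R.
  exact: sin_int_pi.
have [n /andP[n0 /eqP sn] nmin] := ex_minnP ex.
have [k kE] := sin_eq0 sn.
have nz m : (0 < m)%N -> (m < n)%N -> sin (m%:R * al) != 0.
  by move=> m0 mn; apply: contraL mn => sm; rewrite -leqNgt; apply: nmin; rewrite m0.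
(* Orders 1 and 2 are excluded by sin al != 0 and sin(2 al) != 0. *)
have n3 : (2 < n)%N.
  rewrite ltnNge; apply/negP => n2; have : n = 1%N \/ n = 2 by lia.
  by case=> nE; move: sn; rewrite nE ?mul1r; apply/eqP.
have tofrac_injective : injective (@tofrac (ps R)).
  by move=> u w /eqP; rewrite tofrac_eq => /eqP.
have H := compositional_Dfinite tofrac_injective (derF_add (@qD_add R) (@qD_mul R))
  (derF_mul (@qD_mul R)) (derF_tofrac (@qD_mul R)) n3 kE nz sa ca.
by apply: (H T); apply/funext.
Qed.
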